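(* Let $\tau_\omega$ be a singular trace on $\mathcal B(\mathcal H)$. For any $a,b$ in the domain of $\tau_\omega$ and conjugate exponents $p,q\in[1,\infty]$ ($\frac1p+\frac1q=1$), there holds $$|\tau_\omega(ab)|\le\tau_\omega(|ab|)\le C_p\,\tau_\omega(|a|^p)^{1/p}\,\tau_\omega(|b|^q)^{1/q},$$ where $C_p:=1+2\frac{\sqrt{p-1}}{p}\in[1,2]$. If $\tau_\omega$ is generated by a monotone functional $\varphi$, then one can choose $C_p=1$ for every $p\in[1,\infty]$.
   Context: A singular trace on $\mathcal B(\mathcal H)$ ($\mathcal H$ an infinite-dimensional Hilbert space) is a positive tracial weight $\tau:\mathcal B(\mathcal H)_+\to[0,\infty]$ (additive, positively homogeneous, $\tau(x^*x)=\tau(xx^* )$) vanishing on finite rank projections; its domain is the two-sided ideal (contained in the compact operators) spanned by the positive elements on which $\tau$ is finite, and $\tau$ extends linearly to it. For exponent $\infty$, $\tau_\omega(|x|^\infty)^{1/\infty}$ is understood as $\|x\|$, and $C_\infty=1$. For a compact operator $x$, $\mu_x(t)=\mu_n(x)$ for $t\in[n,n+1)$, where $\mu_n(x)$, $n\ge0$, are the eigenvalues of $|x|$ in non-increasing order with multiplicity. It is known that for a singular trace $\tau_\omega$ there is a unique positive linear functional $\varphi$ (with values in $[0,\infty]$) on the cone of positive non-increasing right-continuous functions on $[0,\infty)$ which is dilation invariant, i.e. $\alpha\varphi(D_\alpha\mu)=\varphi(\mu)$ for $\alpha>0$ where $D_\alpha\mu(t)=\mu(\alpha t)$, and such that $\tau_\omega(x)=\varphi(\mu_x)$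 for every positive compact $x$; $\tau_\omega$ is said to be generated by $\varphi$. With $S^\uparrow_\mu(x)=\int_0^x\mu(t)\,dt$ and $S^\downarrow_\mu(x)=\int_x^\infty\mu(t)\,dt$, $\varphi$ is called monotone if it is either increasing ($S^\uparrow_\mu\le S^\uparrow_\nu$ pointwise implies $\varphi(\mu)\le\varphi(\nu)$) or decreasing ($S^\downarrow_\mu\le S^\downarrow_\nu$ pointwise implies $\varphi(\mu)\le\varphi(\nu)$). *)

(* Defs.v *)
From HB Require Import structures.
From mathcomp Require Import all_boot all_order all_algebra.
From mathcomp Require Import all_classical all_reals all_analysis.
From mathcomp Require Export complex.

Set Implicit Arguments.
Unset Strict Implicit.
Unset Printing Implicit Defensive.

Import Order.TTheory GRing.Theory Num.Theory numFieldNormedType.Exports.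

Local Open Scope classical_set_scope.
Local Open Scope ring_scope.
Local Open Scope complex_scope.
Local Open Scope card_scope.

Section LinearAlgebra.
Context {R : realType} {H : lmodType R[i]}.

Definition lspan n (e : 'I_n -> H) : set H :=
  [set v | exists c : 'I_n -> R[i], v = \sum_(i < n) c i *: e i].

Definition lin_indep n (e : 'I_n -> H) : Prop :=
  forall c : 'I_n -> R[i], \sum_(i < n) c i *: e i = 0 -> forall i, c i = 0.

Definition fin_dim (A : set H) : Prop :=
  exists n (e : 'I_n -> H), A `<=` lspan e.

(* The eigenspace of T at l has dimension k; k = 0 when l is not an
   eigenvalue. *)
Definition eigen_mult (T : H -> H) (l : R[i]) (k : nat) : Prop :=
  exists e : 'I_k -> H, lin_indep e /\ [set v | T v = l *: v] = lspan e.

Definition poly_op (P : {poly R}) (T : H -> H) : H -> H :=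
  fun v => \sum_(i < size P) (P`_i)%:C *: iter i T v.

End LinearAlgebra.

Section NormedOperators.
Context {R : realType} {H : completeNormedModType R[i]}.

Definition bounded_op : set (H -> H) := [set T | linear T /\ continuous T].

Definition compact_op : set (H -> H) :=
  [set T | linear T /\ compact (closure (T @` [set v | `|v| <= 1]))].

(* In a normed space over R[i] the norm is R[i]-valued (with zero imaginary
   part), whence the real part. *)
Definition opnorm (T : H -> H) : R :=
  sup [set complex.Re `|T v| | v in [set v : H | `|v| <= 1]].

(* Continuous functional calculus: f(T) is the operator-norm limit of P_n(T)
   for polynomials P_n converging to f uniformly on [0, ||T||].  It is
   meaningful for T positive and f continuous on [0, +oo[. *)
Definition is_fcalc (f : R -> R) (T S : H -> H) : Prop :=
  bounded_op S /\
  exists P : nat -> {poly R},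
    {uniform `[0, opnorm T], (fun n t => (P n).[t]) @ \oo --> (f : R -> R^o)} /\
    opnorm (poly_op (P n) T - S) @[n --> \oo] --> (0 : R).

Definition fcalc (f : R -> R) (T : H -> H) : H -> H :=
  xget (fun=> 0) [set S | is_fcalc f T S].

Definition op_pow (T : H -> H) (r : R) : H -> H := fcalc (fun t => t `^ r) T.

End NormedOperators.

(* d is the inner product, linear in its first argument. *)
Section HilbertOperators.
Context {R : realType} {H : completeNormedModType R[i]}.
Variable d : {dot H for Num.conj}.

Definition adj (T : H -> H) : H -> H :=
  xget (fun=> 0)
    [set S | bounded_op S /\ forall v w, d (T v) w = d v (S w)].

(* The order of R[i] makes 0 <= z imply that z is real; on a complex space
   this also forces T to be self-adjoint. *)
Definition pos_op : set (H -> H) :=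
  [set T | bounded_op T /\ forall v, 0 <= d (T v) v].

Definition absop (T : H -> H) : H -> H := fcalc Num.sqrt (adj T \o T).

Definition finrank_proj : set (H -> H) :=
  [set P | [/\ bounded_op P, P \o P = P, adj P = P & fin_dim (range P)]].

(* mu lists the positive eigenvalues of |x| in non-increasing order, each as
   often as its multiplicity; if they are finitely many, the remaining terms
   are 0, which is then an eigenvalue of infinite multiplicity when H is
   infinite-dimensional and x is compact. *)
Definition is_singular_values (x : H -> H) (mu : R^nat) : Prop :=
  [/\ nonincreasing_seq mu, (forall n, 0 <= mu n) &
      forall l : R, 0 < l ->
        exists k, eigen_mult (absop x) l%:C k /\ [set n | mu n = l] #= `I_k].

Definition singular_values (x : H -> H) : R^nat :=
  xget (fun=> 0) [set mu | is_singular_values x mu].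

(* Functions on [0, +oo[ are represented by functions on R that vanish on the
   negative reals. *)
Definition sv_fun (x : H -> H) : R -> R :=
  fun t => if 0 <= t then singular_values x (Num.truncn t) else 0.

Local Open Scope ereal_scope.

Section Trace.
Variable tau : (H -> H) -> \bar R.

(* An element of the domain, as a combination of positive operators of finite
   trace, together with the corresponding value of the linear extension. *)
Definition is_tr_value (x : H -> H) (z : R[i]) : Prop :=
  exists n (c : 'I_n -> R[i]) (y : 'I_n -> H -> H),
    [/\ forall i, pos_op (y i) /\ tau (y i) < +oo,
        x = (\sum_(i < n) c i *: y i)%R &
        z = (\sum_(i < n) c i * (fine (tau (y i)))%:C)%R].

Definition tr_dom : set (H -> H) := [set x | exists z, is_tr_value x z].

Definition tr_ext (x : H -> H) : R[i] := xget 0%R [set z | is_tr_value x z].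

Record singular_trace : Prop := {
  tr_ge0 : forall x, pos_op x -> 0 <= tau x ;
  tr_add : forall x y, pos_op x -> pos_op y -> tau (x + y)%R = tau x + tau y ;
  tr_hom : forall (c : R) x, (0 <= c)%R -> pos_op x ->
    tau (c%:C *: x)%R = c%:E * tau x ;
  tr_comm : forall x, bounded_op x -> tau (adj x \o x) = tau (x \o adj x) ;
  tr_finrank : forall e, finrank_proj e -> tau e = 0 ;
  tr_compact : tr_dom `<=` compact_op }.

(* tau(|x|^p)^(1/p), read as ||x|| for p = +oo; only used for 1 <= p. *)
Definition tr_norm (p : \bar R) (x : H -> H) : \bar R :=
  match p with
  | r%:E => (tau (op_pow (absop x) r)) `^ r^-1
  | +oo => (opnorm x)%:E
  | -oo => 0
  end.

End Trace.
End HilbertOperators.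

Section Functionals.
Context {R : realType}.
Implicit Types (f g : R -> R) (phi : (R -> R) -> \bar R).

Definition mono_cone : set (R -> R) :=
  [set f : R -> R | [/\ forall t : R, t < 0 -> f t = 0,
               forall t : R, 0 <= t -> 0 <= f t,
               forall s t : R, 0 <= s -> s <= t -> f t <= f s &
               forall t : R, 0 <= t -> f u @[u --> t^'+] --> f t]].

Local Open Scope ereal_scope.

Record dilation_functional phi : Prop := {
  df_ge0 : forall f, mono_cone f -> 0 <= phi f ;
  df_add : forall f g, mono_cone f -> mono_cone g ->
    phi (f \+ g)%R = phi f + phi g ;
  df_hom : forall (c : R) f, (0 <= c)%R -> mono_cone f ->
    phi (fun t => c * f t)%R = c%:E * phi f ;
  df_dilation : forall (a : R) f, (0 < a)%R -> mono_cone f ->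
    a%:E * phi (fun t => f (a * t)%R) = phi f }.

Definition generated_by (H : completeNormedModType R[i])
    (d : {dot H for Num.conj}) (tau : (H -> H) -> \bar R) phi : Prop :=
  dilation_functional phi /\
  forall x, pos_op d x -> compact_op x -> tau x = phi (sv_fun d x).

Definition S_up f (x : R) : \bar R :=
  \int[lebesgue_measure]_(t in `[0%R, x]) (f t)%:E.

Definition S_down f (x : R) : \bar R :=
  \int[lebesgue_measure]_(t in `[x, +oo[) (f t)%:E.

Definition increasing_functional phi : Prop :=
  forall f g, mono_cone f -> mono_cone g ->
    (forall x, (0 <= x)%R -> S_up f x <= S_up g x) -> phi f <= phi g.

Definition decreasing_functional phi : Prop :=
  forall f g, mono_cone f -> mono_cone g ->
    (forall x, (0 <= x)%R -> S_down f x <= S_down g x) -> phi f <= phi g.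

Definition monotone_functional phi : Prop :=
  increasing_functional phi \/ decreasing_functional phi.

Definition holder_const (p : \bar R) : R :=
  if p is r%:E then 1 + 2 * (Num.sqrt (r - 1) / r) else 1.

End Functionals.

(* Main.v *)
Require Import Defs.
From HB Require Import structures.
From mathcomp Require Import all_boot all_order all_algebra.
From mathcomp Require Import all_classical all_reals all_analysis.
From mathcomp Require Import complex.
From mathcomp Require Import ring lra.
Set Implicit Arguments.
Unset Strict Implicit.
Unset Printing Implicit Defensive.
Import Order.TTheory GRing.Theory Num.Theory numFieldNormedType.Exports.
Local Open Scope classical_set_scope.
Local Open Scope ring_scope.
Local Open Scope complex_scope.

(* The constant 1 works for every tracial weight.  For p >= 2 put r = 2/p.
   Writing |ab| = w a |b*| v* with contractions w and v, AM-GM gives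
     2 tau|ab| <= e tau(P) + tau(|b*|^q) / e,  P = B |a|^2 B,  B = |b*|^(1-q/2).
   If e_0, ..., e_n are top eigenvectors of P, with eigenvalues lam_i, then every v
   in a* a B span(e_0, ..., e_n) satisfies |a v|^2 |B v|^2 >= lam_n |v|^4, whence
   <K v, v> >= lam_n |v|^2 for K = r |a|^p + (1-r) |b*|^q by Jensen's and Young's
   inequalities.  By Courant-Fischer the singular values of P are at most those of
   K (which is compact because tau(K) is finite), P is dominated by a conjugate of
   K by a contraction, and tau(P) <= tau(K).  Inserting scalar weights and
   optimising over them gives Hoelder's inequality; p < 2 follows by passing to
   adjoints.  For the first inequality, if th tr(x) = |tr(x)| and x = W |x|, then
   2 Re(th x) <= |x| + W |x| W*. *)

(** * Inner product *)

(** The form inequality P <= K cannot be expected, since [a] and [B] need not commute; only the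
    ordered eigenvalues compare. This is enough because a tracial weight is monotone and does not
    grow under conjugation by a contraction W: with s the square root of T, the tracial property
    turns W s s [adj W] into s [adj W] W s, which is at most T. The exponents are forced. In |b*| =
    |b*|^(1-q/2) |b*|^(q/2) the second factor has square |b*|^q, and the first exponent is
    nonnegative exactly when q <= 2, that is, when p >= 2. Jensen's inequality leads from |a|^2 to
    |a|^p through the power p/2 = 1/r, and from |b*|^(2-q) to |b*|^q through the power 1/(1-r),
    because (2-q)/(1-r) = q. At p = 2 these powers degenerate and the AM-GM step alone gives the
    bound. Contractions take the place of partial isometries throughout. They come from Douglas'
    factorisation X = W Y, available whenever |X v| <= M |Y v|, which is itself derived from a Riesz
    theorem relative to Y. *)

Section Complex.
Context {R : realType}.
Implicit Types z w : R[i].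

Lemma complex_eq z w : complex.Re z = complex.Re w ->
  complex.Im z = complex.Im w -> z = w.
Proof. by case: z w => a b [c e] /= -> ->. Qed.

Lemma ReD z w : complex.Re (z + w) = complex.Re z + complex.Re w.
Proof. by case: z w => a b [c e]. Qed.

Lemma ReN z : complex.Re (- z) = - complex.Re z.
Proof. by case: z. Qed.

Lemma ReB z w : complex.Re (z - w) = complex.Re z - complex.Re w.
Proof. by rewrite ReD ReN. Qed.

Lemma Re_realM (r : R) z : complex.Re (r%:C * z) = r * complex.Re z.
Proof. by case: z => a b /=; rewrite mul0r subr0. Qed.

Lemma Re_conj z : complex.Re (Num.conj z) = complex.Re z.
Proof. by case: z. Qed.

Lemma Re_sum (I : Type) (s : seq I) (P : pred I) (F : I -> R[i]) :
  complex.Re (\sum_(i <- s | P i) F i) = \sum_(i <- s | P i) complex.Re (F i).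
Proof.
elim/big_rec2: _ => // i a b _ <-; exact: ReD.
Qed.

Lemma Re_iM z : complex.Re ('i * z) = - complex.Im z.
Proof. by case: z => a b /=; rewrite mul0r mul1r sub0r. Qed.

Lemma cnormE z : `|z| = (complex.Re `|z|)%:C.
Proof. by rewrite normc_def. Qed.

Lemma Re_norm_ge0 z : 0 <= complex.Re `|z|.
Proof. by rewrite normc_def /= sqrtr_ge0. Qed.

Lemma Re_norm_sqr z : complex.Re `|z| ^+ 2 = complex.Re z ^+ 2 + complex.Im z ^+ 2.
Proof. by rewrite normc_def /= sqr_sqrtr// addr_ge0// sqr_ge0. Qed.

Lemma Re_normM z w : complex.Re `|z * w| = complex.Re `|z| * complex.Re `|w|.
Proof. by rewrite normrM (cnormE z) Re_realM. Qed.

Lemma Re_norm_real (r : R) : complex.Re `|r%:C| = `|r|.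
Proof. by rewrite normc_def /= expr0n addr0 sqrtr_sqr. Qed.

Lemma Re_le_norm z : complex.Re z <= complex.Re `|z|.
Proof.
rewrite normc_def /= (le_trans (ler_norm _))// -sqrtr_sqr.
by rewrite ler_sqrt ?addr_ge0 ?sqr_ge0// lerDl sqr_ge0.
Qed.

Lemma Re_norm_conj z : complex.Re `|Num.conj z| = complex.Re `|z|.
Proof. by rewrite norm_conjC. Qed.

Lemma phase z : exists2 th : R[i],
  complex.Re `|th| = 1 & th * z = (complex.Re `|z|)%:C.
Proof.
have [->|z0] := eqVneq z 0.
  by exists 1; rewrite ?normr1 ?mulr0 ?normr0.
exists (`|z| / z).
  by rewrite normrM normr_id normfV divff ?normr_eq0.
by rewrite divfK// -cnormE.
Qed.

Lemma ReIm_eq0 z : (forall th : R[i], complex.Re (th * z) = 0) -> z = 0.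
Proof.
move=> h; apply: complex_eq => /=; first by rewrite -(h 1) mul1r.
by have := h 'i; rewrite Re_iM => /eqP; rewrite oppr_eq0 => /eqP.
Qed.

End Complex.

Section Inner.
Context {R : realType} {H : completeNormedModType R[i]}.

(** The norm of [H] takes values in [R[i]]; its real part is used so that the total order and the
    arithmetic tactics of [R] apply. *)
Definition rnorm (v : H) : R := complex.Re `|v|.
Local Notation N := rnorm.

Lemma rnormE (v : H) : `|v| = (N v)%:C.
Proof. by apply: complex_eq => //=; rewrite (@ger0_Im _ `|v|). Qed.

Lemma rnorm_ge0 v : 0 <= N v.
Proof. by rewrite -ler0c -rnormE. Qed.
#[local] Hint Resolve rnorm_ge0 : core.

Lemma rnorm0 : N 0 = 0.
Proof. by rewrite /N normr0. Qed.

Lemma rnorm0_eq0 v : N v = 0 -> v = 0.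
Proof. by move=> h; apply/eqP; rewrite -normr_eq0 rnormE h. Qed.

Lemma rnorm_gt0 v : v != 0 -> 0 < N v.
Proof.
move=> v0; rewrite lt_neqAle rnorm_ge0 andbT eq_sym.
by apply: contra v0 => /eqP /rnorm0_eq0 ->.
Qed.

Lemma rnormD u v : N (u + v) <= N u + N v.
Proof. by rewrite -lecR rmorphD /= -!rnormE ler_normD. Qed.

Lemma rnormN v : N (- v) = N v.
Proof. by rewrite /N normrN. Qed.

Lemma rnormB u v : N (u - v) = N (v - u).
Proof. by rewrite -rnormN opprB. Qed.

Lemma rnormZ (c : R[i]) v : N (c *: v) = complex.Re `|c| * N v.
Proof. by rewrite /N normrZ {1}(cnormE c) Re_realM. Qed.

Lemma rnormZr (c : R) v : N (c%:C *: v) = `|c| * N v.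
Proof. by rewrite rnormZ Re_norm_real. Qed.

Variable d : {dot H for Num.conj}.
(** This ties the inner product to the norm of the type and, with completeness, makes [H] a Hilbert
    space. *)
Hypothesis d_norm : forall v : H, d v v = `|v| ^+ 2.

Lemma ipDl u v w : d (u + v) w = d u w + d v w.
Proof. by rewrite linearDl. Qed.

Lemma ipDr u v w : d w (u + v) = d w u + d w v.
Proof. by rewrite linearDr. Qed.

Lemma ipNl v w : d (- v) w = - d v w.
Proof. by rewrite linearNl. Qed.

Lemma ipNr v w : d v (- w) = - d v w.
Proof. by rewrite linearNr. Qed.

Lemma ipBl u v w : d (u - v) w = d u w - d v w.
Proof. by rewrite linearBl. Qed.

Lemma ipBr u v w : d w (u - v) = d w u - d w v.
Proof. by rewrite linearBr. Qed.

Lemma ip0l w : d 0 w = 0. Proof. by rewrite linear0l. Qed.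

Lemma ip0r w : d w 0 = 0. Proof. by rewrite linear0r. Qed.

Lemma ipZl c v w : d (c *: v) w = c * d v w.
Proof. by rewrite linearZl_LR. Qed.

Lemma ipZr c v w : d v (c *: w) = Num.conj c * d v w.
Proof. by rewrite linearZr_LR. Qed.

Lemma ipC v w : d v w = Num.conj (d w v).
Proof. by rewrite hermC /= expr0 mul1r. Qed.

Lemma ipZrr (c : R) v w : d v (c%:C *: w) = c%:C * d v w.
Proof.
rewrite ipZr; congr (_ * _).
by rewrite -[LHS]/(conjc _) conjc_real.
Qed.

Lemma ip_suml (I : Type) (s : seq I) (P : pred I) (F : I -> H) w :
  d (\sum_(i <- s | P i) F i) w = \sum_(i <- s | P i) d (F i) w.
Proof. by elim/big_rec2: _ => [|i a b _ <-]; rewrite ?ip0l// ipDl. Qed.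

Lemma ip_sumr (I : Type) (s : seq I) (P : pred I) (F : I -> H) w :
  d w (\sum_(i <- s | P i) F i) = \sum_(i <- s | P i) d w (F i).
Proof. by elim/big_rec2: _ => [|i a b _ <-]; rewrite ?ip0r// ipDr. Qed.

Lemma ipvv v : d v v = (N v ^+ 2)%:C.
Proof. by rewrite d_norm rnormE -rmorphXn. Qed.

Definition real_ip v w : R := complex.Re (d v w).
Local Notation rip := real_ip.

Lemma ripC v w : rip v w = rip w v.
Proof. by rewrite /real_ip ipC Re_conj. Qed.

Lemma ripDl u v w : rip (u + v) w = rip u w + rip v w.
Proof. by rewrite /real_ip ipDl ReD. Qed.

Lemma ripDr u v w : rip w (u + v) = rip w u + rip w v.
Proof. by rewrite /real_ip ipDr ReD. Qed.

Lemma ripNl v w : rip (- v) w = - rip v w.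
Proof. by rewrite /real_ip ipNl ReN. Qed.

Lemma ripNr v w : rip v (- w) = - rip v w.
Proof. by rewrite /real_ip ipNr ReN. Qed.

Lemma ripBl u v w : rip (u - v) w = rip u w - rip v w.
Proof. by rewrite ripDl ripNl. Qed.

Lemma ripBr u v w : rip w (u - v) = rip w u - rip w v.
Proof. by rewrite ripDr ripNr. Qed.

Lemma rip0l w : rip 0 w = 0. Proof. by rewrite /real_ip ip0l. Qed.

Lemma rip0r w : rip w 0 = 0. Proof. by rewrite /real_ip ip0r. Qed.

Lemma ripZl (c : R) v w : rip (c%:C *: v) w = c * rip v w.
Proof. by rewrite /real_ip ipZl Re_realM. Qed.

Lemma ripZr (c : R) v w : rip v (c%:C *: w) = c * rip v w.
Proof. by rewrite /real_ip ipZrr Re_realM. Qed.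

Lemma ripvv v : rip v v = N v ^+ 2.
Proof. by rewrite /real_ip ipvv. Qed.

Lemma rnormD_sqr u v : N (u + v) ^+ 2 = N u ^+ 2 + 2 * rip u v + N v ^+ 2.
Proof. by rewrite -!ripvv ripDl !ripDr (ripC v u); ring. Qed.

Lemma rnormB_sqr u v : N (u - v) ^+ 2 = N u ^+ 2 - 2 * rip u v + N v ^+ 2.
Proof. by rewrite rnormD_sqr ripNr rnormN; ring. Qed.

(** Cauchy-Schwarz, by expanding the squared norm of |v| u - |u| v; for nonzero u and v the common
    factor 2 |u| |v| cancels. *)
Lemma rip_le u v : rip u v <= N u * N v.
Proof.
have [->|v0] := eqVneq v 0; first by rewrite rip0r rnorm0 mulr0.
have [->|u0] := eqVneq u 0; first by rewrite rip0l rnorm0 mul0r.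
have Nv := rnorm_gt0 v0; have Nu := rnorm_gt0 u0.
have := sqr_ge0 (N ((N v)%:C *: u - (N u)%:C *: v)).
rewrite rnormB_sqr !rnormZr !ger0_norm// ripZl ripZr.
have -> : (N v * N u) ^+ 2 - 2 * (N v * (N u * rip u v)) + (N u * N v) ^+ 2
  = (2 * (N u * N v)) * (N u * N v - rip u v) by ring.
by rewrite pmulr_rge0 ?subr_ge0// !mulr_gt0.
Qed.

(** The phase of the inner product is absorbed into [u], whose norm does not change. *)
Lemma ip_le u v : complex.Re `|d u v| <= N u * N v.
Proof.
have [th th1 thE] := phase (d u v).
have <- : rip (th *: u) v = complex.Re `|d u v| by rewrite /real_ip ipZl thE.
by apply: le_trans (rip_le _ _) _; rewrite rnormZ th1 mul1r.
Qed.

Lemma ip_nondeg v : (forall w, d w v = 0) -> v = 0.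
Proof.
move=> h; apply: rnorm0_eq0; apply/eqP; rewrite -sqrf_eq0 -ripvv /real_ip h //.
Qed.

End Inner.

(** * Bounded operators and adjoints *)

Section Eps.
Context {R : realType}.
Implicit Types X c : R.

(** With [le_eps], the form in which limits are taken throughout: every error term is linear in e.
    If X < 0, the value e = -X / (2 (|c| + 1)) keeps the sum at most X / 2. *)
Lemma ge0_eps X c : (forall e, 0 < e -> 0 <= X + c * e) -> 0 <= X.
Proof.
move=> h; rewrite leNgt; apply/negP => X0.
have c1 : 0 < `|c| + 1 by rewrite ltr_wpDl.
have e0 : 0 < - X / 2 / (`|c| + 1) by rewrite !divr_gt0// oppr_gt0.
have := h _ e0; apply/negP; rewrite -ltNge.
apply: le_lt_trans (_ : X + (`|c| + 1) * (- X / 2 / (`|c| + 1)) < 0).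
  by rewrite lerD2l ler_wpM2r ?(ltW e0)// (le_trans (ler_norm _)) ?lerDl.
by rewrite mulrC divfK ?gt_eqF//; lra.
Qed.

Lemma le_eps X Y c : (forall e, 0 < e -> X <= Y + c * e) -> X <= Y.
Proof.
move=> h; rewrite -subr_ge0; apply: (@ge0_eps _ c) => e /h.
by rewrite -subr_ge0; congr (_ <= _); ring.
Qed.

(** First-order condition at a minimum. The test value is D / (A + 1) rather than the vertex D / A
    because A may vanish; there the quadratic equals -D^2 (A + 2) / (A + 1)^2. *)
Lemma quad_eq0 (A D : R) : 0 <= A -> (forall t, 0 <= t ^+ 2 * A - 2 * t * D) ->
  D = 0.
Proof.
move=> A0 /(_ (D / (A + 1))) h.
have A1 : 0 < A + 1 by rewrite ltr_wpDl.
apply/eqP; rewrite -sqrf_eq0 eq_le sqr_ge0 andbT.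
have : 0 <= - (D ^+ 2 * (A + 2)).
  rewrite (_ : - _ = (A + 1) ^+ 2 *
    ((D / (A + 1)) ^+ 2 * A - 2 * (D / (A + 1)) * D)).
    by rewrite mulr_ge0// sqr_ge0.
  by field; rewrite gt_eqF.
rewrite oppr_ge0 pmulr_lle0//; lra.
Qed.

Lemma le_sqr (x y : R) : 0 <= x -> 0 <= y -> x ^+ 2 <= y ^+ 2 -> x <= y.
Proof. by move=> x0 y0; rewrite ler_pXn2r ?nnegrE. Qed.

End Eps.

Lemma exists_null_seq (R : realType) : exists u_ : nat -> R,
  (forall n, 0 < u_ n) /\
  forall e, 0 < e -> exists n, forall k, (n <= k)%N -> u_ k < e.
Proof.
exists (fun n => n.+1%:R^-1); split=> [n|e e0]; first by rewrite invr_gt0.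
have [n _ hn] := near_infty_natSinv_lt (PosNum e0).
by exists n => k /hn.
Qed.

Section RawLinear.
Context {R : realType} {E F : lmodType R[i]}.
Variable T : E -> F.
Hypothesis lT : linear T.

Lemma lin0 : T 0 = 0.
Proof. by have := lT (-1) 0 0; rewrite scaler0 addr0 scaleN1r addNr. Qed.

Lemma linD u v : T (u + v) = T u + T v.
Proof. by have := lT 1 u v; rewrite !scale1r. Qed.

Lemma linZ c v : T (c *: v) = c *: T v.
Proof. by have := lT c v 0; rewrite lin0 !addr0. Qed.

Lemma linN v : T (- v) = - T v.
Proof. by rewrite -scaleN1r linZ scaleN1r. Qed.

Lemma linB u v : T (u - v) = T u - T v.
Proof. by rewrite linD linN. Qed.

Lemma lin_sum (I : Type) (s : seq I) (P : pred I) (G : I -> E) :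
  T (\sum_(i <- s | P i) G i) = \sum_(i <- s | P i) T (G i).
Proof. by elim/big_rec2: _ => [|i a b _ <-]; rewrite ?lin0// linD. Qed.
End RawLinear.

Section Bounded.
Context {R : realType} {H : completeNormedModType R[i]}.
Local Notation N := (@rnorm R H).
Implicit Types (S T : H -> H) (M : R).

Lemma addfE S T v : (S + T) v = S v + T v. Proof. by []. Qed.

Lemma oppfE T v : (- T) v = - T v. Proof. by []. Qed.

Lemma subfE S T v : (S - T) v = S v - T v. Proof. by []. Qed.

Lemma scalefE c T v : (c *: T) v = c *: T v. Proof. by []. Qed.

Lemma sumfE (I : Type) (s : seq I) (P : pred I) (F : I -> H -> H) v :
  (\sum_(i <- s | P i) F i) v = \sum_(i <- s | P i) F i v.
Proof. by elim/big_rec2: _ => // i a b _ <-. Qed.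

Definition bnd M T := forall v, N (T v) <= M * N v.

Lemma complete_seq (y : nat -> H) :
  (forall e, 0 < e -> exists n, forall m k, (n <= m)%N -> (n <= k)%N ->
     N (y m - y k) < e) ->
  exists z, forall e, 0 < e -> exists n, forall m, (n <= m)%N -> N (z - y m) < e.
Proof.
move=> h.
have /cauchy_cvgP yc : cauchy (y @ \oo).
  apply: cauchy_exP => e e0.
  have eE : e = (complex.Re e)%:C.
    by apply: complex_eq => //=; rewrite (@ger0_Im _ e)// ltW.
  have e0' : 0 < complex.Re e by rewrite -ltcR -eE.
  have [n hn] := h _ e0'.
  exists (y n); exists n => // k /= nk; rewrite -ball_normE /=.
  by rewrite eE rnormE ltcR hn.
exists (lim (y @ \oo)) => e e0.
have /cvgrPdist_lt /(_ e%:C) := yc; rewrite ltcR => /(_ e0)[n _ hn].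
by exists n => m nm; have := hn m nm; rewrite /= rnormE ltcR.
Qed.

Lemma bounded_opP T :
  bounded_op T <-> linear T /\ exists2 M, 0 <= M & bnd M T.
Proof.
split=> [[lT cT]|[lT [M M0 hM]]].
  split=> //.
  pose f : {linear H -> H} := HB.pack T (GRing.isLinear.Build _ _ _ _ T lT).
  have : bounded_near f (nbhs 0) by apply/linear_bounded_continuous.
  move/linear_boundedP/pinfty_ex_gt0 => [r r0 hr].
  have rE : r = (complex.Re r)%:C.
    by apply: complex_eq => //=; rewrite (@ger0_Im _ r)// ltW.
  exists (complex.Re r); first by rewrite -lecR -rE ltW.
  move=> v; have := hr v.
  by rewrite !rnormE rE -rmorphM /= lecR.
split=> //.
pose f : {linear H -> H} := HB.pack T (GRing.isLinear.Build _ _ _ _ T lT).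
have /linear_bounded_continuous : bounded_near f (nbhs 0).
  apply/linear_boundedP; exists M%:C; split; first by apply/complex_realP; exists M.
  move=> r Mr v; rewrite (le_trans (_ : _ <= M%:C * `|v|))//.
    by rewrite !rnormE -rmorphM lecR.
  by rewrite ler_wpM2r// ltW.
by [].
Qed.

Lemma opnorm_has_sup T : bounded_op T ->
  has_sup [set complex.Re `|T v| | v in [set v : H | `|v| <= 1]].
Proof.
move=> /bounded_opP[lT [M M0 hM]]; split.
  by exists (complex.Re `|T 0|), 0 => //=; rewrite normr0 ler01.
exists M => _ [v /= v1 <-]; apply: le_trans (hM v) _.
by rewrite ler_piMr//; move: v1; rewrite rnormE (lecR _ 1).
Qed.

Lemma opnorm_bnd T : bounded_op T -> bnd (opnorm T) T.
Proof.
move=> bT v; have [->|v0] := eqVneq v 0.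
  by rewrite (lin0 bT.1) !rnorm0 mulr0.
have Nv := rnorm_gt0 v0.
have : complex.Re `|T ((N v)^-1%:C *: v)| <= opnorm T.
  apply: ub_le_sup; first by case: (opnorm_has_sup bT).
  exists ((N v)^-1%:C *: v) => //=.
  rewrite rnormE rnormZr ger0_norm ?invr_ge0 ?rnorm_ge0// mulVf ?gt_eqF//.
rewrite (linZ bT.1) -/(N _) rnormZr ger0_norm ?invr_ge0 ?rnorm_ge0//.
by rewrite ler_pdivrMl// mulrC.
Qed.

Lemma opnorm_le T M : 0 <= M -> bnd M T -> opnorm T <= M.
Proof.
move=> M0 hM; apply: ge_sup.
  by exists (complex.Re `|T 0|), 0 => //=; rewrite normr0 ler01.
move=> _ [v /= v1 <-]; apply: le_trans (hM v) _.
by rewrite ler_piMr//; move: v1; rewrite rnormE (lecR _ 1).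
Qed.

Lemma opnorm_ge0 T : bounded_op T -> 0 <= opnorm T.
Proof.
move=> bT; apply: le_trans (_ : complex.Re `|T 0| <= _).
  exact: rnorm_ge0.
apply: ub_le_sup; first by case: (opnorm_has_sup bT).
by exists 0 => //=; rewrite normr0 ler01.
Qed.

Lemma bounded_id : bounded_op (@id H).
Proof. by apply/bounded_opP; split=> //; exists 1 => // v; rewrite mul1r. Qed.

Lemma bounded_comp S T : bounded_op S -> bounded_op T -> bounded_op (S \o T).
Proof.
move=> /bounded_opP[lS [M M0 hM]] /bounded_opP[lT [K K0 hK]].
apply/bounded_opP; split; first by move=> c u v /=; rewrite lT lS.
exists (M * K); first by rewrite mulr_ge0.
by move=> v /=; rewrite (le_trans (hM _))// -mulrA ler_wpM2l.
Qed.

Lemma bounded_add S T : bounded_op S -> bounded_op T -> bounded_op (S + T).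
Proof.
move=> /bounded_opP[lS [M M0 hM]] /bounded_opP[lT [K K0 hK]].
apply/bounded_opP; split.
  by move=> c u v; rewrite !addfE lT lS scalerDr addrACA.
exists (M + K); first by rewrite addr_ge0.
by move=> v; rewrite (le_trans (rnormD _ _))// mulrDl lerD.
Qed.

Lemma bounded_scale c T : bounded_op T -> bounded_op (c *: T).
Proof.
move=> /bounded_opP[lT [K K0 hK]].
apply/bounded_opP; split.
  move=> a u v; rewrite !scalefE lT scalerDr !scalerA.
  by rewrite (mulrC c).
exists (complex.Re `|c| * K); first by rewrite mulr_ge0// Re_norm_ge0.
by move=> v; rewrite rnormZ -mulrA ler_wpM2l// Re_norm_ge0.
Qed.

Lemma bounded_opp T : bounded_op T -> bounded_op (- T).
Proof.
move=> h; rewrite (_ : - T = -1 *: T); first exact: bounded_scale.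
by apply/funext => v; rewrite scalefE scaleN1r.
Qed.

Lemma bounded_sub S T : bounded_op S -> bounded_op T -> bounded_op (S - T).
Proof. by move=> hS hT; apply: bounded_add => //; apply: bounded_opp. Qed.

Lemma bounded0 : bounded_op (0 : H -> H).
Proof.
apply/bounded_opP; split; first by move=> c u v; rewrite scaler0 addr0.
by exists 0 => // v; rewrite mul0r rnorm0.
Qed.

Lemma bounded_sum (I : Type) (s : seq I) (P : pred I) (F : I -> H -> H) :
  (forall i, P i -> bounded_op (F i)) -> bounded_op (\sum_(i <- s | P i) F i).
Proof.
move=> h; elim/big_rec: _ => [|i x Pi bx]; first exact: bounded0.
by apply: bounded_add => //; exact: h.
Qed.

Variable d : {dot H for Num.conj}.
Hypothesis d_norm : forall v : H, d v v = `|v| ^+ 2.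
Local Notation rip := (real_ip d).

(* Minimise N(Y v)^2 - 2 Re (f v); by the parallelogram law the vectors Y v
   of a minimising sequence converge. *)
Lemma riesz (E : lmodType R[i]) (Y : E -> H) (f : E -> R[i]^o) M :
  linear Y -> linear f -> 0 <= M ->
  (forall v, complex.Re `|f v| <= M * N (Y v)) ->
  exists z, (forall e, 0 < e -> exists v, N (z - Y v) < e) /\
            (forall v, f v = d (Y v) z).
Proof.
move=> lY lf M0 fM.
pose J v := N (Y v) ^+ 2 - 2 * complex.Re (f v).
have fZ c v : f (c *: v) = c * f v by exact: (linZ lf).
have JM v : - M ^+ 2 <= J v.
  have := Re_le_norm (f v); have := fM v; rewrite /J => h1 h2.
  have := sqr_ge0 (N (Y v) - M).
  by rewrite (_ : (_ - _) ^+ 2 = N (Y v) ^+ 2 - 2 * (M * N (Y v)) + M ^+ 2); [lra|ring].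
have hJ : has_inf (range J).
  split; first by exists (J 0), 0.
  by exists (- M ^+ 2) => _ [v _ <-].
pose m := inf (range J).
have mJ v : m <= J v by apply: ge_inf; [case: hJ | exists v].
have [u_ [u_gt0 hinv]] := exists_null_seq R.
have /choice[v_ v_P] (n : nat) : exists v, J v < m + u_ n.
  have [|x [v _ <-] h] := @inf_adherent _ (range J) (u_ n) _ hJ.
    exact: u_gt0.
  by exists v.
have Jpar v w : N (Y v - Y w) ^+ 2 = 2 * (J v + J w) - 4 * J (2^-1%:C *: (v + w)).
  rewrite /J fZ Re_realM (linD lf) ReD (linZ lY) (linD lY) rnormZr.
  rewrite exprMn (rnormB_sqr d_norm) (rnormD_sqr d_norm) ger0_norm//.
  by field.
have cau n k : N (Y (v_ n) - Y (v_ k)) ^+ 2 <= 2 * (u_ n + u_ k).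
  rewrite Jpar; have := v_P n; have := v_P k.
  have := mJ (2^-1%:C *: (v_ n + v_ k)).
  move: (J _) (J _) (J _) (u_ n) (u_ k) => a b c x y; lra.
have [z hz] : exists z, forall e, 0 < e ->
    exists n, forall k, (n <= k)%N -> N (z - Y (v_ k)) < e.
  apply: complete_seq => e e0.
  have [|n hn] := hinv (e ^+ 2 / 4); first by rewrite divr_gt0// exprn_gt0.
  exists n => i j /hn hi /hn hj.
  rewrite -(ltr_pXn2r (_ : 0 < 2)%N) ?nnegrE ?rnorm_ge0 ?(ltW e0)//.
  by apply: le_lt_trans (cau i j) _; lra.
have zRe v : complex.Re (f v) = rip (Y v) z.
  apply/eqP; rewrite -subr_eq0; apply/eqP.
  (* First variation: J (v_l + t v) - J (v_l) = t^2 |Y v|^2 + 2 t (Re (Y v_l, Y v) - Re (f v))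
     exceeds -e along the minimising sequence. Replacing Y v_l by its limit z costs at most 2 |t| |Y
     v| e. *)
  apply: (@quad_eq0 _ (N (Y v) ^+ 2)); first exact: sqr_ge0.
  move=> t; set D := complex.Re (f v) - _.
  apply: (@ge0_eps _ _ (1 + 2 * `|t| * N (Y v))) => e e0.
  have [n hn] := hz e e0; have [k hk] := hinv e e0.
  pose l := maxn n k.
  have := hn l (leq_maxl _ _); have := hk l (leq_maxr _ _) => h1 h2.
  have h3 : J (v_ l) < m + e by apply: lt_le_trans (v_P l) _; rewrite lerD2l ltW.
  have h4 : J (v_ l) - e < J (v_ l + t%:C *: v).
    by apply: lt_le_trans (mJ _); lra.
  have h5 : `|t * rip (Y v) (z - Y (v_ l))| <= `|t| * (N (Y v) * e).
    rewrite normrM ler_wpM2l// ler_norml.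
    have a1 := rip_le d_norm (Y v) (z - Y (v_ l)).
    have := rip_le d_norm (- Y v) (z - Y (v_ l)).
    rewrite rnormN ripNl => a2.
    have : N (Y v) * N (z - Y (v_ l)) <= N (Y v) * e.
      by rewrite ler_wpM2l ?rnorm_ge0 ?(ltW h2).
    lra.
  move: h4; rewrite /J (linD lY) (linZ lY) (rnormD_sqr d_norm) (linD lf).
  rewrite ReD fZ Re_realM rnormZr ripZr exprMn real_normK ?num_real//.
  have := ler_normlP _ _ h5 => -[]; rewrite ripBr /D (ripC d (Y (v_ l))).
  nra.
exists z; split.
  by move=> e /hz[n /(_ n (leqnn n))]; exists (v_ n).
move=> v; apply/eqP; rewrite -subr_eq0; apply/eqP/ReIm_eq0 => th.
by rewrite mulrBr -fZ ReB zRe (linZ lY) /real_ip ipZl subrr.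
Qed.

End Bounded.

Section Adjoint.
Context {R : realType} {H : completeNormedModType R[i]}.
Local Notation N := (@rnorm R H).
Variable d : {dot H for Num.conj}.
Hypothesis d_norm : forall v : H, d v v = `|v| ^+ 2.
Local Notation rip := (real_ip d).
Local Notation adj := (adj d).
Local Notation pos_op := (pos_op d).
Implicit Types (S T : H -> H) (M : R).

(** For fixed x the functional v -> d (X v) x is bounded relative to Y, so [riesz] represents it by
    a vector in the closure of the range of Y. Membership in that closure makes the vector unique,
    hence W linear, and also yields the bound on W. Constructing this adjoint map avoids extending Y
    v -> X v by continuity; Y = id gives ordinary adjoints. *)
Lemma douglas_adj (E : lmodType R[i]) (X Y : E -> H) M :
  linear X -> linear Y -> 0 <= M -> (forall v, N (X v) <= M * N (Y v)) ->
  exists W : H -> H, [/\ linear W, bnd M W &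
    forall v x, d (X v) x = d (Y v) (W x)].
Proof.
move=> lX lY M0 XY.
have ex x : exists z, (forall e, 0 < e -> exists v, N (z - Y v) < e) /\
    (forall v, d (X v) x = d (Y v) z).
  apply: (@riesz _ _ d d_norm E Y (fun v => d (X v) x : R[i]^o) (M * N x)) => //.
  - by move=> c u v; rewrite lX ipDl ipZl.
  - by rewrite mulr_ge0 ?rnorm_ge0.
  - move=> v; rewrite (le_trans (ip_le d_norm _ _))//.
    by rewrite mulrAC ler_wpM2r ?rnorm_ge0.
have /choice[W WP] := ex.
(* A vector in the closure of the range of Y that is orthogonal to this range vanishes. *)
have uni (z z' : H) : (forall e, 0 < e -> exists v, N (z - Y v) < e) ->
    (forall v, d (Y v) z = 0) -> z = 0.
  move=> hz z0; apply: rnorm0_eq0; apply/eqP; rewrite -sqrf_eq0 eq_le sqr_ge0 andbT.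
  apply: (@le_eps _ _ _ (N z)) => e /hz[v hv].
  rewrite -(ripvv d_norm) add0r -{1}(subrK (Y v) z) ripDl [X in _ + X](_ : _ = 0).
    rewrite addr0 (le_trans (rip_le d_norm _ _))// mulrC ler_wpM2l ?rnorm_ge0//.
    exact: ltW.
  by rewrite /real_ip z0.
exists W; split.
- move=> c u v; apply/eqP; rewrite -subr_eq0; apply/eqP; apply: uni => //.
    move=> e e0.
    have c0 : 0 < complex.Re `|c| + 1 by rewrite ltr_wpDl// Re_norm_ge0.
    have e4 : 0 < e / 4 by rewrite divr_gt0.
    have [w1 h1] := (WP (c *: u + v)).1 (e / 4) e4.
    have [w2 h2] := (WP u).1 (e / 4 / (complex.Re `|c| + 1)) (divr_gt0 e4 c0).
    have [w3 h3] := (WP v).1 (e / 4) e4.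
    exists (w1 - (c *: w2 + w3)).
    rewrite (linB lY) lY.
    rewrite (_ : _ - _ - _ = (W (c *: u + v) - Y w1) -
       (c *: (W u - Y w2) + (W v - Y w3))); last first.
      rewrite scalerBr [X in _ = _ - X]addrACA -opprD !opprB.
      by rewrite addrACA [RHS]addrACA; congr (_ + _); rewrite addrC.
    rewrite (le_lt_trans (rnormD _ _))// rnormN.
    have : N (c *: (W u - Y w2) + (W v - Y w3)) <= e / 4 + e / 4.
      rewrite (le_trans (rnormD _ _))// lerD ?(ltW h3)// rnormZ.
      rewrite (le_trans (_ : _ <= (complex.Re `|c| + 1) * N (W u - Y w2)))//.
        by rewrite ler_wpM2r ?rnorm_ge0// lerDl.
      by rewrite mulrC -ler_pdivlMr// ltW.
    lra.
  move=> w; rewrite ipBr ipDr ipZr -!(WP _).2 ipDr ipZr; ring.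
- move=> x; have [->|W0] := eqVneq (W x) 0.
    by rewrite rnorm0 mulr_ge0 ?rnorm_ge0.
  have NW := rnorm_gt0 W0.
  rewrite -(ler_pM2r NW) -expr2.
  apply: (@le_eps _ _ _ (M * N x + N (W x))) => e /(WP x).1[v hv].
  rewrite -(ripvv d_norm) -{1}(subrK (Y v) (W x)) ripDl.
  have : rip (Y v) (W x) <= N (X v) * N x.
    by rewrite {1}/real_ip -(WP x).2; apply: rip_le.
  have h1 := rip_le d_norm (W x - Y v) (W x).
  have h2 : N (W x - Y v) * N (W x) <= e * N (W x).
    by rewrite ler_wpM2r ?rnorm_ge0// ltW.
  have h3 : N (Y v) <= N (W x) + e.
    rewrite -{1}(subrK (W x) (Y v)) (le_trans (rnormD _ _))// addrC.
    by rewrite lerD2l rnormB ltW.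
  have h4 : N (X v) * N x <= M * (N (W x) + e) * N x.
    rewrite ler_wpM2r ?rnorm_ge0// (le_trans (XY v))// ler_wpM2l//.
  lra.
- by move=> v x; exact: (WP x).2.
Qed.

Lemma adj_exists T M : linear T -> 0 <= M -> bnd M T ->
  exists S, [/\ linear S, bnd M S & forall v w, d (T v) w = d v (S w)].
Proof. by move=> lT M0 hM; apply: (@douglas_adj H T id M). Qed.

Lemma adjP T : bounded_op T ->
  bounded_op (adj T) /\ forall v w, d (T v) w = d v (adj T w).
Proof.
move=> bT; have /bounded_opP[lT [M M0 hM]] := bT.
have [S [lS bS TS]] := adj_exists lT M0 hM.
have : exists S, bounded_op S /\ forall v w, d (T v) w = d v (S w).
  by exists S; split=> //; apply/bounded_opP; split=> //; exists M.
exact: (@xgetPex _ (fun=> 0)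
    [set S | bounded_op S /\ forall v w, d (T v) w = d v (S w)]).
Qed.

Lemma adj_uniq T S : bounded_op T -> (forall v w, d (T v) w = d v (S w)) ->
  adj T = S.
Proof.
move=> bT TS; apply/funext => w; apply/eqP; rewrite -subr_eq0; apply/eqP.
apply: (ip_nondeg d_norm) => v.
by rewrite ipBr -TS -(adjP bT).2 subrr.
Qed.

Lemma bounded_adj T : bounded_op T -> bounded_op (adj T).
Proof. by case/adjP. Qed.

Lemma adjE T v w : bounded_op T -> d (T v) w = d v (adj T w).
Proof. by move=> bT; case: (adjP bT) => _ ->. Qed.

Lemma adjEl T v w : bounded_op T -> d v (T w) = d (adj T v) w.
Proof. by move=> bT; rewrite ipC (adjE _ _ bT) -ipC. Qed.

Lemma adjK T : bounded_op T -> adj (adj T) = T.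
Proof.
move=> bT; apply: adj_uniq; first exact: bounded_adj.
by move=> v w; rewrite adjEl.
Qed.

Lemma adj_comp S T : bounded_op S -> bounded_op T ->
  adj (S \o T) = adj T \o adj S.
Proof.
move=> bS bT; apply: adj_uniq; first exact: bounded_comp.
by move=> v w /=; rewrite !adjE.
Qed.

Lemma bnd_adj T M : bounded_op T -> 0 <= M -> bnd M T -> bnd M (adj T).
Proof.
move=> bT M0 hM; have [S [lS bS TS]] := adj_exists bT.1 M0 hM.
by rewrite (adj_uniq bT TS).
Qed.

(** Douglas' factorisation; W is the adjoint of the map from [douglas_adj]. The domain [E] is a bare
    module, without norm or completeness, so that it can later be a space of finitely supported
    sequences. *)
Lemma douglas (E : lmodType R[i]) (X Y : E -> H) M :
  linear X -> linear Y -> 0 <= M -> (forall v, N (X v) <= M * N (Y v)) ->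
  exists W : H -> H, [/\ bounded_op W, bnd M W & forall v, X v = W (Y v)].
Proof.
move=> lX lY M0 XY; have [W [lW bW WP]] := douglas_adj lX lY M0 XY.
have bW' : bounded_op W by apply/bounded_opP; split=> //; exists M.
exists (adj W); split; [exact: bounded_adj|exact: bnd_adj|].
move=> v; apply/eqP; rewrite -subr_eq0; apply/eqP.
apply: (ip_nondeg d_norm) => x.
by rewrite ipBr -adjE// ipC WP -ipC subrr.
Qed.

Lemma pos_bounded T : pos_op T -> bounded_op T. Proof. by case. Qed.

Lemma pos_ip T v : pos_op T -> d (T v) v = (rip (T v) v)%:C.
Proof.
move=> [_ /(_ v) h]; apply: complex_eq => //=.
by rewrite (@ger0_Im _ _ h).
Qed.

Lemma pos_rip T v : pos_op T -> 0 <= rip (T v) v.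
Proof. by move=> hT; rewrite -lecR -pos_ip//; case: hT. Qed.

(** D = T - [adj T] has a vanishing quadratic form. Polarising at v + w makes (D v, w) antisymmetric
    in v and w, and replacing w by i w makes it symmetric, so D = 0. *)
Lemma pos_adj T : pos_op T -> adj T = T.
Proof.
move=> [bT pT]; have bD := bounded_sub bT (bounded_adj bT).
set D := T - adj T in bD.
have D0 v : d (D v) v = 0.
  rewrite /D subfE ipBl -adjEl// [d v _]ipC; have h := pT v.
  rewrite -[Num.conj _]/(conjc _) (_ : conjc _ = d (T v) v) ?subrr//.
  by move: (@ger0_Im _ _ h); case: (d (T v) v) => a b /= ->; rewrite oppr0.
have Dvw v w : d (D v) w = - d (D w) v.
  have := D0 (v + w); rewrite (linD bD.1) ipDl !ipDr !D0 add0r addr0.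
  by move/eqP; rewrite addr_eq0 => /eqP.
have Dvw' v w : d (D v) w = d (D w) v.
  have := Dvw v ('i *: w); rewrite (linZ bD.1) ipZr ipZl.
  rewrite -[Num.conj _]/(conjc _) (_ : conjc 'i = - 'i :> R[i]); last first.
    by apply: complex_eq => //=; rewrite oppr0.
  rewrite mulNr => /oppr_inj /mulfI; apply.
  by apply/eqP => -[] /eqP; rewrite oner_eq0.
apply/funext => w; apply/eqP; rewrite -subr_eq0; apply/eqP.
apply: (ip_nondeg d_norm) => v.
rewrite -opprB ipNr -subfE -/D ipC.
have : d (D w) v = 0.
  by have := Dvw w v; rewrite Dvw' => /eqP; rewrite -addr_eq0 -mulr2n mulrn_eq0 => /eqP.
by move=> ->; rewrite rmorph0 oppr0.
Qed.

Lemma pos_sym T v w : pos_op T -> d (T v) w = d v (T w).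
Proof. by move=> pT; rewrite (adjE _ _ (pos_bounded pT)) (pos_adj pT). Qed.

Lemma pos_rsym T v w : pos_op T -> rip (T v) w = rip v (T w).
Proof. by move=> pT; rewrite /real_ip pos_sym. Qed.

Lemma pos_rip_op T : bounded_op T -> adj T = T -> (forall v, 0 <= rip (T v) v) ->
  pos_op T.
Proof.
move=> bT aT pT; split=> // v; have := pT v; rewrite /real_ip.
have : d (T v) v = conjc (d (T v) v).
  by rewrite -[conjc _]/(Num.conj _) -ipC adjEl// aT.
case: (d (T v) v) => a b /= -[] hb; rewrite lecE /= => ->; rewrite andbT.
by apply/eqP; lra.
Qed.

Lemma sym_adj T : bounded_op T -> (forall v w, d (T v) w = d v (T w)) ->
  adj T = T.
Proof. by move=> bT /(adj_uniq bT). Qed.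

Lemma pos_add S T : pos_op S -> pos_op T -> pos_op (S + T).
Proof.
move=> [bS pS] [bT pT]; split; first exact: bounded_add.
by move=> v; rewrite addfE ipDl addr_ge0.
Qed.

Lemma pos_scale (c : R) T : 0 <= c -> pos_op T -> pos_op (c%:C *: T).
Proof.
move=> c0 [bT pT]; split; first exact: bounded_scale.
by move=> v; rewrite scalefE ipZl mulr_ge0// ler0c.
Qed.

Lemma pos0 : pos_op 0.
Proof. by split; [exact: bounded0|move=> v; rewrite ip0l]. Qed.

Lemma pos_sum (I : Type) (s : seq I) (P : pred I) (F : I -> H -> H) :
  (forall i, P i -> pos_op (F i)) -> pos_op (\sum_(i <- s | P i) F i).
Proof.
move=> h; elim/big_rec: _ => [|i x Pi bx]; first exact: pos0.
by apply: pos_add => //; exact: h.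
Qed.

Lemma pos_conj W T : bounded_op W -> pos_op T -> pos_op (W \o T \o adj W).
Proof.
move=> bW [bT pT]; split.
  by apply: bounded_comp (bounded_adj bW); apply: bounded_comp.
by move=> v /=; rewrite adjE.
Qed.

Lemma pos_adjcomp T : bounded_op T -> pos_op (adj T \o T).
Proof.
move=> bT; split; first by apply: bounded_comp => //; exact: bounded_adj.
by move=> v /=; rewrite -adjEl// d_norm exprn_ge0.
Qed.

Lemma pos_compadj T : bounded_op T -> pos_op (T \o adj T).
Proof.
move=> bT; have := pos_adjcomp (bounded_adj bT).
by rewrite (adjK bT).
Qed.

Lemma rip_adjcomp T v : bounded_op T -> rip (adj T (T v)) v = N (T v) ^+ 2.
Proof. by move=> bT; rewrite /real_ip -adjEl// -/(real_ip d _ _) ripvv. Qed.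

Lemma pos_sub S T : pos_op S -> pos_op T ->
  (forall v, rip (S v) v <= rip (T v) v) -> pos_op (T - S).
Proof.
move=> pS pT h; split; first by apply: bounded_sub; apply: pos_bounded.
move=> v; rewrite subfE ipBl !pos_ip// -rmorphB ler0c subr_ge0 //.
Qed.

(* Polarisation: 4 Re (S v, w) is a difference of two values of the form. *)
Lemma sym_bnd S M : bounded_op S -> adj S = S -> 0 <= M ->
  (forall v, `|rip (S v) v| <= M * N v ^+ 2) -> bnd M S.
Proof.
move=> bS aS M0 hS v.
have [->|Sv0] := eqVneq (S v) 0; first by rewrite rnorm0 mulr_ge0 ?rnorm_ge0.
have [v0|v0] := eqVneq v 0; first by move: Sv0; rewrite v0 (lin0 bS.1) eqxx.
have NS := rnorm_gt0 Sv0; have Nv := rnorm_gt0 v0.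
have Ssym u w : rip (S u) w = rip (S w) u.
  by rewrite /real_ip adjE// aS ipC Re_conj.
have key u w : 2 * rip (S u) w <= M * (N u ^+ 2 + N w ^+ 2).
  have h1 := ler_normlW (hS (u + w)).
  have := hS (u - w); rewrite -normrN => /ler_normlW h2.
  move: h1 h2; rewrite (linD bS.1) (linB bS.1) (rnormD_sqr d_norm).
  rewrite (rnormB_sqr d_norm) !ripDl !ripDr !ripNr !ripNl (Ssym w u); nra.
(* Scaling S v to the length of v turns the inequality into 2 |v| |S v| <= 2 M |v|^2. *)
have := key v ((N v / N (S v))%:C *: S v).
rewrite ripZr rnormZr (ripvv d_norm) ger0_norm ?divr_ge0 ?rnorm_ge0//.
rewrite divfK ?gt_eqF// (_ : _ / _ * _ = N v * N (S v)); last first.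
  by field; rewrite gt_eqF.
by move=> h; rewrite -(ler_pM2l Nv); lra.
Qed.

Lemma rip_bnd T M v : bnd M T -> `|rip (T v) v| <= M * N v ^+ 2.
Proof.
move=> hM; rewrite ler_norml; apply/andP; split.
  rewrite lerNl -ripNl (le_trans (rip_le d_norm _ _))// rnormN expr2 mulrA.
  by rewrite ler_wpM2r ?rnorm_ge0.
rewrite (le_trans (rip_le d_norm _ _))// expr2 mulrA.
by rewrite ler_wpM2r ?rnorm_ge0.
Qed.

End Adjoint.

(** * Functional calculus *)

Section PolyCalculus.
Context {R : realType} {H : completeNormedModType R[i]}.
Local Notation N := (@rnorm R H).
Variable d : {dot H for Num.conj}.
Hypothesis d_norm : forall v : H, d v v = `|v| ^+ 2.
Local Notation rip := (real_ip d).
Local Notation adj := (adj d).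
Local Notation pos_op := (pos_op d).
Implicit Types (S T : H -> H) (M : R) (p q : {poly R[i]}).

(** Complex coefficients are allowed because a real polynomial is split into linear factors over
    [R[i]] in [bounded_below_poly]. *)
Definition cpoly_op (p : {poly R[i]}) T : H -> H :=
  fun v => \sum_(i < size p) p`_i *: iter i T v.

Lemma cpoly_op_widen p T v n : (size p <= n)%N ->
  cpoly_op p T v = \sum_(i < n) p`_i *: iter i T v.
Proof.
move=> pn; rewrite /cpoly_op (big_ord_widen _ (fun i => p`_i *: iter i T v) pn).
rewrite big_mkcond; apply: eq_bigr => i _; case: ltnP => // h.
by rewrite nth_default// scale0r.
Qed.

Lemma cpoly_opD p q T v : cpoly_op (p + q) T v = cpoly_op p T v + cpoly_op q T v.
Proof.
pose n := maxn (size p) (size q).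
rewrite (@cpoly_op_widen _ _ _ n) ?size_polyD//.
rewrite (@cpoly_op_widen p _ _ n) ?leq_maxl// (@cpoly_op_widen q _ _ n) ?leq_maxr//.
by rewrite -big_split; apply: eq_bigr => i _; rewrite coefD scalerDl.
Qed.

Lemma cpoly_opZ c p T v : cpoly_op (c *: p) T v = c *: cpoly_op p T v.
Proof.
rewrite (@cpoly_op_widen _ _ _ (size p)) ?size_scale_leq// /cpoly_op scaler_sumr.
by apply: eq_bigr => i _; rewrite coefZ scalerA.
Qed.

Lemma cpoly_opC c T v : cpoly_op c%:P T v = c *: v.
Proof.
by rewrite (@cpoly_op_widen _ _ _ 1) ?size_polyC_leq1// big_ord1 coefC.
Qed.

Lemma cpoly_opMX p T v : cpoly_op (p * 'X) T v = cpoly_op p T (T v).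
Proof.
rewrite (@cpoly_op_widen _ _ _ (size p).+1) ?size_polyMleq//; last first.
  by rewrite (leq_trans (size_polyMleq _ _))// size_polyX addnC.
rewrite big_ord_recl coefMX eqxx scale0r add0r; apply: eq_bigr => i _.
by rewrite coefMX /= -iterSr.
Qed.

Variable T : H -> H.
Hypothesis lT : linear T.

Lemma linear_iter n : linear (iter n T).
Proof. by elim: n => [|n IH] // c u v /=; rewrite IH lT. Qed.

Lemma cpoly_op_comm p v : cpoly_op p T (T v) = T (cpoly_op p T v).
Proof.
rewrite /cpoly_op (lin_sum lT); apply: eq_bigr => i _.
by rewrite (linZ lT) -iterSr iterS.
Qed.

Lemma cpoly_opM p q v : cpoly_op (p * q) T v = cpoly_op p T (cpoly_op q T v).
Proof.
elim/poly_ind: p v => [|p c IH] v.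
  by rewrite mul0r -polyC0 !cpoly_opC !scale0r.
rewrite mulrDl !cpoly_opD mulrAC (cpoly_opMX (p * q)) IH mul_polyC cpoly_opZ.
by rewrite cpoly_opMX cpoly_opC cpoly_op_comm.
Qed.

Lemma linear_cpoly_op p : linear (cpoly_op p T).
Proof.
move=> c u v; rewrite /cpoly_op scaler_sumr -big_split; apply: eq_bigr => i _.
by rewrite linear_iter scalerDr !scalerA mulrC.
Qed.

Local Notation toC := (map_poly (real_complex R)).

Lemma poly_opE (P : {poly R}) v : poly_op P T v = cpoly_op (toC P) T v.
Proof.
rewrite /poly_op /cpoly_op size_map_poly; apply: eq_bigr => i _.
by rewrite coef_map.
Qed.

Lemma poly_opD (P Q : {poly R}) v :
  poly_op (P + Q) T v = poly_op P T v + poly_op Q T v.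
Proof. by rewrite !poly_opE rmorphD cpoly_opD. Qed.

Lemma poly_opZ (c : R) (P : {poly R}) v :
  poly_op (c *: P) T v = c%:C *: poly_op P T v.
Proof. by rewrite !poly_opE map_polyZ cpoly_opZ. Qed.

Lemma poly_opB (P Q : {poly R}) v :
  poly_op (P - Q) T v = poly_op P T v - poly_op Q T v.
Proof.
by rewrite poly_opD -(scaleN1r Q) poly_opZ rmorphN rmorph1 scaleN1r.
Qed.

Lemma poly_opC (c : R) v : poly_op c%:P T v = c%:C *: v.
Proof. by rewrite poly_opE map_polyC cpoly_opC. Qed.

Lemma poly_opX v : poly_op 'X T v = T v.
Proof. by rewrite poly_opE map_polyX -['X]mul1r cpoly_opMX cpoly_opC scale1r. Qed.

Lemma poly_opM (P Q : {poly R}) v :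
  poly_op (P * Q) T v = poly_op P T (poly_op Q T v).
Proof. by rewrite !poly_opE rmorphM cpoly_opM. Qed.

Lemma linear_poly_op (P : {poly R}) : linear (poly_op P T).
Proof. by move=> c u v; rewrite !poly_opE linear_cpoly_op. Qed.

Lemma poly_op_sym (P : {poly R}) v w : (forall v w, d (T v) w = d v (T w)) ->
  d (poly_op P T v) w = d v (poly_op P T w).
Proof.
move=> sT; rewrite /poly_op ip_suml ip_sumr; apply: eq_bigr => i _.
rewrite ipZl ipZrr; congr (_ * _).
by elim: (nat_of_ord i) v w => // n IH v w; rewrite iterS sT IH -iterSr.
Qed.

Lemma bounded_poly_op (P : {poly R}) : bounded_op T -> bounded_op (poly_op P T).
Proof.
move=> bT; rewrite /poly_op (_ : (fun v => _) =
  \sum_(i < size P) ((P`_i)%:C *: iter i T)); last first.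
  by apply/funext => v; rewrite sumfE.
apply: bounded_sum => i _; apply: bounded_scale.
elim: (nat_of_ord i) => [|n IH]; first exact: bounded_id.
rewrite (_ : iter n.+1 T = T \o iter n T)//; exact: bounded_comp.
Qed.

Hypothesis pT : pos_op T.

(** Positivity of S at v - S v / L gives 0 <= (S v, v) - 2 |S v|^2 / L + (S S v, S v) / L^2, and the
    last term is at most |S v|^2 / L. *)
Lemma pos_norm_sqr S L v : pos_op S -> 0 < L -> bnd L S ->
  N (S v) ^+ 2 <= L * rip (S v) v.
Proof.
move=> pS L0 hL; have lS := (pos_bounded pS).1.
have := pos_rip (v - L^-1%:C *: S v) pS.
have := rip_bnd d_norm (S v) hL; move/ler_normlW.
rewrite (linB lS) (linZ lS) !ripBl !ripBr !ripZl !ripZr (pos_rsym d_norm (S v) v pS).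
rewrite (ripvv d_norm) => h1 h2.
have h3 : L^-1 * (L^-1 * rip (S (S v)) (S v)) <= L^-1 * N (S v) ^+ 2.
  by rewrite ler_pM2l ?invr_gt0// ler_pdivrMl.
rewrite -ler_pdivrMl//; lra.
Qed.

Variable M : R.
Hypothesis M0 : 0 <= M.
Hypothesis TM : forall v, rip (T v) v <= M * N v ^+ 2.

Definition bounded_below S := exists2 c, 0 < c & forall v, c * N v <= N (S v).

Lemma bounded_belowW S c : 0 < c ->
  (forall v, c * N v ^+ 2 <= complex.Re `|d (S v) v|) -> bounded_below S.
Proof.
move=> c0 h; exists c => // v; have [->|v0] := eqVneq v 0.
  by rewrite rnorm0 mulr0 rnorm_ge0.
rewrite -(ler_pM2r (rnorm_gt0 v0)) -mulrA -expr2 (le_trans (h v))//.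
exact: ip_le.
Qed.

(** The form of T is real, between 0 and M |v|^2. Hence the form of T - z is at least |Im z| |v|^2
    in modulus when z is not real, and at least dist(z, [0, M]) |v|^2 when z is real. *)
Lemma bounded_below_factor (z : R[i]) :
  (forall t, 0 <= t <= M -> z <> t%:C) -> bounded_below (fun v => T v - z *: v).
Proof.
move=> hz.
have ipE v : d (T v - z *: v) v =
    (rip (T v) v - complex.Re z * N v ^+ 2) +i* (- complex.Im z * N v ^+ 2).
  rewrite ipBl ipZl (pos_ip _ pT) (ipvv d_norm).
  by case: z {hz} => a b; apply: complex_eq => /=; ring.
have [y0|y0] := eqVneq (complex.Im z) 0; last first.
  apply: (@bounded_belowW _ `|complex.Im z|); first by rewrite normr_gt0.
  move=> v; rewrite ipE; apply: le_sqr; rewrite ?Re_norm_ge0 ?mulr_ge0 ?rnorm_ge0//.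
  rewrite Re_norm_sqr /= !exprMn real_normK ?num_real// sqrrN lerDr.
  exact: sqr_ge0.
have zE : z = (complex.Re z)%:C by apply: complex_eq; rewrite /= ?y0.
have [x0|x0] := ltP (complex.Re z) 0.
  apply: (@bounded_belowW _ (- complex.Re z)); first by rewrite oppr_gt0.
  move=> v; apply: le_trans (Re_le_norm _); rewrite ipE /=.
  by have := pos_rip v pT; lra.
have [x1|x1] := ltP M (complex.Re z).
  apply: (@bounded_belowW _ (complex.Re z - M)); first by rewrite subr_gt0.
  move=> v; rewrite -normrN; apply: le_trans (Re_le_norm _); rewrite ReN ipE /=.
  by have := TM v; lra.
by case: (hz (complex.Re z)) => //; rewrite x0 x1.
Qed.

Lemma bounded_below_prod (s : seq R[i]) :
  (forall z, z \in s -> forall t, 0 <= t <= M -> z <> t%:C) ->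
  bounded_below (cpoly_op (\prod_(z <- s) ('X - z%:P)) T).
Proof.
elim: s => [|z s IH] hs.
  by exists 1 => // v; rewrite big_nil cpoly_opC scale1r mul1r.
have [|c c0 hc] := IH; first by move=> w ws; apply: hs; rewrite inE ws orbT.
have [|c' c'0 hc'] := @bounded_below_factor z.
  by apply: hs; rewrite inE eqxx.
exists (c' * c); first exact: mulr_gt0.
move=> v; rewrite big_cons cpoly_opM -mulrA.
set w := cpoly_op _ T v; apply: (@le_trans _ _ (c' * N w)).
  by rewrite ler_pM2l// hc.
apply: le_trans (hc' w) _; rewrite cpoly_opD -['X]mul1r cpoly_opMX cpoly_opC.
by rewrite -polyCN cpoly_opC scale1r scaleNr.
Qed.

(** Spectral mapping without spectra: over [R[i]] the polynomial splits, none of its roots lies in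
    [0, M], and a product of operators that are bounded below is bounded below. *)
Lemma bounded_below_poly (Q : {poly R}) :
  (forall t, 0 <= t <= M -> 0 < Q.[t]) -> bounded_below (poly_op Q T).
Proof.
move=> hQ; have [r rE] := closed_field_poly_normal (toC Q).
have lc0 : lead_coef (toC Q) != 0.
  rewrite lead_coef_eq0 map_poly_eq0; apply/eqP => Q0.
  by have := hQ 0; rewrite lexx M0 Q0 horner0 ltxx => /(_ isT).
have [|c c0 hc] := @bounded_below_prod r.
  move=> z zr t ht zt; have /negP := lt0r_neq0 (hQ t ht); apply.
  have : root (toC Q) z by rewrite rE rootZ// root_prod_XsubC.
  by rewrite zt /root horner_map /= -(inj_eq (@complexI R)).
move: (lead_coef _) rE lc0 => lc rE lc0; exists (complex.Re `|lc| * c).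
  rewrite mulr_gt0// lt_neqAle Re_norm_ge0 andbT eq_sym.
  by apply: contra lc0 => /eqP h; rewrite -normr_eq0 cnormE h.
move=> v; rewrite poly_opE rE cpoly_opZ rnormZ -mulrA ler_wpM2l//.
exact: Re_norm_ge0.
Qed.

(* Otherwise the infimum lam < 0 of the numerical range of P(T) is an
   approximate eigenvalue, although P - lam has no root in [0, M]. *)
Lemma poly_op_pos (P : {poly R}) :
  (forall t, 0 <= t <= M -> 0 <= P.[t]) -> pos_op (poly_op P T).
Proof.
move=> hP; have bT := pos_bounded pT.
have sT v w : d (T v) w = d v (T w) by exact: pos_sym.
have symP (Q : {poly R}) : adj (poly_op Q T) = poly_op Q T.
  by apply: sym_adj => //; [exact: bounded_poly_op|move=> *; exact: poly_op_sym].
have bP := bounded_poly_op P bT.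
apply: (pos_rip_op d_norm bP (symP P)) => v0; rewrite leNgt; apply/negP => v0P.
have v0n : v0 != 0 by apply: contraPneq v0P => ->; rewrite rip0r ltxx.
have Nv0 := rnorm_gt0 v0n.
pose A := [set rip (poly_op P T v) v | v in [set v | N v = 1]].
have scal v : v != 0 -> A (rip (poly_op P T v) v / N v ^+ 2).
  move=> vn; have Nv := rnorm_gt0 vn.
  exists ((N v)^-1%:C *: v) => /=.
    by rewrite rnormZr ger0_norm ?invr_ge0 ?rnorm_ge0// mulVf ?gt_eqF.
  by rewrite (linZ bP.1) ripZl ripZr; field; rewrite gt_eqF.
have hA : has_inf A.
  split; first by eexists; exact: scal v0n.
  exists (- opnorm (poly_op P T)) => _ [v /= v1 <-].
  have := rip_bnd d_norm v (opnorm_bnd bP); rewrite v1 expr1n mulr1.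
  by rewrite ler_norml => /andP[].
pose lam := inf A.
have lamA x : A x -> lam <= x by move=> Ax; apply: ge_inf => //; case: hA.
have lam0 : lam < 0.
  apply: le_lt_trans (lamA _ (scal _ v0n)) _.
  by rewrite pmulr_llt0// invr_gt0 exprn_gt0.
have QE v : poly_op (P - lam%:P) T v = poly_op P T v - lam%:C *: v.
  by rewrite poly_opB poly_opC.
have [|c c0 hc] := @bounded_below_poly (P - lam%:P).
  by move=> t /hP; rewrite hornerD hornerN hornerC; lra.
have bQ := bounded_poly_op (P - lam%:P) bT.
have pQ : pos_op (poly_op (P - lam%:P) T).
  apply: (pos_rip_op d_norm bQ (symP _)) => v.
  have [->|vn] := eqVneq v 0; first by rewrite rip0r.
  rewrite QE ripBl ripZl (ripvv d_norm) subr_ge0 -ler_pdivlMr.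
    exact: lamA (scal v vn).
  by rewrite exprn_gt0// rnorm_gt0.
pose L := opnorm (poly_op (P - lam%:P) T) + 1.
have L0 : 0 < L by rewrite ltr_wpDl// opnorm_ge0.
have hL : bnd L (poly_op (P - lam%:P) T).
  move=> v; rewrite (le_trans (opnorm_bnd bQ v))// ler_wpM2r ?rnorm_ge0//.
  by rewrite lerDl.
(* For a unit vector v whose form value is within c^2 / L of the infimum, c^2 <= |Q v|^2 <= L (Q v,
   v) < c^2 with Q = P(T) - lam. *)
have e0 : 0 < c ^+ 2 / L by rewrite divr_gt0// exprn_gt0.
have [_ [v /= v1 <-]] := inf_adherent e0 hA; rewrite -/lam.
have := pos_norm_sqr v pQ L0 hL; rewrite QE ripBl ripZl (ripvv d_norm) v1 expr1n mulr1.
have : c ^+ 2 <= N (poly_op (P - lam%:P) T v) ^+ 2.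
  by rewrite ler_sqr ?nnegrE ?rnorm_ge0 ?(ltW c0)// -[c]mulr1 -v1.
rewrite QE => h1 h2; rewrite -ltrBlDl ltr_pdivlMr// mulrC.
by apply/negP; rewrite -leNgt (le_trans h1).
Qed.

(** Positivity of c + P(T) and c - P(T) bounds the quadratic form, and for a symmetric operator this
    bounds the norm. *)
Lemma poly_op_bnd (P : {poly R}) c :
  (forall t, 0 <= t <= M -> `|P.[t]| <= c) -> bnd c (poly_op P T).
Proof.
move=> hP; have bT := pos_bounded pT.
have c0 : 0 <= c by apply: le_trans (hP 0 _); rewrite ?lexx.
apply: (sym_bnd d_norm) => //; first exact: bounded_poly_op.
  apply: sym_adj => //; first exact: bounded_poly_op.
  by move=> *; apply: poly_op_sym => *; exact: pos_sym.
move=> v; rewrite ler_norml; apply/andP; split.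
  have /(pos_rip v) : pos_op (poly_op (P + c%:P) T).
    apply: poly_op_pos => t /hP; rewrite hornerD hornerC ler_norml; lra.
  by rewrite poly_opD poly_opC ripDl ripZl (ripvv d_norm); lra.
have /(pos_rip v) : pos_op (poly_op (c%:P - P) T).
  apply: poly_op_pos => t /hP; rewrite hornerD hornerN hornerC ler_norml; lra.
by rewrite poly_opB poly_opC ripBl ripZl (ripvv d_norm); lra.
Qed.

End PolyCalculus.

(** * Weierstrass approximation of power functions by Bernstein polynomials *)

Section Weierstrass.
Context {R : realType}.
Implicit Types (f g : R -> R) (P Q : {poly R}) (M e : R).

(** Stands in for continuity on [0, M]: it is what the functional calculus consumes, and it is
    stable under products, powers and rescaling. *)
Definition papprox M f := forall e, 0 < e ->
  exists P, forall t, 0 <= t <= M -> `|P.[t] - f t| <= e.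

(* Expectation of g at the number of successes among n trials of
   probability x: the Bernstein polynomial of g, without binomials. *)
Fixpoint bern n (g : nat -> R) : {poly R} :=
  if n is m.+1 then 'X * bern m (fun k => g k.+1) + (1 - 'X) * bern m g
  else (g 0)%:P.

Lemma bernS n (g : nat -> R) x : (bern n.+1 g).[x] =
  x * (bern n (fun k => g k.+1)).[x] + (1 - x) * (bern n g).[x].
Proof. by rewrite /= !hornerE. Qed.

Lemma bern_le n (g h : nat -> R) x : 0 <= x <= 1 ->
  (forall k, (k <= n)%N -> g k <= h k) -> (bern n g).[x] <= (bern n h).[x].
Proof.
move=> /andP[x0 x1]; elim: n g h => [|n IH] g h gh.
  by rewrite /= !hornerC gh.
rewrite !bernS; apply: lerD; apply: ler_wpM2l; rewrite ?subr_ge0//;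
  apply: IH => k kn; apply: gh => //; exact: leqW.
Qed.

(** The binomial law has mean n x and variance n x (1 - x). The centre a is arbitrary because the
    induction replaces it by a - 1 in the success branch. *)
Lemma bern_quad n (a b c x : R) :
  (bern n (fun k => b + c * (k%:R - a) ^+ 2)).[x] =
  b + c * ((n%:R * x - a) ^+ 2 + n%:R * x * (1 - x)).
Proof.
elim: n a => [|n IH] a; first by rewrite /= hornerC; ring.
have -> : bern n.+1 (fun k => b + c * (k%:R - a) ^+ 2) =
    'X * bern n (fun k => b + c * (k%:R - (a - 1)) ^+ 2) +
    (1 - 'X) * bern n (fun k => b + c * (k%:R - a) ^+ 2).
  rewrite /=; congr ('X * bern n _ + _); apply/funext => k.
  by rewrite -natr1; ring.
by rewrite hornerD !hornerM !hornerE !IH -natr1; ring.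
Qed.

(** Chebyshev's argument: |f(k/n) - f(x)| is at most e/2 + c (k - n x)^2, by uniform continuity if
    k/n is near x and by boundedness otherwise. [bern] is monotone, and its value on that quadratic
    is known exactly. *)
Lemma papprox_unit f :
  (forall e, 0 < e -> exists2 del : R, 0 < del & forall s t : R, 0 <= s <= 1 ->
     0 <= t <= 1 -> `|s - t| < del -> `|f s - f t| <= e) ->
  (exists K : R, forall t : R, 0 <= t <= 1 -> `|f t| <= K) -> papprox 1 f.
Proof.
move=> uf [K hK] e e0.
have K0 : 0 <= K by apply: le_trans (hK 0 _); rewrite ?lexx ?ler01.
have [|del del0 hdel] := uf (e / 2); first by rewrite divr_gt0.
(* This n makes the variance term 2 K / (del^2 n) at most e / 2. *)
have [n hn] : exists n : nat, 4 * K / (e * del ^+ 2) < n%:R.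
  exists (Num.truncn (4 * K / (e * del ^+ 2))).+1.
  exact: truncnS_gt.
have ed0 : 0 < e * del ^+ 2 by rewrite mulr_gt0// exprn_gt0.
have n0 : 0 < n%:R :> R.
  by apply: le_lt_trans hn; rewrite divr_ge0 ?mulr_ge0// ltW.
move: hn; rewrite ltr_pdivrMr// => hn.
pose c := 2 * K / del ^+ 2 / n%:R ^+ 2.
have c0 : 0 <= c by rewrite !divr_ge0 ?mulr_ge0 ?exprn_ge0// ltW.
exists (bern n (fun k => f (k%:R / n%:R))) => x x01.
have x1 : x * (1 - x) <= 1.
  case/andP: x01 => x0 x1; rewrite -subr_ge0.
  by rewrite (_ : _ - _ = (1 - x) ^+ 2 + x) ?addr_ge0 ?sqr_ge0//; ring.
have bnd_quad : c * ((n%:R * x - n%:R * x) ^+ 2 + n%:R * x * (1 - x)) <= e / 2.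
  rewrite subrr expr0n add0r -mulrA.
  have -> : c * (n%:R * (x * (1 - x))) = (2 * K / del ^+ 2 / n%:R) * (x * (1 - x)).
    by rewrite /c; field; rewrite !gt_eqF.
  apply: (@le_trans _ _ (2 * K / del ^+ 2 / n%:R)).
    by rewrite ler_piMr// !divr_ge0 ?mulr_ge0 ?exprn_ge0// ltW.
  rewrite ler_pdivrMr// ler_pdivrMr ?exprn_gt0//; lra.
have key k : (k <= n)%N ->
    `|f (k%:R / n%:R) - f x| <= e / 2 + c * (k%:R - n%:R * x) ^+ 2.
  move=> kn; have s01 : 0 <= (k%:R / n%:R : R) <= 1.
    by rewrite divr_ge0 ?(ltW n0)//= ler_pdivrMr// mul1r ler_nat.
  have cq : c * (k%:R - n%:R * x) ^+ 2 = 2 * K * ((k%:R / n%:R - x) / del) ^+ 2.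
    rewrite /c; move: (k%:R : R) => y.
    by field; rewrite (gt_eqF n0) (gt_eqF del0).
  have [h|h] := ltP `|k%:R / n%:R - x| del.
    rewrite (le_trans (hdel _ _ s01 x01 h))// lerDl mulr_ge0// sqr_ge0 //.
  apply: (@le_trans _ _ (2 * K)).
    rewrite (le_trans (ler_normB _ _))// (_ : 2 * K = K + K); last by ring.
    by rewrite lerD ?hK.
  rewrite cq -[leLHS]add0r lerD ?divr_ge0 ?(ltW e0)// ler_peMr ?mulr_ge0//.
  rewrite -real_normK ?num_real// exprn_ege1// normrM normfV (gtr0_norm del0).
  by rewrite ler_pdivlMr// mul1r.
rewrite ler_norml; apply/andP; split.
  have := @bern_le n (fun k => (f x - e / 2) + (- c) * (k%:R - n%:R * x) ^+ 2)
    (fun k => f (k%:R / n%:R)) x x01.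
  rewrite bern_quad => h.
  have : f x - e / 2 + - c * ((n%:R * x - n%:R * x) ^+ 2 + n%:R * x * (1 - x)) <=
    (bern n (fun k => f (k%:R / n%:R))).[x].
    by apply: h => k /key; rewrite ler_norml => /andP[]; lra.
  by rewrite mulNr; lra.
have := @bern_le n (fun k => f (k%:R / n%:R))
  (fun k => (f x + e / 2) + c * (k%:R - n%:R * x) ^+ 2) x x01.
rewrite bern_quad => h.
have : (bern n (fun k => f (k%:R / n%:R))).[x] <=
  f x + e / 2 + c * ((n%:R * x - n%:R * x) ^+ 2 + n%:R * x * (1 - x)).
  by apply: h => k /key; rewrite ler_norml => /andP[]; lra.
lra.
Qed.

Lemma poly_bounded P M : exists2 K, 0 <= K & forall t, 0 <= t <= M -> `|P.[t]| <= K.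
Proof.
elim/poly_ind: P => [|P c [K K0 hK]].
  by exists 0 => // t _; rewrite horner0 normr0.
exists (K * `|M| + `|c|); first by rewrite addr_ge0// mulr_ge0.
move=> t tM; rewrite hornerD hornerM hornerX hornerC.
rewrite (le_trans (ler_normD _ _))// lerD2r normrM ler_pM//; first exact: hK.
by case/andP: tM => t0 tM; rewrite !ger0_norm// (le_trans t0).
Qed.

Lemma papprox_bounded M f : papprox M f ->
  exists2 K, 0 <= K & forall t, 0 <= t <= M -> `|f t| <= K.
Proof.
move=> /(_ 1 ltr01)[P hP]; have [K K0 hK] := poly_bounded P M.
exists (K + 1); first by rewrite addr_ge0.
move=> t tM; have := hP t tM; have := hK t tM.
move=> h1 h2; rewrite -(subrK P.[t] (f t)).
by rewrite (le_trans (ler_normD _ _))// addrC lerD// distrC.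
Qed.

Lemma papproxM M f g : papprox M f -> papprox M g ->
  papprox M (fun t => f t * g t).
Proof.
move=> hf hg; have [K K0 hK] := papprox_bounded hf.
have [L L0 hL] := papprox_bounded hg => e e0.
pose e' := Num.min 1 (e / (K + L + 1)).
have KL : 0 < K + L + 1 by rewrite ltr_wpDl// addr_ge0.
have e'0 : 0 < e' by rewrite lt_min ltr01 divr_gt0.
have [P hP] := hf _ e'0; have [Q hQ] := hg _ e'0.
exists (P * Q) => t tM; rewrite hornerM.
have -> : P.[t] * Q.[t] - f t * g t =
  (P.[t] - f t) * (Q.[t] - g t) + f t * (Q.[t] - g t) + (P.[t] - f t) * g t by ring.
apply: (@le_trans _ _ (e' * 1 + K * e' + e' * L)).
  rewrite (le_trans (ler_normD _ _))// lerD//.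
    rewrite (le_trans (ler_normD _ _))// lerD// normrM ler_pM//.
    - exact: hP.
    - by rewrite (le_trans (hQ t tM))// ge_min lexx.
    - exact: hK.
    - exact: hQ.
  by rewrite normrM ler_pM//; [exact: hP|exact: hL].
have : e' <= e / (K + L + 1) by rewrite ge_min lexx orbT.
rewrite ler_pdivlMr//; lra.
Qed.

Lemma papprox_ext M f g : papprox M f -> (forall t, 0 <= t <= M -> f t = g t) ->
  papprox M g.
Proof.
move=> hf fg e /hf[P hP]; exists P => t tM; rewrite -fg//; exact: hP.
Qed.

Lemma papprox_scale M f : 0 <= M -> papprox 1 (fun t => f (M * t)) -> papprox M f.
Proof.
rewrite le_eqVlt => /predU1P[<- _ e e0|M0 hf e /hf[P hP]].
  exists (f 0)%:P => t; rewrite -eq_le => /eqP <-.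
  by rewrite hornerC subrr normr0 ltW.
exists (P \Po (M^-1 *: 'X)) => t /andP[t0 tM].
rewrite horner_comp hornerZ hornerX.
have := hP (M^-1 * t); rewrite mulVKf ?gt_eqF//; apply.
by rewrite mulr_ge0 ?invr_ge0 ?(ltW M0)//= ler_pdivrMl// mulr1.
Qed.

Lemma papproxX M f n : papprox M f -> papprox M (fun t => f t ^+ n).
Proof.
move=> hf; elim: n => [|n IH].
  by move=> e e0; exists 1 => t _; rewrite hornerC expr0 subrr normr0 ltW.
apply: papprox_ext (papproxM hf IH) _ => t _; exact/esym/exprS.
Qed.

Lemma papprox_cst M (c : R) : papprox M (fun=> c).
Proof. by move=> e e0; exists c%:P => t _; rewrite hornerC subrr normr0 ltW. Qed.

(** For 0 <= z <= y one has z / y <= (z / y)^s since s <= 1; the cases z = x and z = y - x are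
    added. *)
Lemma powR_subadd (s x y : R) : 0 <= s <= 1 -> 0 <= x <= y ->
  y `^ s <= x `^ s + (y - x) `^ s.
Proof.
move=> /andP[s0 s1] /andP[x0 xy].
have [y0|y0] := eqVneq y 0.
  have -> : x = 0 by lra.
  by rewrite y0 subrr lerDl powR_ge0.
have yp : 0 < y by rewrite lt_neqAle eq_sym y0 (le_trans x0).
have key z : 0 <= z <= y -> z / y * y `^ s <= z `^ s.
  move=> /andP[z0 zy]; rewrite -[in leRHS](divfK y0 z) powRM ?divr_ge0 ?(ltW yp)//.
  rewrite ler_wpM2r ?powR_ge0//; have [->|zn] := eqVneq z 0.
    by rewrite mul0r powR_ge0.
  have zp : 0 < z by rewrite lt_neqAle eq_sym zn.
  by apply: ger1_powR => //; rewrite divr_gt0//= ler_pdivrMr// mul1r.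
have := key x; rewrite x0 xy => /(_ isT) h1.
have := key (y - x); rewrite subr_ge0 xy gerBl x0 => /(_ isT) h2.
by rewrite (le_trans _ (lerD h1 h2))// -mulrDl -mulrDl addrC subrK divff// mul1r.
Qed.

(** By subadditivity t^s is Hoelder continuous, with modulus del = e^(1/s). *)
Lemma papprox_powR01 (s : R) : 0 < s <= 1 -> papprox 1 (fun t => t `^ s).
Proof.
move=> /andP[s0 s1]; apply: papprox_unit; last first.
  exists 1 => t /andP[t0 t1]; rewrite ger0_norm ?powR_ge0//.
  have <- : 1 `^ s = 1 :> R by rewrite powR1.
  by rewrite ge0_ler_powR ?nnegrE ?(ltW s0).
move=> e e0; exists (e `^ s^-1); first exact: powR_gt0.
have step (x y : R) : 0 <= x <= y -> `|y - x| < e `^ s^-1 ->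
    `|y `^ s - x `^ s| <= e.
  move=> xy; have /andP[x0 xley] := xy; have y0 := le_trans x0 xley.
  rewrite ger0_norm ?subr_ge0// => h.
  rewrite ger0_norm ?subr_ge0 ?ge0_ler_powR ?nnegrE ?(ltW s0)//.
  rewrite lerBlDl (le_trans (powR_subadd _ xy)) ?(ltW s0)// lerD2l.
  rewrite -[leRHS]powRr1 ?(ltW e0)// -(mulVf (lt0r_neq0 s0)) powRrM.
  by rewrite ge0_ler_powR ?nnegrE ?(ltW s0) ?subr_ge0 ?powR_ge0// ltW.
move=> x y /andP[x0 _] /andP[y0 _].
have [xy|yx] := leP x y.
  by rewrite distrC => h; rewrite distrC; apply: step; rewrite ?x0.
by apply: step; rewrite y0 ltW.
Qed.

(** Rescaling reduces to [0, 1]. There t^s is the n-th power of t^(s/n) with n > s, so a continuity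
    estimate is required for exponents at most 1 only. For s = 0 the function is constant, with 0^0
    = 1. *)
Lemma papprox_powR M (s : R) : 0 <= M -> 0 <= s -> papprox M (fun t => t `^ s).
Proof.
move=> M0 s0; apply: papprox_scale => //.
apply: (@papprox_ext _ (fun t => M `^ s * t `^ s)); last first.
  by move=> t /andP[t0 _]; rewrite powRM.
apply: papproxM; first exact: papprox_cst.
move: s0; rewrite le_eqVlt => /predU1P[<-|s0].
  by apply: papprox_ext (@papprox_cst 1 1) _ => t _; rewrite powRr0.
pose n := (Num.truncn s).+1; have ns : s < n%:R by exact: truncnS_gt.
have n0 : 0 < n%:R :> R by [].
apply: (@papprox_ext _ (fun t => (t `^ (s / n%:R)) ^+ n)).
  apply: papproxX; apply: papprox_powR01.
  by rewrite divr_gt0//= ler_pdivrMr// mul1r ltW.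
move=> t _; rewrite -powR_mulrn ?powR_ge0// -powRrM divfK// gt_eqF//.
Qed.

End Weierstrass.

(** * Continuous functional calculus of a positive operator *)

Section FunctionalCalculus.
Context {R : realType} {H : completeNormedModType R[i]}.
Local Notation N := (@rnorm R H).
Variable d : {dot H for Num.conj}.
Hypothesis d_norm : forall v : H, d v v = `|v| ^+ 2.
Local Notation rip := (real_ip d).
Local Notation adj := (adj d).
Local Notation pos_op := (pos_op d).
Implicit Types (S T : H -> H) (M e c : R) (P Q : {poly R}) (f g : R -> R).

Lemma bndD c e S T : bnd c S -> bnd e T -> bnd (c + e) (S + T).
Proof.
move=> hS hT v; rewrite addfE mulrDl (le_trans (rnormD _ _))//.
by rewrite lerD.
Qed.

Lemma bndN c T : bnd c T -> bnd c (- T).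
Proof. by move=> hT v; rewrite oppfE rnormN. Qed.

Lemma bnd_subC c S T : bnd c (S - T) -> bnd c (T - S).
Proof. by move=> h; rewrite -opprB; apply: bndN. Qed.

Lemma bnd_trans c e S T U : bnd c (S - T) -> bnd e (T - U) -> bnd (c + e) (S - U).
Proof.
move=> h1 h2 v; have := bndD h1 h2 v.
by rewrite !addfE !oppfE addrA subrK.
Qed.

Lemma bnd_comp c e S T : 0 <= c -> bnd c S -> bnd e T -> bnd (c * e) (S \o T).
Proof.
move=> c0 hS hT v /=; rewrite (le_trans (hS _))// -mulrA ler_wpM2l//.
Qed.

Lemma bndW c e T : c <= e -> bnd c T -> bnd e T.
Proof.
by move=> ce hT v; rewrite (le_trans (hT v))// ler_wpM2r// rnorm_ge0.
Qed.

Lemma bnd_scale (c : R[i]) e T : bnd e T -> bnd (complex.Re `|c| * e) (c *: T).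
Proof.
by move=> hT v; rewrite scalefE rnormZ -mulrA ler_wpM2l// Re_norm_ge0.
Qed.

Lemma bnd_eps_eq S T K : (forall e, 0 < e -> bnd (K * e) (S - T)) -> S = T.
Proof.
move=> h; apply/funext => v; apply/eqP; rewrite -subr_eq0; apply/eqP.
apply: rnorm0_eq0; apply/eqP; rewrite eq_le rnorm_ge0 andbT.
apply: (@le_eps _ _ _ (K * N v)) => e e0; rewrite add0r.
by have := h e e0 v; rewrite subfE mulrAC.
Qed.

(** Epsilon form of [is_fcalc]: one polynomial for each accuracy, and [bnd] in place of convergence
    of operator norms. *)
Definition fc f T S := bounded_op S /\ forall e, 0 < e -> exists P,
  (forall t, 0 <= t <= opnorm T -> `|P.[t] - f t| <= e) /\
  bnd e (poly_op P T - S).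

Lemma is_fcalcP f T S : bounded_op T -> is_fcalc f T S <-> fc f T S.
Proof.
move=> bT; split=> -[bS].
  move=> [P [uP cP]]; split=> // e e0.
  have h1 : \forall n \near \oo,
      forall t, t \in `[0, opnorm T] -> `|(P n).[t] - f t| < e.
    have := uP [set h | forall t, t \in `[0, opnorm T] -> `|h t - f t| < e].
    case=> [|n _ hn]; last by exists n => // k /hn.
    apply/uniform_nbhs; exists [set xy | ball xy.1 e xy.2]; split.
      exact: (entourage_ball (R^o : pseudoMetricType R) (PosNum e0)).
    move=> h /= hh t tM; have := hh t tM.
    by rewrite -ball_normE /= distrC.
  have h2 : \forall n \near \oo, `|0 - opnorm (poly_op (P n) T - S)| < e.
    by move/cvgrPdist_lt: cP; apply.
  have [n [hn1 hn2]] : exists n,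
      (forall t, t \in `[0, opnorm T] -> `|(P n).[t] - f t| < e) /\
      `|0 - opnorm (poly_op (P n) T - S)| < e.
    have [n _ hn] := filterI h1 h2; exists n.
    exact: hn n (leqnn n).
  exists (P n); split.
    by move=> t tM; apply/ltW/hn1; rewrite in_itv.
  move: hn2; rewrite sub0r normrN => /ltr_normlW hn2.
  apply: bndW (ltW hn2) _; apply: opnorm_bnd; apply: bounded_sub => //.
  exact: bounded_poly_op.
move=> h; split=> //.
have /choice[P hP] : forall n : nat, exists P,
    (forall t, 0 <= t <= opnorm T -> `|P.[t] - f t| <= n.+1%:R^-1) /\
    bnd n.+1%:R^-1 (poly_op P T - S).
  by move=> n; apply: h; rewrite invr_gt0.
exists P; split.
  move=> A /uniform_nbhs[E [/= entE EA]].
  have [e e0 eE] := entE.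
  have [n _ hn] := near_infty_natSinv_lt (PosNum e0).
  exists n => // k nk; apply: EA => t /= tM; apply: eE.
  rewrite /ball_ /= distrC.
  apply: le_lt_trans (hn k nk); apply: (hP k).1.
  by move: tM; rewrite in_itv.
apply/cvgrPdist_lt => e e0.
have [n _ hn] := near_infty_natSinv_lt (PosNum e0).
exists n => // k nk /=; rewrite sub0r normrN.
have bD : bounded_op (poly_op (P k) T - S).
  by apply: bounded_sub => //; exact: bounded_poly_op.
rewrite ger0_norm ?opnorm_ge0//; apply: le_lt_trans (hn k nk).
by apply: opnorm_le; [rewrite invr_ge0|exact: (hP k).2].
Qed.

Variable T : H -> H.
Hypothesis pT : pos_op T.
Let bT : bounded_op T := pos_bounded pT.
Let lT : linear T := bT.1.
Local Notation M := (opnorm T).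

Lemma opnorm_ge0_pos : 0 <= M. Proof. exact: opnorm_ge0. Qed.

Lemma rip_opnorm v : rip (T v) v <= M * N v ^+ 2.
Proof. exact: ler_normlW (rip_bnd d_norm v (opnorm_bnd bT)). Qed.

Lemma poly_op_bndM P c : (forall t, 0 <= t <= M -> `|P.[t]| <= c) ->
  bnd c (poly_op P T).
Proof.
by apply: (poly_op_bnd d_norm lT pT opnorm_ge0_pos) => v; exact: rip_opnorm.
Qed.

Lemma poly_op_distM P Q c : (forall t, 0 <= t <= M -> `|P.[t] - Q.[t]| <= c) ->
  bnd c (poly_op P T - poly_op Q T).
Proof.
move=> h v; rewrite subfE -(poly_opB T); apply: poly_op_bndM.
by move=> t /h; rewrite hornerD hornerN.
Qed.

Lemma fc_poly P : fc (horner P) T (poly_op P T).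
Proof.
split; first exact: bounded_poly_op.
move=> e e0; exists P; split.
  by move=> t _; rewrite subrr normr0 ltW.
by move=> v; rewrite subfE subrr rnorm0 mulr_ge0 ?rnorm_ge0// ltW.
Qed.

(** Triangle inequality through one approximating polynomial on each side. With c arbitrarily small
    it shows that f(T) depends only on the values of f on [0, |T|]. *)
Lemma fc_dist f g S S' c : fc f T S -> fc g T S' ->
  (forall t, 0 <= t <= M -> `|f t - g t| <= c) -> bnd c (S - S').
Proof.
move=> [bS hS] [bS' hS'] h v; apply: (@le_eps _ _ _ (4 * N v)) => e e0.
have [P [P1 P2]] := hS e e0; have [Q [Q1 Q2]] := hS' e e0.
have PQ : bnd (e + c + e) (poly_op P T - poly_op Q T).
  apply: poly_op_distM => t tM.
  rewrite (_ : _ - _ = (P.[t] - f t) + (f t - g t) + (g t - Q.[t])); last by ring.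
  rewrite (le_trans (ler_normD _ _))// lerD//; last by rewrite distrC Q1.
  by rewrite (le_trans (ler_normD _ _))// lerD ?P1 ?h.
have := bnd_trans (bnd_trans (bnd_subC P2) PQ) Q2 v; lra.
Qed.

Lemma fc_uniq f g S S' : fc f T S -> fc g T S' ->
  (forall t, 0 <= t <= M -> f t = g t) -> S = S'.
Proof.
move=> hS hS' fg; apply: (@bnd_eps_eq _ _ 1) => e e0; rewrite mul1r.
apply: fc_dist hS hS' _ => t /fg ->; rewrite subrr normr0 ltW//.
Qed.

Lemma fc_ext f g S : fc f T S -> (forall t, 0 <= t <= M -> f t = g t) -> fc g T S.
Proof.
move=> [bS hS] fg; split=> // e /hS[P [P1 P2]]; exists P; split=> // t tM.
by rewrite -fg// P1.
Qed.

(** Errors may be any fixed multiple of e, with e <= 1, so the algebraic rules below need no tuning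
    of constants. *)
Lemma fc_intro f S K : bounded_op S -> 0 <= K ->
  (forall e, 0 < e -> e <= 1 -> exists P,
    (forall t, 0 <= t <= M -> `|P.[t] - f t| <= K * e) /\
    bnd (K * e) (poly_op P T - S)) -> fc f T S.
Proof.
move=> bS K0 h; split=> // e e0.
have K1 : 0 < K + 1 by rewrite ltr_wpDl.
have [||P [P1 P2]] := h (Num.min 1 (e / (K + 1))).
- by rewrite lt_min ltr01 divr_gt0.
- by rewrite ge_min lexx.
have Ke : K * Num.min 1 (e / (K + 1)) <= e.
  apply: (@le_trans _ _ (K * (e / (K + 1)))).
    by rewrite ler_wpM2l// ge_min lexx orbT.
  by rewrite mulrA ler_pdivrMr// mulrC ler_pM2l// lerDl.
exists P; split; last exact: bndW P2.
by move=> t /P1 /le_trans; apply.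
Qed.

Lemma fc_id : fc id T T.
Proof.
have := fc_poly 'X; rewrite (_ : poly_op 'X T = T).
  by move=> h; apply: fc_ext h _ => t _; rewrite hornerX.
by apply/funext => v; rewrite (poly_opX T).
Qed.

Lemma fc_cst c : fc (fun=> c) T (c%:C *: id).
Proof.
have := fc_poly c%:P; rewrite (_ : poly_op c%:P T = c%:C *: id).
  by move=> h; apply: fc_ext h _ => t _; rewrite hornerC.
by apply/funext => v; rewrite (poly_opC T).
Qed.

Lemma fc_add f g S S' : fc f T S -> fc g T S' ->
  fc (fun t => f t + g t) T (S + S').
Proof.
move=> [bS hS] [bS' hS']; apply: (@fc_intro _ _ 2) => //.
  exact: bounded_add.
move=> e e0 _; have [P [P1 P2]] := hS e e0; have [Q [Q1 Q2]] := hS' e e0.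
exists (P + Q); split.
  move=> t tM; rewrite hornerD opprD addrACA.
  by rewrite (le_trans (ler_normD _ _))// mulr2n mulrDl mul1r lerD ?P1 ?Q1.
rewrite (_ : _ - _ = (poly_op P T - S) + (poly_op Q T - S')).
  by rewrite mulr2n mulrDl mul1r; apply: bndD.
apply/funext => v; rewrite !addfE !oppfE (poly_opD T) addfE opprD.
by rewrite addrACA.
Qed.

Lemma fc_scale c f S : fc f T S -> fc (fun t => c * f t) T (c%:C *: S).
Proof.
move=> [bS hS]; apply: (@fc_intro _ _ `|c|) => //.
  exact: bounded_scale.
move=> e e0 _; have [P [P1 P2]] := hS e e0.
exists (c *: P); split.
  by move=> t tM; rewrite hornerZ -mulrBr normrM ler_wpM2l// P1.
rewrite (_ : _ - _ = c%:C *: (poly_op P T - S)).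
  by rewrite -Re_norm_real; apply: bnd_scale.
apply/funext => v; rewrite [LHS]subfE !scalefE subfE (poly_opZ T).
by rewrite scalerBr.
Qed.

Lemma fc_bounded f S : fc f T S ->
  exists2 K, 0 <= K & forall t, 0 <= t <= M -> `|f t| <= K.
Proof.
by move=> [_ h]; apply: papprox_bounded => e /h[P [P1 _]]; exists P.
Qed.

(** P Q - S S' = P (Q - S') + (P - S) S'. The assumption e <= 1 bounds P on the interval by K + 1,
    independently of e. *)
Lemma fc_mul f g S S' : fc f T S -> fc g T S' ->
  fc (fun t => f t * g t) T (S \o S').
Proof.
move=> fS gS'; have [K K0 hK] := fc_bounded fS; have [L L0 hL] := fc_bounded gS'.
have [bS hS] := fS; have [bS' hS'] := gS'.
have o0 := opnorm_ge0 bS'.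
apply: (@fc_intro _ _ (K + 1 + L + opnorm S')).
- exact: bounded_comp.
- by rewrite !addr_ge0.
move=> e e0 e1; have [P [P1 P2]] := hS e e0; have [Q [Q1 Q2]] := hS' e e0.
have PK t : 0 <= t <= M -> `|P.[t]| <= K + 1.
  move=> tM; rewrite -(subrK (f t) P.[t]) (le_trans (ler_normD _ _))//.
  by rewrite addrC lerD ?hK// (le_trans (P1 t tM)).
have bP := poly_op_bndM PK.
exists (P * Q); split.
  move=> t tM; rewrite hornerM.
  rewrite (_ : _ - _ = P.[t] * (Q.[t] - g t) + (P.[t] - f t) * g t); last by ring.
  apply: (@le_trans _ _ ((K + 1) * e + e * L)).
    rewrite (le_trans (ler_normD _ _))// lerD// normrM ler_pM//.
    - exact: PK.
    - exact: Q1.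
    - exact: P1.
    - exact: hL.
  have : 0 <= opnorm S' * e by rewrite mulr_ge0// ltW.
  lra.
rewrite (_ : _ - _ = (poly_op P T \o (poly_op Q T - S')) + ((poly_op P T - S) \o S')).
  apply: bndW (bndD (bnd_comp _ bP Q2) (bnd_comp (ltW e0) P2 (opnorm_bnd bS'))).
    have : 0 <= L * e by rewrite mulr_ge0// ltW.
    lra.
  by rewrite addr_ge0.
apply/funext => v; rewrite !addfE !oppfE /= (poly_opM lT) addfE oppfE addfE oppfE.
by rewrite (linB (linear_poly_op lT P)) addrA subrK.
Qed.

Lemma fc_sym f S : fc f T S -> adj S = S.
Proof.
move=> [bS hS]; apply: (@bnd_eps_eq _ _ 2) => e e0.
have [P [P1 P2]] := hS e e0; rewrite mulr2n mulrDl mul1r.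
have bP := bounded_poly_op P bT.
have aP : adj (poly_op P T) = poly_op P T.
  by apply: (sym_adj d_norm) => // v w; apply: poly_op_sym => *; exact: pos_sym.
apply: bnd_trans (P2); apply: bnd_subC.
rewrite -aP (_ : _ - _ = adj (poly_op P T - S)).
  by apply: bnd_adj => //; [exact: bounded_sub|exact: ltW].
have -> : adj (poly_op P T - S) = adj (poly_op P T) - adj S.
  apply: (adj_uniq d_norm) => [|v w]; first exact: bounded_sub.
  by rewrite !subfE ipBl ipBr !(adjE d_norm).
by [].
Qed.

(** If P is within e of f, then P + e is nonnegative on the interval, so [poly_op_pos] makes the
    form of f(T) at least -2 e |v|^2. *)
Lemma fc_pos f S : fc f T S -> (forall t, 0 <= t <= M -> 0 <= f t) -> pos_op S.
Proof.
move=> fS f0; apply: (pos_rip_op d_norm fS.1 (fc_sym fS)) => v.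
apply: (@ge0_eps _ _ (2 * N v ^+ 2)) => e e0.
have [P [P1 P2]] := fS.2 e e0.
have : pos_op (poly_op (P + e%:P) T).
  apply: (poly_op_pos d_norm lT pT opnorm_ge0_pos); first exact: rip_opnorm.
  move=> t tM; have := P1 t tM; have := f0 t tM.
  by rewrite hornerD hornerC ler_norml; lra.
move=> /(pos_rip v); rewrite (poly_opD T) (poly_opC T) ripDl ripZl (ripvv d_norm).
have := rip_bnd d_norm v P2; rewrite subfE ripBl ler_norml; lra.
Qed.

(** The approximants form a Cauchy sequence uniformly on the unit ball. The limit is taken
    pointwise, and linearity and boundedness follow from the uniform rate [SA]. *)
Lemma fc_exists f : papprox M f -> exists S, fc f T S.
Proof.
move=> hf.
have [u_ [u_gt0 hinv]] := exists_null_seq R.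
have /choice[P_ P_P] (n : nat) := hf _ (u_gt0 n).
pose A n := poly_op (P_ n) T.
have AA n m : bnd (u_ n + u_ m) (A n - A m).
  apply: poly_op_distM => t tM.
  rewrite (_ : _ - _ = ((P_ n).[t] - f t) + (f t - (P_ m).[t])); last by ring.
  by rewrite (le_trans (ler_normD _ _))// lerD ?P_P// distrC P_P.
have /choice[S hS] v : exists z, forall e, 0 < e ->
    exists n, forall m, (n <= m)%N -> N (z - A m v) < e.
  apply: complete_seq => e e0.
  have [|n hn] := hinv (e / (2 * (N v + 1))).
    by rewrite divr_gt0// mulr_gt0// ltr_wpDl// rnorm_ge0.
  exists n => m k nm nk; have := AA m k v; rewrite subfE => /le_lt_trans; apply.
  have := hn m nm; have := hn k nk; have Nv : 0 <= N v by exact: rnorm_ge0.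
  rewrite !ltr_pdivlMr ?mulr_gt0 ?ltr_wpDl//.
  have := u_gt0 m; have := u_gt0 k; nra.
have SA n : bnd (u_ n) (S - A n).
  move=> v; apply: (@le_eps _ _ _ (1 + N v)) => e e0.
  have [k hk] := hS v e e0; have [l hl] := hinv e e0.
  have := hk _ (leq_maxl k l); have := hl _ (leq_maxr k l).
  set m := maxn k l => h1 h2; have h3 := AA m n v; rewrite subfE in h3.
  rewrite subfE -(subrK (A m v) (S v)) -addrA.
  rewrite (le_trans (rnormD _ _))//.
  have : u_ m * N v <= e * N v by rewrite ler_wpM2r ?rnorm_ge0// ltW.
  lra.
have bS : bounded_op S.
  apply/bounded_opP; split.
    move=> c u v; apply/eqP; rewrite -subr_eq0; apply/eqP/rnorm0_eq0/eqP.
    rewrite eq_le rnorm_ge0 andbT.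
    apply: (@le_eps _ _ _ (N (c *: u + v) + (complex.Re `|c| * N u + N v))).
    move=> e /hinv[n /(_ _ (leqnn n)) hn]; rewrite add0r.
    have lA : linear (A n) by exact: linear_poly_op.
    rewrite (_ : _ - _ = (S - A n) (c *: u + v) -
      (c *: (S - A n) u + (S - A n) v)).
      rewrite (le_trans (rnormD _ _))// rnormN mulrDl lerD//.
        by rewrite mulrC (le_trans (SA n _))// ler_wpM2r ?rnorm_ge0// ltW.
      rewrite (le_trans (rnormD _ _))// mulrDl lerD//.
        rewrite rnormZ -mulrA ler_wpM2l ?Re_norm_ge0// mulrC.
        by rewrite (le_trans (SA n _))// ler_wpM2r ?rnorm_ge0// ltW.
      by rewrite mulrC (le_trans (SA n _))// ler_wpM2r ?rnorm_ge0// ltW.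
    rewrite !subfE lA scalerBr [X in _ = _ - X]addrACA -opprD opprB.
    by rewrite addrA subrK.
  exists (u_ 0%N + opnorm (A 0%N)).
    rewrite addr_ge0 ?(ltW (u_gt0 _))//; apply: opnorm_ge0.
    exact: bounded_poly_op.
  move=> v; have := bndD (SA 0%N) (opnorm_bnd (bounded_poly_op (P_ 0%N) bT)) v.
  by rewrite addfE subfE subrK.
exists S; split=> // e /hinv[n /(_ _ (leqnn n)) hn]; exists (P_ n); split.
  by move=> t tM; rewrite (le_trans (P_P n t tM))// ltW.
by apply: bndW (ltW hn) _; apply: bnd_subC.
Qed.

Lemma fcalcP f : papprox M f -> fc f T (fcalc f T).
Proof.
move=> /fc_exists[S /(is_fcalcP _ _ bT) hS]; apply/(is_fcalcP _ _ bT).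
by apply: (@xgetPex _ (fun=> 0) [set S | is_fcalc f T S]); exists S.
Qed.

Lemma fc_powR (s : R) : 0 <= s -> fc (fun t => t `^ s) T (op_pow T s).
Proof. by move=> s0; apply/fcalcP/papprox_powR => //; exact: opnorm_ge0_pos. Qed.

Lemma fc_sqrt : fc Num.sqrt T (fcalc Num.sqrt T).
Proof.
apply: fcalcP; apply: papprox_ext (papprox_powR opnorm_ge0_pos (_ : 0 <= 2^-1)) _.
  by rewrite invr_ge0.
by move=> t /andP[t0 _]; rewrite powR12_sqrt.
Qed.

End FunctionalCalculus.

(** * Absolute value and polar decomposition *)

Section AbsoluteValue.
Context {R : realType} {H : completeNormedModType R[i]}.
Local Notation N := (@rnorm R H).
Variable d : {dot H for Num.conj}.
Hypothesis d_norm : forall v : H, d v v = `|v| ^+ 2.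
Local Notation rip := (real_ip d).
Local Notation adj := (adj d).
Local Notation pos_op := (pos_op d).
Local Notation absop := (absop d).
Implicit Types (S T X : H -> H) (M e c : R) (P Q : {poly R}) (f g : R -> R).

Lemma poly_op_intertwine P T T' X v : linear X -> (forall v, X (T v) = T' (X v)) ->
  X (poly_op P T v) = poly_op P T' (X v).
Proof.
move=> lX XT; rewrite /poly_op (lin_sum lX); apply: eq_bigr => i _.
rewrite (linZ lX); congr (_ *: _).
by elim: (nat_of_ord i) => // n IH; rewrite !iterS XT IH.
Qed.

(** Polynomials pass through X exactly. One polynomial has to serve both T and T', hence
    approximation up to the larger of the two norms. *)
Lemma fc_intertwine f T T' X S S' : pos_op T -> pos_op T' -> bounded_op X ->
  (forall v, X (T v) = T' (X v)) ->
  papprox (Num.max (opnorm T) (opnorm T')) f ->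
  fc f T S -> fc f T' S' -> X \o S = S' \o X.
Proof.
move=> pT pT' bX XT hf fS fS'.
apply: (@bnd_eps_eq _ _ _ _ (opnorm X + opnorm X)) => e e0.
have [P hP] := hf e e0.
have h1 : bnd e (poly_op P T - S).
  apply: (fc_dist d_norm pT (fc_poly pT P) fS) => t /andP[t0 tM].
  by apply: hP; rewrite t0 le_max tM.
have h2 : bnd e (poly_op P T' - S').
  apply: (fc_dist d_norm pT' (fc_poly pT' P) fS') => t /andP[t0 tM].
  by apply: hP; rewrite t0 le_max tM orbT.
have hX := opnorm_bnd bX; have X0 := opnorm_ge0 bX.
rewrite mulrDl [X in bnd (_ + X)]mulrC.
have -> : (X \o S) - (S' \o X) =
    - (X \o (poly_op P T - S)) + ((poly_op P T' - S') \o X).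
  apply/funext => v; rewrite !addfE !oppfE /= !addfE !oppfE (linB bX.1).
  by rewrite (poly_op_intertwine P v bX.1 XT) opprB addrA subrK.
apply: bndD; last exact: bnd_comp (ltW e0) h2 hX.
by apply: bndN; apply: bnd_comp.
Qed.

Lemma pos_sqrt T : pos_op T -> pos_op (fcalc Num.sqrt T) /\
  fcalc Num.sqrt T \o fcalc Num.sqrt T = T.
Proof.
move=> pT; have fS := fc_sqrt d_norm pT; split.
  by apply: (fc_pos d_norm pT fS) => t _; rewrite sqrtr_ge0.
apply: (fc_uniq d_norm pT (fc_mul d_norm pT fS fS) (fc_id pT)).
by move=> t /andP[t0 _]; rewrite -expr2 sqr_sqrtr.
Qed.

Lemma pos_rip0 T v : pos_op T -> rip (T v) v = 0 -> T v = 0.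
Proof.
move=> pT; have [pS SS] := pos_sqrt pT.
rewrite -{1}SS /= (pos_rsym d_norm _ _ pS) (ripvv d_norm) => /eqP.
rewrite sqrf_eq0 => /eqP /rnorm0_eq0 h.
by rewrite -{1}SS /= h (lin0 (pos_bounded pS).1).
Qed.

(* If r and s are positive with r^2 = s^2 and commute then y = (r - s) v
   satisfies <r y, y> + <s y, y> = 0. *)
Lemma pos_sqrt_uniq S T : pos_op T -> pos_op S -> S \o S = T ->
  S = fcalc Num.sqrt T.
Proof.
move=> pT pS SS; have [] := pos_sqrt pT; set r := fcalc _ _ => pr rr.
have fr : fc Num.sqrt T r by exact: fc_sqrt.
have bS := pos_bounded pS; have br := pos_bounded pr.
have com v : S (r v) = r (S v).
  have : S \o r = r \o S.
    apply: (@fc_intertwine Num.sqrt T T S r r) => //.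
      by move=> w; rewrite -SS.
    apply: papprox_ext (papprox_powR _ (_ : 0 <= 2^-1)) _.
    - by rewrite le_max (opnorm_ge0_pos pT).
    - by rewrite invr_ge0.
    - by move=> t /andP[t0 _]; rewrite powR12_sqrt.
  by move/(congr1 (fun h => h v)).
apply/funext => v; apply/eqP; rewrite eq_sym -subr_eq0; apply/eqP.
set y := r v - S v.
have sum0 : r y + S y = 0.
  rewrite /y (linB br.1) (linB bS.1) com.
  rewrite -[r (r v)]/((r \o r) v) -[S (S v)]/((S \o S) v) rr SS.
  by rewrite addrA subrK subrr.
have : rip (r y) y + rip (S y) y = 0 by rewrite -ripDl sum0 rip0l.
have := pos_rip y pr; have := pos_rip y pS => h1 h2 h3.
have ry : r y = 0 by apply: pos_rip0 => //; lra.
have Sy : S y = 0 by apply: pos_rip0 => //; lra.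
apply: rnorm0_eq0; apply/eqP; rewrite -sqrf_eq0 -(ripvv d_norm) {1}/y ripBl.
by rewrite (pos_rsym d_norm _ _ pr) (pos_rsym d_norm _ _ pS) ry Sy rip0r subrr.
Qed.

Lemma pos_absop T : bounded_op T -> pos_op (absop T).
Proof. by move=> bT; have [] := pos_sqrt (pos_adjcomp d_norm bT). Qed.

Lemma absop_sqr T v : bounded_op T -> absop T (absop T v) = adj T (T v).
Proof.
move=> bT; have [_] := pos_sqrt (pos_adjcomp d_norm bT).
by move/(congr1 (fun h => h v)).
Qed.

Lemma rnorm_absop T v : bounded_op T -> N (absop T v) = N (T v).
Proof.
move=> bT; apply/eqP; rewrite -(@eqrXn2 _ 2) ?rnorm_ge0//.
rewrite -!(ripvv d_norm) -(pos_rsym d_norm _ _ (pos_absop bT)) absop_sqr//.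
by rewrite (rip_adjcomp d_norm)// (ripvv d_norm).
Qed.

(** Douglas' factorisation applies in both directions because |T| v and T v have the same norm; here
    and in [polar_inv] only a contraction is produced. *)
Lemma polar T : bounded_op T -> exists W : H -> H,
  [/\ bounded_op W, bnd 1 W & T = W \o absop T].
Proof.
move=> bT; have [||||W [bW W1 TW]] := @douglas _ _ d d_norm H T (absop T) 1.
- exact: bT.1.
- exact: (pos_bounded (pos_absop bT)).1.
- by [].
- by move=> v; rewrite mul1r rnorm_absop.
by exists W; split=> //; apply/funext.
Qed.

Lemma polar_inv T : bounded_op T -> exists W : H -> H,
  [/\ bounded_op W, bnd 1 W & absop T = W \o T].
Proof.
move=> bT; have [||||W [bW W1 TW]] := @douglas _ _ d d_norm H (absop T) T 1.
- exact: (pos_bounded (pos_absop bT)).1.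
- exact: bT.1.
- by [].
- by move=> v; rewrite mul1r rnorm_absop.
by exists W; split=> //; apply/funext.
Qed.

(** Expanding the squared norm of [adj W (W (S v)) - S v] leaves at most |S v|^2 - 2 |W S v|^2 + |S
    v|^2 = 0. *)
Lemma contraction_isometry W S v : bounded_op W -> bnd 1 W ->
  N (W (S v)) = N (S v) -> adj W (W (S v)) = S v.
Proof.
move=> bW W1 iso; apply/eqP; rewrite -subr_eq0; apply/eqP/rnorm0_eq0/eqP.
rewrite -sqrf_eq0 eq_le sqr_ge0 andbT (rnormB_sqr d_norm).
rewrite (rip_adjcomp d_norm)// iso.
have := bnd_adj d_norm bW ler01 W1 (W (S v)); rewrite mul1r iso.
move=> h; have : N (adj W (W (S v))) ^+ 2 <= N (S v) ^+ 2.
  by rewrite ler_pXn2r ?nnegrE ?rnorm_ge0.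
lra.
Qed.

Lemma op_pow1 T : pos_op T -> op_pow T 1 = T.
Proof.
move=> pT; apply: (fc_uniq d_norm pT (fc_powR d_norm pT ler01) (fc_id pT)).
by move=> t /andP[t0 _]; rewrite powRr1.
Qed.

(** [adj W \o W] fixes the range of b = |T|, so s = W b [adj W] is a positive square root of T
    [adj T] and equals the absolute value of [adj T]. W intertwines b with s, hence also their q-th
    powers. *)
Lemma op_pow_absop_adj T (q : R) : bounded_op T -> 1 <= q ->
  exists W : H -> H, [/\ bounded_op W, bnd 1 W &
    op_pow (absop (adj T)) q = W \o op_pow (absop T) q \o adj W].
Proof.
move=> bT q1; have q0 : 0 < q by apply: lt_le_trans q1.
have [W [bW W1 TW]] := polar bT; exists W; split=> //.
have bA := bounded_adj d_norm bT; have bWa := bounded_adj d_norm bW.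
set b := absop T; have pb : pos_op b by exact: pos_absop.
have bb := pos_bounded pb; have bbb : b \o b = adj T \o T.
  by apply/funext => v /=; rewrite /b absop_sqr.
have WWb v : adj W (W (b v)) = b v.
  apply: contraction_isometry => //.
  by rewrite -[W (b v)]/((W \o b) v) /b -TW rnorm_absop.
have bWW v : b (adj W (W v)) = b v.
  apply/eqP; rewrite -subr_eq0; apply/eqP; apply: (ip_nondeg d_norm) => w.
  rewrite ipBr -!(pos_sym d_norm _ _ pb).
  by rewrite -(adjE d_norm)// (adjEl d_norm _ v bW) WWb subrr.
have Tadj : adj T = b \o adj W.
  by rewrite {1}TW (adj_comp d_norm)// (pos_adj d_norm pb).
pose s := W \o b \o adj W.
have ps : pos_op s by exact: pos_conj.
have pA : pos_op (absop (adj T)) by exact: pos_absop.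
have sE : absop (adj T) = s.
  apply/esym/pos_sqrt_uniq => //; first exact: pos_adjcomp.
  rewrite (adjK d_norm)// Tadj; apply/funext => v; rewrite /s /=.
  by rewrite bWW -[W (b (b _))]/((W \o b) (b _)) /b -TW.
have fb := fc_powR d_norm pb (ltW q0).
have q10 : 0 <= q - 1 by rewrite subr_ge0.
have fs := fc_powR d_norm ps (ltW q0).
have fs1 := fc_powR d_norm ps q10.
have tw : W \o op_pow b q = op_pow s q \o W.
  apply: (@fc_intertwine (fun t => t `^ q) b s W) => //.
    by move=> v; rewrite /s /= bWW.
  by apply: papprox_powR; rewrite ?(ltW q0)// le_max (opnorm_ge0_pos pb).
have sWW v : s (W (adj W v)) = s v by rewrite /s /= bWW.
(* Splitting off one factor s, as q >= 1 permits, lets s^q absorb [W \o adj W] on its right. *)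
have sq : op_pow s q = op_pow s (q - 1) \o s.
  apply: (fc_uniq d_norm ps fs (fc_mul d_norm ps fs1 (fc_id ps))).
  by move=> t /andP[t0 _]; rewrite mulrC mulr_powRB1.
rewrite sE; apply/funext => v; transitivity (op_pow s q (W (adj W v))).
  by rewrite sq /= sWW.
by rewrite -[LHS]/((op_pow s q \o W) (adj W v)) -tw.
Qed.

End AbsoluteValue.

(** * Tracial weights *)

Section FunctionalCalculusOrder.
Context {R : realType} {H : completeNormedModType R[i]}.
Variable d : {dot H for Num.conj}.
Hypothesis d_norm : forall v : H, d v v = `|v| ^+ 2.

Lemma fc_le T (f g : R -> R) (S S' : H -> H) : pos_op d T -> fc f T S -> fc g T S' ->
  (forall t, 0 <= t <= opnorm T -> f t <= g t) ->
  forall v, real_ip d (S v) v <= real_ip d (S' v) v.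
Proof.
move=> pT fS gS' fg v; rewrite -subr_ge0 -ripBl -subfE; apply: pos_rip.
have := fc_add gS' (fc_scale (-1) fS).
rewrite (_ : _ + _ = S' - S); last first.
  by apply/funext => w; rewrite addfE scalefE rmorphN rmorph1 scaleN1r.
by move=> /(fc_pos d_norm pT); apply=> t /fg; rewrite mulN1r subr_ge0.
Qed.

End FunctionalCalculusOrder.

Section Trace.
Context {R : realType} {H : completeNormedModType R[i]}.
Local Notation N := (@rnorm R H).
Variable d : {dot H for Num.conj}.
Hypothesis d_norm : forall v : H, d v v = `|v| ^+ 2.
Local Notation rip := (real_ip d).
Local Notation adj := (adj d).
Local Notation pos_op := (pos_op d).
Local Notation absop := (absop d).
Implicit Types (S T X W : H -> H) (M e c : R) (P Q : {poly R}) (f g : R -> R).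
Variable tau : (H -> H) -> \bar R.
Hypothesis tau_sing : singular_trace d tau.
Local Open Scope ereal_scope.

Lemma tau_ge0 T : pos_op T -> 0 <= tau T.
Proof. exact: tr_ge0 tau_sing _. Qed.

Lemma tau_mono S T : pos_op S -> pos_op T ->
  (forall v, (rip (S v) v <= rip (T v) v)%R) -> tau S <= tau T.
Proof.
move=> pS pT ST; rewrite (_ : T = S + (T - S))%R; last by rewrite addrC subrK.
have pTS := pos_sub pS pT ST.
by rewrite (tr_add tau_sing)// leeDl// tau_ge0.
Qed.

Lemma tau_adjcomp T : bounded_op T -> tau (adj T \o T) = tau (T \o adj T).
Proof. exact: tr_comm tau_sing _. Qed.

Lemma tau0 : tau 0%R = 0.
Proof.
have := tr_hom tau_sing (lexx (0%R : R)) (pos0 d).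
by rewrite mul0e (_ : (0 : R)%:C *: (0 : H -> H) = 0)%R ?scaler0.
Qed.

Lemma tau_sum (I : Type) (s : seq I) (P : pred I) (F : I -> H -> H) :
  (forall i, P i -> pos_op (F i)) ->
  tau (\sum_(i <- s | P i) F i)%R = \sum_(i <- s | P i) tau (F i).
Proof.
move=> h.
suff : pos_op (\sum_(i <- s | P i) F i)%R /\
    tau (\sum_(i <- s | P i) F i)%R = \sum_(i <- s | P i) tau (F i) by case.
elim/big_rec2: _ => [|i x y Pi [py yx]]; first by split; [exact: pos0|exact: tau0].
have pF := h i Pi; split; first exact: pos_add.
by rewrite (tr_add tau_sing)// yx.
Qed.

(** With s the square root of T, the tracial property exchanges (W s) [adj (W s)] for [adj (W s)] (W
    s), whose form |W s v|^2 is at most |s v|^2. *)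
Lemma tau_conj W T : bounded_op W -> bnd 1%R W -> pos_op T ->
  tau (W \o T \o adj W) <= tau T.
Proof.
move=> bW W1 pT; have [ps ss] := pos_sqrt d_norm pT.
set s := fcalc _ T in ps ss; have bs := pos_bounded ps.
have bA := bounded_adj d_norm bW.
have bWs : bounded_op (W \o s) by exact: bounded_comp.
have aWs : adj (W \o s) = s \o adj W by rewrite (adj_comp d_norm)// (pos_adj d_norm ps).
have -> : W \o T \o adj W = (W \o s) \o adj (W \o s).
  by rewrite aWs -ss.
rewrite -tau_adjcomp//; apply: tau_mono => //; first exact: pos_adjcomp.
move=> v; rewrite (rip_adjcomp d_norm)// -{1}ss /= (pos_rsym d_norm _ _ ps).
rewrite (ripvv d_norm) ler_pXn2r ?nnegrE ?rnorm_ge0//.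
by have := W1 (s v); rewrite mul1r.
Qed.

(* halfop W T dominates the real part of W T since 0 <= (W - 1) T (W - 1)*. *)
Definition halfop W T : H -> H := (2^-1%:C *: (T + (W \o T \o adj W)))%R.

Lemma pos_halfop W T : bounded_op W -> pos_op T -> pos_op (halfop W T).
Proof.
move=> bW pT; apply: pos_scale; first by rewrite invr_ge0.
by apply: pos_add => //; apply: pos_conj.
Qed.

Lemma rip_halfop W T v : bounded_op W -> pos_op T ->
  (rip (W (T v)) v <= rip (halfop W T v) v)%R.
Proof.
move=> bW pT; have [ps ss] := pos_sqrt d_norm pT.
set s := fcalc _ T in ps ss.
have TE u w : rip (T u) w = rip (s u) (s w).
  by rewrite -{1}ss /= (pos_rsym d_norm _ _ ps).
have WE u w : rip (W u) w = rip u (adj W w).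
  by rewrite /real_ip (adjE d_norm).
rewrite /halfop scalefE addfE ripZl ripDl /= !WE !TE.
have := sqr_ge0 (N (s v - s (adj W v)))%R.
rewrite (rnormB_sqr d_norm) !(ripvv d_norm); lra.
Qed.

Lemma half_lee (x y z : \bar R) : 0 <= z -> x <= z -> y <= z ->
  2^-1%:E * (x + y) <= z.
Proof.
move: z => [z| |]// z0 xz yz; last by rewrite leey.
apply: (@le_trans _ _ (2^-1%:E * (z%:E + z%:E))).
  by rewrite lee_wpmul2l ?lee_fin ?invr_ge0// leeD.
by rewrite -EFinD -EFinM lee_fin; lra.
Qed.

Lemma tau_halfop W T : bounded_op W -> bnd 1%R W -> pos_op T ->
  tau (halfop W T) <= tau T.
Proof.
move=> bW W1 pT; have pW := pos_conj d_norm bW pT.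
rewrite /halfop (tr_hom tau_sing) ?invr_ge0//; last exact: pos_add.
by rewrite (tr_add tau_sing)// half_lee ?tau_ge0// tau_conj.
Qed.

(** Replaces the estimate |tau (W T)| <= tau T, in which [tau] would have to be evaluated at a
    non-positive operator. *)
Lemma tau_half X W T : pos_op X -> bounded_op W -> bnd 1%R W -> pos_op T ->
  (forall v, X v = W (T v)) -> tau X <= tau T.
Proof.
move=> pX bW W1 pT XE; apply: le_trans (tau_halfop bW W1 pT).
apply: tau_mono => //; first exact: pos_halfop.
by move=> v; rewrite XE rip_halfop.
Qed.

Lemma bnd1_phase W (th : R[i]) : complex.Re `|th|%R = 1%R -> bnd 1%R W ->
  bnd 1%R (th *: W)%R.
Proof. by move=> th1 W1 v; rewrite scalefE rnormZ th1 mul1r. Qed.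

(* With th z = |z| and x = W |x|, the real part of th x is a real combination
   of the y_i and is at most halfop (th W) |x|. *)
Lemma tr_value_le x z : bounded_op x -> is_tr_value d tau x z ->
  (complex.Re `|z|)%:E <= tau (absop x).
Proof.
move=> bx [n [c [y [hy xE zE]]]].
have py i : pos_op (y i) by case: (hy i).
have [W [bW W1 xW]] := polar d_norm bx.
have pb := pos_absop d_norm bx.
have tb0 := tau_ge0 pb.
have [th th1 thE] := phase z.
pose r i := complex.Re (th * c i)%R.
pose tp i := fine (tau (y i)).
have tpE i : tau (y i) = (tp i)%:E.
  by rewrite /tp fineK// ge0_fin_numE ?tau_ge0//; case: (hy i).
have Rz : complex.Re `|z|%R = (\sum_(i < n) r i * tp i)%R.
  transitivity (complex.Re (th * z)%R); first by rewrite thE.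
  rewrite zE mulr_sumr Re_sum; apply: eq_bigr => i _.
  by rewrite mulrA mulrC Re_realM mulrC.
(* [tau] is additive on positive operators only, so the combination with real coefficients r_i is
   split as Sp - Sn, and Sn is moved to the other side of the inequality. *)
pose Sp : H -> H := (\sum_(i < n) (Num.max (r i) 0)%:C *: y i)%R.
pose Sn : H -> H := (\sum_(i < n) (Num.max (- r i) 0)%:C *: y i)%R.
have pmax (t : R) : (0 <= Num.max t 0)%R by rewrite le_max lexx orbT.
have pp (t : 'I_n -> R) i : pos_op ((Num.max (t i) 0)%:C *: y i)%R.
  exact: pos_scale.
have pSp : pos_op Sp by apply: pos_sum => i _; exact: pp.
have pSn : pos_op Sn by apply: pos_sum => i _; exact: (pp (fun i => - r i)%R).
have tS (t : 'I_n -> R) : tau (\sum_(i < n) (Num.max (t i) 0)%:C *: y i)%R =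
    (\sum_(i < n) Num.max (t i) 0 * tp i)%:E.
  rewrite tau_sum => [|i _]; last exact: pp.
  rewrite -sumEFin; apply: eq_bigr => i _.
  by rewrite (tr_hom tau_sing)// tpE EFinM.
pose W' : H -> H := (th *: W)%R.
have bW' : bounded_op W' by exact: bounded_scale.
have W'1 : bnd 1%R W' by exact: bnd1_phase.
have ph := pos_halfop bW' pb.
have key : tau Sp <= tau Sn + tau (absop x).
  apply: (@le_trans _ _ (tau (Sn + halfop W' (absop x))%R)); last first.
    by rewrite (tr_add tau_sing)// leeD2l// tau_halfop.
  apply: tau_mono => //; first exact: pos_add.
  move=> v; rewrite addfE ripDl -lerBlDl.
  apply: le_trans (rip_halfop v bW' pb).
  rewrite /W' scalefE -[W (absop x v)]/((W \o absop x) v) -xW xE.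
  rewrite /Sp /Sn /real_ip ipZl !sumfE !ip_suml mulr_sumr !Re_sum -sumrB.
  apply: ler_sum => i _; rewrite !scalefE !ipZl (pos_ip v (py i)) !Re_realM.
  rewrite (_ : complex.Re (th * _) = r i * rip (y i v) v)%R; last first.
    by rewrite mulrA mulrC Re_realM mulrC.
  rewrite /= -mulrBl ler_wpM2r//; first exact: (pos_rip v (py i)).
  by case: (leP (r i) 0%R); case: (leP (- r i)%R 0%R); lra.
move: tb0 key; case: (tau (absop x)) => [t| |]; [|by move=> *; rewrite leey|by []].
rewrite /Sp /Sn !tS -EFinD !lee_fin => _ key.
rewrite Rz; apply: (@le_trans _ _ (\sum_(i < n) Num.max (r i) 0 * tp i -
  \sum_(i < n) Num.max (- r i) 0 * tp i)%R); last by rewrite lerBlDl.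
rewrite -sumrB; apply: ler_sum => i _; rewrite -mulrBl ler_wpM2r//.
  by rewrite -lee_fin -tpE tau_ge0.
by case: (leP (r i) 0%R); case: (leP (- r i)%R 0%R); lra.
Qed.

(** The bound holds for every admissible value, in particular for the one picked by [xget]; the
    default value 0 obeys it as well. *)
Lemma tr_ext_le x : bounded_op x -> (complex.Re `|tr_ext d tau x|)%:E <= tau (absop x).
Proof.
move=> bx; rewrite /tr_ext; case: xgetP => [z _ /= hz|_].
  exact: tr_value_le.
rewrite normr0; apply: tau_ge0; exact: pos_absop.
Qed.

Lemma tr_dom_bounded x : tr_dom d tau x -> bounded_op x.
Proof.
move=> [_ [n [c [y [hy -> _]]]]]; apply: bounded_sum => i _.
by apply: bounded_scale; apply: (@pos_bounded _ _ d); case: (hy i).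
Qed.

(** From |x| = W x the form of |x| is a sum of real parts of c_i (W y_i v, v). With the phase of c_i
    absorbed into W, each term is at most |c_i| times the form of a [halfop], whose trace does not
    exceed that of y_i. *)
Lemma tr_dom_absop x : tr_dom d tau x -> tau (absop x) < +oo.
Proof.
move=> dx; have bx := tr_dom_bounded dx.
move: dx => [_ [n [c [y [hy xE _]]]]].
have py i : pos_op (y i) by case: (hy i).
have [W [bW W1 xW]] := polar_inv d_norm bx.
have pb := pos_absop d_norm bx.
have /choice[th thP] : forall i, exists th : R[i],
    complex.Re `|th|%R = 1%R /\ (c i = (complex.Re `|c i|%R)%:C * th)%R.
  move=> i; have [th th1 thE] := phase (c i); exists (th^-1)%R.
  have tn : (`|th| = 1)%R by rewrite cnormE th1.
  have t0 : th != 0%R by rewrite -normr_eq0 tn oner_eq0.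
  split; first by rewrite normfV tn invr1.
  by rewrite -thE mulrAC divff// mul1r.
have bW' i : bounded_op (th i *: W)%R by exact: bounded_scale.
have W'1 i : bnd 1%R (th i *: W)%R by apply: bnd1_phase => //; case: (thP i).
have ph i : pos_op ((complex.Re `|c i|%R)%:C *: halfop (th i *: W) (y i))%R.
  by apply: pos_scale (Re_norm_ge0 _) _; apply: pos_halfop.
apply: (@le_lt_trans _ _ (tau (\sum_(i < n)
    (complex.Re `|c i|%R)%:C *: halfop (th i *: W) (y i))%R)).
  apply: tau_mono => //; first exact: pos_sum.
  move=> v; rewrite {1}xW /= {1}xE !sumfE (lin_sum bW.1) /real_ip !ip_suml !Re_sum.
  apply: ler_sum => i _; rewrite !scalefE (linZ bW.1) !ipZl Re_realM.
  rewrite [X in complex.Re (X * _)%R](thP i).2 -mulrA Re_realM.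
  rewrite ler_wpM2l ?Re_norm_ge0//.
  by have := rip_halfop v (bW' i) (py i); rewrite /real_ip !scalefE !ipZl.
rewrite tau_sum//; apply: lte_sum_pinfty => i _.
rewrite (tr_hom tau_sing) ?Re_norm_ge0//; last exact: pos_halfop.
rewrite lte_mul_pinfty ?lee_fin ?Re_norm_ge0//.
by apply: le_lt_trans (tau_halfop _ _ _) _ => //; case: (hy i).
Qed.

Lemma pos_op_pow T (p : R) : pos_op T -> (0 <= p)%R -> pos_op (op_pow T p).
Proof.
move=> pT p0; apply: (fc_pos d_norm pT (fc_powR d_norm pT p0)) => t _.
exact: powR_ge0.
Qed.

(** On [0, |T|] one has t^p <= |T|^(p-1) t. *)
Lemma tau_op_pow_lty T (p : R) : pos_op T -> (1 <= p)%R -> tau T < +oo ->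
  tau (op_pow T p) < +oo.
Proof.
move=> pT p1 Tlt; have p0 : (0 < p)%R by apply: lt_le_trans p1.
have pp := pos_op_pow pT (ltW p0).
pose c := (opnorm T `^ (p - 1))%R.
have c0 : (0 <= c)%R by exact: powR_ge0.
have pcT : pos_op (c%:C *: T)%R by exact: pos_scale.
apply: (@le_lt_trans _ _ (tau (c%:C *: T)%R)); last first.
  by rewrite (tr_hom tau_sing)// lte_mul_pinfty.
apply: tau_mono => // v.
apply: (fc_le d_norm pT (fc_powR d_norm pT (ltW p0)) (fc_scale c (fc_id pT))).
move=> t /andP[t0 tM]; rewrite -(mulr_powRB1 t0 p0) mulrC ler_wpM2r//.
by rewrite ge0_ler_powR ?nnegrE ?subr_ge0// (le_trans t0).
Qed.

Lemma pos_tr_dom T : pos_op T -> tau T < +oo -> tr_dom d tau T.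
Proof.
move=> pT Tlt; exists ((1 * (fine (tau T))%:C)%R).
exists 1%N, (fun=> 1%R), (fun=> T); split => //.
  by rewrite big_ord1 scale1r.
by rewrite big_ord1.
Qed.

Lemma tau_absop_adj T : bounded_op T -> tau (absop (adj T)) <= tau (absop T).
Proof.
move=> bT; have [W [bW W1 E]] := op_pow_absop_adj d_norm bT (lexx 1%R).
have bA := bounded_adj d_norm bT.
have pA := pos_absop d_norm bT; have pA' := pos_absop d_norm bA.
rewrite (op_pow1 d_norm pA') (op_pow1 d_norm pA) in E.
by rewrite E; exact: tau_conj.
Qed.

End Trace.

(** * Compact operators *)

Section Compact.
Context {R : realType} {H : completeNormedModType R[i]}.
Local Notation N := (@rnorm R H).
Variable d : {dot H for Num.conj}.
Hypothesis d_norm : forall v : H, d v v = `|v| ^+ 2.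
Local Notation rip := (real_ip d).
Local Notation adj := (adj d).
Local Notation pos_op := (pos_op d).
Implicit Types (S T X W K : H -> H) (M e c : R).

(** Images of sequences in the unit ball have a cluster point, approached at arbitrarily late
    indices; no subsequence is extracted. *)
Definition seq_compact T := forall v : nat -> H, (forall n, N (v n) <= 1) ->
  exists y, forall e, 0 < e -> forall m, exists2 n, (m <= n)%N & N (T (v n) - y) < e.

Lemma compact_op_seq T : compact_op T -> seq_compact T.
Proof.
move=> [lT cT] v v1.
have [|y [_ cy]] := cT ((T \o v) @ \oo) _.
  exists 0%N => // n _ /=; apply: subset_closure; exists (v n) => //=.
  by rewrite rnormE (lecR _ 1) v1.
exists y => e e0 m.
have [||z [[n /= mn <-] bz]] := cy [set T (v n) | n in [set n | (m <= n)%N]]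
    (ball y e%:C).
- by exists m => // n /= mn; exists n.
- by apply: nbhsx_ballx; rewrite ltcR.
exists n => //; move: bz; rewrite -ball_normE /= rnormE ltcR.
by rewrite rnormB.
Qed.

Lemma seq_compact_compl T X : seq_compact T -> bounded_op X -> seq_compact (X \o T).
Proof.
move=> cT bX v /cT[y hy]; exists (X y) => e e0 m.
have o0 : 0 < opnorm X + 1 by rewrite ltr_wpDl// opnorm_ge0.
have [n mn hn] := hy (e / (opnorm X + 1)) (divr_gt0 e0 o0) m.
exists n => //=; rewrite -(linB bX.1); apply: le_lt_trans (opnorm_bnd bX _) _.
move: hn; rewrite ltr_pdivlMr//.
have := rnorm_ge0 (T (v n) - y); nra.
Qed.

Lemma seq_compact_compr T X : seq_compact T -> linear T -> bounded_op X ->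
  seq_compact (T \o X).
Proof.
move=> cT lT bX v v1.
have o0 : 0 < opnorm X + 1 by rewrite ltr_wpDl// opnorm_ge0.
set K := opnorm X + 1 in o0.
have [|y hy] := cT (fun n => K^-1%:C *: X (v n)).
  move=> n; rewrite rnormZr ger0_norm ?invr_ge0 ?(ltW o0)// ler_pdivrMl// mulr1.
  rewrite (le_trans (opnorm_bnd bX _))// (le_trans (_ : _ <= opnorm X))//.
    by rewrite ler_piMr ?opnorm_ge0.
  by rewrite lerDl.
exists (K%:C *: y) => e e0 m.
have [n mn hn] := hy (e / K) (divr_gt0 e0 o0) m.
exists n => //=; have -> : T (X (v n)) = K%:C *: T (K^-1%:C *: X (v n)).
  by rewrite (linZ lT) scalerA -rmorphM divff ?gt_eqF// scale1r.
by rewrite -scalerBr rnormZr gtr0_norm// mulrC -ltr_pdivlMr.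
Qed.

(** The eigenvalue is also an operator bound, hence maximal. When it is 0 the vector is set to 0,
    which keeps the later enumeration total for operators of finite rank. *)
Definition top_eigen K (kg : R * H) := [/\ 0 <= kg.1, bnd kg.1 K,
  K kg.2 = kg.1%:C *: kg.2 & if kg.1 == 0 then kg.2 = 0 else N kg.2 = 1].

(** For unit-ball vectors v_n with |K v_n| -> k = |K|, the squared norm of K^2 v_n - k^2 v_n is at
    most k^2 (k^2 - |K v_n|^2) and tends to 0. A cluster point y of K v_n therefore satisfies K^2 y
    = k^2 y, and |y| >= k > 0. *)
Lemma top_eigen_exists K : pos_op K -> seq_compact K -> exists kg, top_eigen K kg.
Proof.
move=> pK cK; have bK := pos_bounded pK; have hK := opnorm_bnd bK.
have [k0|k0] := eqVneq (opnorm K) 0.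
  exists (0, 0); split=> //=; rewrite ?eqxx//; first by rewrite -k0.
  by rewrite (lin0 bK.1) scaler0.
set k := opnorm K in k0 hK.
have kp : 0 < k by rewrite lt_neqAle eq_sym k0 opnorm_ge0.
have [u_ [u_gt0 hinv]] := exists_null_seq R.
have /choice[v_ v_P] (n : nat) : exists v, N v <= 1 /\ k - u_ n < N (K v).
  have [_ [v /= v1 <-] h] := sup_adherent (u_gt0 n) (opnorm_has_sup bK).
  by exists v; split=> //; move: v1; rewrite rnormE (lecR _ 1).
have Kle n : N (K (v_ n)) <= k.
  by rewrite (le_trans (hK _))// ler_piMr ?(ltW kp)//; case: (v_P n).
have [y hy] := cK v_ (fun n => (v_P n).1).
have Ny : k <= N y.
  apply: (@le_eps _ _ _ 2) => e e0; have [m hm] := hinv e e0.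
  have [n mn hn] := hy e e0 m; have := (v_P n).2; have := hm n mn.
  have := rnormD (K (v_ n) - y) y; rewrite subrK; lra.
have step n : N (K (K (v_ n)) - (k ^+ 2)%:C *: v_ n) ^+ 2 <= 2 * k ^+ 3 * u_ n.
  rewrite (rnormB_sqr d_norm) ripZr rnormZr (pos_rsym d_norm _ _ pK) (ripvv d_norm).
  rewrite ger0_norm ?sqr_ge0//.
  have h1 : N (K (K (v_ n))) ^+ 2 <= k ^+ 2 * N (K (v_ n)) ^+ 2.
    by rewrite -exprMn ler_pXn2r ?nnegrE ?mulr_ge0 ?rnorm_ge0 ?(ltW kp)// hK.
  have h2 : (k ^+ 2 * N (v_ n)) ^+ 2 <= k ^+ 4.
    rewrite exprMn -exprM -[leRHS]mulr1 ler_wpM2l ?exprn_ge0 ?(ltW kp)//.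
    by rewrite expr_le1 ?rnorm_ge0//; case: (v_P n).
  have h3 : k ^+ 2 - N (K (v_ n)) ^+ 2 <= 2 * k * u_ n.
    have := Kle n; have := (v_P n).2; have := rnorm_ge0 (K (v_ n)).
    have := u_gt0 n; nra.
  have : k ^+ 2 * (k ^+ 2 - N (K (v_ n)) ^+ 2) <= k ^+ 2 * (2 * k * u_ n).
    by rewrite ler_wpM2l// exprn_ge0// ltW.
  lra.
have KKy : K (K y) = (k ^+ 2)%:C *: y.
  apply/eqP; rewrite -subr_eq0; apply/eqP/rnorm0_eq0/eqP.
  rewrite eq_le rnorm_ge0 andbT.
  apply: (@le_eps _ _ _ (2 * k ^+ 2 + k)) => e e0; rewrite add0r.
  have k3 : 0 < 2 * k ^+ 3 by rewrite mulr_gt0// exprn_gt0.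
  have [m hm] := hinv (e ^+ 2 / (2 * k ^+ 3)) (divr_gt0 (exprn_gt0 _ e0) k3).
  have [n mn hn] := hy e e0 m.
  have h1 : N (K (K (v_ n)) - (k ^+ 2)%:C *: v_ n) <= e.
    apply: le_sqr; rewrite ?rnorm_ge0 ?(ltW e0)//.
    apply: le_trans (step n) _; have := hm n mn.
    by rewrite ltr_pdivlMr// mulrC => /ltW.
  rewrite (_ : _ - _ = K (K (y - K (v_ n))) +
     (K (K (K (v_ n)) - (k ^+ 2)%:C *: v_ n) + (k ^+ 2)%:C *: (K (v_ n) - y))).
    rewrite (le_trans (rnormD _ _))// (_ : _ * e = k * (k * e) + (k * e + k ^+ 2 * e)).
      rewrite lerD//.
        rewrite (le_trans (hK _))// ler_wpM2l ?(ltW kp)//.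
        rewrite (le_trans (hK _))// ler_wpM2l ?(ltW kp)//.
        by rewrite rnormB ltW.
      rewrite (le_trans (rnormD _ _))// lerD//.
        by rewrite (le_trans (hK _))// ler_wpM2l ?(ltW kp).
      rewrite rnormZr ger0_norm ?sqr_ge0// ler_wpM2l ?sqr_ge0// ltW//.
    by ring.
  rewrite !(linB bK.1) (linZ bK.1) scalerBr.
  by rewrite [X in _ = _ + X]addrA subrK addrA subrK.
(* K y - k y is mapped to -k times itself, so it vanishes by positivity of K. *)
have Ky : K y = k%:C *: y.
  apply/eqP; rewrite -subr_eq0; apply/eqP; set z := K y - _.
  have Kz : K z = (- k)%:C *: z.
    rewrite /z (linB bK.1) (linZ bK.1) KKy scalerBr scalerA -rmorphM.
    rewrite (_ : - k * k = - k ^+ 2); last by ring.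
    by rewrite !rmorphN !scaleNr opprK addrC.
  have := pos_rip z pK; rewrite Kz ripZl (ripvv d_norm) mulNr oppr_ge0.
  rewrite pmulr_rle0// => h; apply: rnorm0_eq0; apply/eqP.
  by rewrite -sqrf_eq0 eq_le h sqr_ge0.
have Nyp := lt_le_trans kp Ny.
exists (k, (N y)^-1%:C *: y); split=> //=; first exact: ltW.
  by rewrite (linZ bK.1) Ky !scalerA mulrC.
rewrite (negbTE k0) rnormZr ger0_norm ?invr_ge0 ?rnorm_ge0//.
by rewrite mulVf ?gt_eqF.
Qed.

Definition cnsq (z : R[i]) : R := complex.Re `|z| ^+ 2.

Definition deflate (kg : R * H) K : H -> H :=
  fun v => K v - kg.1%:C *: (d v kg.2 *: kg.2).

Lemma ip_cnsq v g : d (d v g *: g) v = (cnsq (d v g))%:C.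
Proof.
rewrite ipZl (ipC d g v) /cnsq rmorphXn /= -cnormE.
by rewrite -normCK.
Qed.

Lemma rip_deflate kg K v :
  rip (deflate kg K v) v = rip (K v) v - kg.1 * cnsq (d v kg.2).
Proof. by rewrite /deflate ripBl ripZl /real_ip ip_cnsq. Qed.

(** The deflated operator is K Q, where Q removes the component along g. The range of K Q is
    orthogonal to g because g is an eigenvector, so the form of K Q at v is the form of K at Q v. *)
Lemma deflateE K kg : pos_op K -> top_eigen K kg ->
  pos_op (deflate kg K) /\ (seq_compact K -> seq_compact (deflate kg K)).
Proof.
case: kg => k g pK [/= k0 hK Kg gn]; have bK := pos_bounded pK.
pose Q v := v - d v g *: g.
have bQ : bounded_op Q.
  apply/bounded_opP; split.
    move=> c u v; rewrite /Q ipDl ipZl scalerDl -scalerA opprD addrACA.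
    by rewrite scalerBr.
  exists (1 + N g * N g); first by rewrite addr_ge0// mulr_ge0// rnorm_ge0.
  move=> v; rewrite /Q (le_trans (rnormD _ _))// rnormN rnormZ mulrDl mul1r lerD//.
  rewrite mulrAC ler_wpM2r ?rnorm_ge0// mulrC; exact: ip_le.
have DE : deflate (k, g) K = K \o Q.
  apply/funext => v; rewrite /deflate /Q /= (linB bK.1) (linZ bK.1) Kg.
  by rewrite !scalerA mulrC.
have Qg v : d (Q v) g = 0.
  rewrite /Q ipBl ipZl; move: gn; case: ifP => _ gn.
    by rewrite gn !ip0r mulr0 subrr.
  by rewrite (ipvv d_norm) gn expr1n mulr1 subrr.
split; last first.
  by move=> cK; rewrite DE; apply: seq_compact_compr => //; exact: bK.1.
split; first by rewrite DE; exact: bounded_comp.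
move=> v; rewrite DE /= -{2}(subrK (d v g *: g) v) -/(Q v) ipDr ipZr.
rewrite (pos_sym d_norm (Q v) g pK) Kg ipZrr Qg !mulr0 addr0.
by case: pK.
Qed.

(** The spectral theorem through truncated sums with remainder [kap n], so no series has to
    converge. Vectors with [kap n = 0] are padding and need not be unit vectors. *)
Record spectral K (kap : nat -> R) (g : nat -> H) : Prop := {
  sp_noninc : forall m n, (m <= n)%N -> kap n <= kap m;
  sp_ge0 : forall n, 0 <= kap n;
  sp_lim : forall e, 0 < e -> exists n, kap n < e;
  sp_unit : forall n, 0 < kap n -> N (g n) = 1;
  sp_orth : forall m n, m <> n -> d (g m) (g n) = 0;
  sp_eigen : forall n, K (g n) = (kap n)%:C *: g n;
  sp_lower : forall n v, \sum_(k < n) kap k * cnsq (d v (g k)) <= rip (K v) v;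
  sp_upper : forall n v, rip (K v) v <=
    \sum_(k < n) kap k * cnsq (d v (g k)) + kap n * N v ^+ 2 }.

Lemma spectral_exists K : pos_op K -> seq_compact K ->
  exists kap g, spectral K kap g.
Proof.
move=> pK cK.
(* A total choice of top eigenpair, with (0, 0) as default, allows plain iteration of the
   deflation. *)
have /choice[F FP] (S : H -> H) : exists kg, pos_op S -> seq_compact S -> top_eigen S kg.
  have [[pS cS]|h] := pselect (pos_op S /\ seq_compact S).
    by have [kg] := top_eigen_exists pS cS; exists kg.
  by exists (0, 0) => pS cS; case: h.
pose Kn n := iter n (fun S => deflate (F S) S) K.
pose kap n := (F (Kn n)).1; pose g n := (F (Kn n)).2.
have KnS n : Kn n.+1 = deflate (F (Kn n)) (Kn n) by [].
have pc n : pos_op (Kn n) /\ seq_compact (Kn n).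
  elim: n => // n [pn cn]; rewrite KnS.
  have [? h] := deflateE pn (FP _ pn cn); split=> //; exact: h.
have te n : top_eigen (Kn n) (kap n, g n).
  by rewrite /kap /g -surjective_pairing; case: (pc n) => pn cn; exact: FP.
have k0 n : 0 <= kap n by case: (te n).
have Kng n : Kn n (g n) = (kap n)%:C *: g n by case: (te n).
have Nb n : bnd (kap n) (Kn n) by case: (te n).
have gg n : d (g n) (g n) = (kap n != 0)%:R.
  case: (te n) => /= _ _ _; case: eqP => _ h; first by rewrite h ip0l.
  by rewrite (ipvv d_norm) h expr1n.
have KSg n v : Kn n.+1 v = Kn n v - (kap n)%:C *: (d v (g n) *: g n) by [].
have sK n v w : d (Kn n v) w = d v (Kn n w).
  by case: (pc n) => pn _; exact: pos_sym.
(* If the n-th deflation kills g_m, symmetry makes g_m orthogonal to g_n; then subtracting the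
   component along g_n still kills g_m, and the induction continues. *)
have zero m n : (m < n)%N -> Kn n (g m) = 0 /\ d (g m) (g n) = 0.
  have orth i j : Kn j (g i) = 0 -> d (g i) (g j) = 0.
    move=> h; have [kj|kj] := eqVneq (kap j) 0.
      by case: (te j) => /= _ _ _; rewrite kj eqxx => ->; rewrite ip0r.
    have := sK j (g i) (g j); rewrite h ip0l Kng ipZrr => /esym/eqP.
    by rewrite mulf_eq0 -[0]/(0%:C) (inj_eq (@complexI R)) (negbTE kj) => /eqP.
  have : forall n, (m < n)%N -> Kn n (g m) = 0.
    elim=> // {}n IH; rewrite ltnS leq_eqVlt => /predU1P[->|mn].
      rewrite KSg Kng gg; case: eqVneq => [->|_] /=.
        by rewrite rmorph0 !scale0r subrr.
      by rewrite scale1r subrr.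
    by rewrite KSg IH// (orth _ _ (IH mn)) scale0r scaler0 subrr.
  by move=> h /h hn; split=> //; exact: orth.
have orth m n : m <> n -> d (g m) (g n) = 0.
  move=> /eqP; rewrite neq_ltn => /orP[/zero[]//|/zero[_ h]].
  by rewrite ipC h rmorph0.
have sumE n v : K v = \sum_(k < n) (kap k)%:C *: (d v (g k) *: g k) + Kn n v.
  elim: n => [|n IH]; first by rewrite big_ord0 add0r.
  by rewrite big_ord_recr KSg /= -addrA [X in _ + X]addrC subrK.
have noninc1 n : kap n.+1 <= kap n.
  have [_ _ _ /=] := te n.+1; case: eqP => [->//|_ Ng].
  have : rip (Kn n.+1 (g n.+1)) (g n.+1) <= rip (Kn n (g n.+1)) (g n.+1).
    rewrite {1}KnS rip_deflate gerBl; apply: mulr_ge0; first exact: k0.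
    exact: sqr_ge0.
  rewrite (Kng n.+1) ripZl (ripvv d_norm) Ng expr1n mulr1 => /le_trans; apply.
  have := ler_normlW (rip_bnd d_norm (g n.+1) (Nb n)).
  by rewrite Ng expr1n mulr1.
have noninc m n : (m <= n)%N -> kap n <= kap m.
  move=> /subnK <-; elim: (n - m)%N => // j IH; rewrite addSn.
  exact: le_trans (noninc1 _) IH.
have eig n : K (g n) = (kap n)%:C *: g n.
  rewrite (sumE n) Kng big1 ?add0r// => k _; rewrite (orth n k) ?scale0r ?scaler0//.
  by move=> nk; have := ltn_ord k; rewrite -nk ltnn.
have unit n : 0 < kap n -> N (g n) = 1.
  by case: (te n) => /= _ _ _ + kn; rewrite gt_eqF.
have ripE n v : rip (K v) v =
    \sum_(k < n) kap k * cnsq (d v (g k)) + rip (Kn n v) v.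
  rewrite {1}(sumE n v) ripDl; congr (_ + _).
  rewrite /real_ip ip_suml Re_sum; apply: eq_bigr => k _.
  by rewrite ipZl Re_realM ip_cnsq.
exists kap, g; split=> //.
(* Otherwise the orthonormal g_n satisfy |K g_n - K g_m|^2 = kap_n^2 + kap_m^2 >= e^2, so K g_n has
   no cluster point. *)
- move=> e e0; apply: contrapT => /forallNP h.
  have ke n : e <= kap n by rewrite leNgt; apply/negP/h.
  have kp n : 0 < kap n by apply: lt_le_trans (ke n).
  have [|y hy] := cK g; first by move=> n; rewrite unit.
  have e2 : 0 < e / 2 by rewrite divr_gt0.
  have [n _ hn] := hy _ e2 0%N; have [m nm hm] := hy _ e2 n.+1.
  have : N (K (g n) - K (g m)) < e.
    rewrite (_ : K (g n) - K (g m) = (K (g n) - y) - (K (g m) - y)).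
      by rewrite (le_lt_trans (rnormD _ _))// rnormN; lra.
    by rewrite opprB addrA subrK.
  apply/negP; rewrite -leNgt; apply: le_sqr; rewrite ?rnorm_ge0 ?(ltW e0)//.
  rewrite !eig (rnormB_sqr d_norm) ripZl ripZr {1}/real_ip orth; last first.
    by move=> nm'; move: nm; rewrite nm' ltnn.
  rewrite !rnormZr !unit// !mulr1 !mulr0 subr0 !real_normK ?num_real//.
  by have := ke n; have := kp n; have := sqr_ge0 (kap m); nra.
- by move=> n v; rewrite (ripE n v) lerDl; apply: pos_rip; case: (pc n).
- move=> n v; rewrite (ripE n v) lerD2l.
  exact: ler_normlW (rip_bnd d_norm v (Nb n)).
Qed.

End Compact.

(** * Comparison of eigenvalues and of traces *)

Section Comparison.
Context {R : realType} {H : completeNormedModType R[i]}.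
Local Notation N := (@rnorm R H).
Variable d : {dot H for Num.conj}.
Hypothesis d_norm : forall v : H, d v v = `|v| ^+ 2.
Local Notation rip := (real_ip d).
Local Notation adj := (adj d).
Local Notation pos_op := (pos_op d).
Implicit Types (S T X W K : H -> H) (M e c : R).

Lemma cnsq_ge0 z : 0 <= cnsq z :> R. Proof. exact: sqr_ge0. Qed.

Lemma rip_orthonormal n (e : nat -> H) (r : nat -> R) (a : nat -> R[i]) :
  (forall i j, i <> j -> d (e i) (e j) = 0) ->
  rip (\sum_(i < n) (r i)%:C *: (a i *: e i)) (\sum_(i < n) a i *: e i) =
  \sum_(i < n) r i * cnsq (a i) * N (e i) ^+ 2.
Proof.
move=> oe; rewrite /real_ip ip_suml Re_sum; apply: eq_bigr => i _.
rewrite ip_sumr (bigD1 i)//= big1 ?addr0; last first.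
  move=> j ji; rewrite !ipZl ipZr (oe i j) ?mulr0// => ij.
  by move/eqP: ji; apply; apply/val_inj.
rewrite !ipZl ipZr Re_realM -mulrA; congr (_ * _).
rewrite mulrA -normCK (ipvv d_norm) mulrC Re_realM mulrC; congr (_ * _).
have -> : `|a i| ^+ 2 = (cnsq (a i))%:C by rewrite /cnsq rmorphXn /= -cnormE.
by [].
Qed.

Lemma rnorm_orthonormal n (e : nat -> H) (a : nat -> R[i]) :
  (forall i j, i <> j -> d (e i) (e j) = 0) ->
  N (\sum_(i < n) a i *: e i) ^+ 2 = \sum_(i < n) cnsq (a i) * N (e i) ^+ 2.
Proof.
move=> oe; have := @rip_orthonormal n e (fun=> 1) a oe.
rewrite (_ : \sum_(i < n) _%:C *: _ = \sum_(i < n) a i *: e i).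
  rewrite (ripvv d_norm) => ->; apply: eq_bigr => i _; by rewrite mul1r.
by apply: eq_bigr => i _; rewrite rmorph1 scale1r.
Qed.

(** Orthogonality imposes n linear equations on n + 1 coefficients, so the left kernel of the matrix
    of inner products is nonzero. *)
Lemma exists_orthogonal n (w : 'I_n.+1 -> H) (g : nat -> H) :
  exists2 c : 'rV[R[i]]_n.+1, c != 0 &
    forall k, (k < n)%N -> d (\sum_i c 0 i *: w i) (g k) = 0.
Proof.
pose A := \matrix_(i < n.+1, k < n) d (w i) (g k).
have kA : kermx A != 0.
  rewrite -mxrank_eq0 mxrank_ker -lt0n subn_gt0 ltnS.
  by rewrite (leq_trans (rank_leq_col A)).
exists (nz_row (kermx A)); first by rewrite nz_row_eq0.
move=> k kn; have /sub_kermxP/matrixP/(_ 0 (Ordinal kn)) := nz_row_sub (kermx A).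
rewrite !mxE => cA; rewrite ip_suml -[RHS]cA.
by apply: eq_bigr => i _; rewrite ipZl mxE.
Qed.

Section MinMax.
Variables (P K : H -> H) (lam kap : nat -> R) (e g : nat -> H) (Th : H -> H).
Hypothesis spP : spectral d P lam e.
Hypothesis spK : spectral d K kap g.
Hypothesis bP : bounded_op P.
Hypothesis lTh : linear Th.
(** The premise l (P u, u) <= |P u|^2 holds for combinations of eigenvectors of P with eigenvalues
    at least l. It mentions no eigenvectors, so it can be used for a concrete P; the conclusion says
    that the Rayleigh quotient of K at Th u is at least l. *)
Hypothesis ThP : forall l u, 0 < l -> 0 < rip (P u) u ->
  l * rip (P u) u <= N (P u) ^+ 2 ->
  Th u <> 0 /\ l * N (Th u) ^+ 2 <= rip (K (Th u)) (Th u).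

(* Courant-Fischer: the image under Th of the span of e_0, ..., e_n contains a
   vector orthogonal to g_0, ..., g_(n-1). *)
Lemma spectral_le n : lam n <= kap n.
Proof.
have [ln|] := ltP 0 (lam n); last by move/le_trans; apply; exact: sp_ge0 spK n.
have li i : (i <= n)%N -> 0 < lam i.
  by move=> h; apply: lt_le_trans ln _; exact: (sp_noninc spP h).
have [c c0 hc] := @exists_orthogonal n (fun i => Th (e i)) g.
pose a (i : nat) : R[i] := c 0 (inord i).
pose u := \sum_(i < n.+1) a i *: e i.
have aE (i : 'I_n.+1) : a i = c 0 i by rewrite /a inord_val.
have oe := sp_orth spP.
have PuE : P u = \sum_(i < n.+1) (lam i)%:C *: (a i *: e i).
  rewrite (lin_sum bP.1); apply: eq_bigr => i _.
  by rewrite (linZ bP.1) (sp_eigen spP) !scalerA mulrC.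
have ripu : rip (P u) u = \sum_(i < n.+1) lam i * cnsq (a i).
  rewrite PuE (rip_orthonormal _ _ _ oe); apply: eq_bigr => i _.
  by rewrite (sp_unit spP) ?expr1n ?mulr1// li// -ltnS.
have normPu : N (P u) ^+ 2 = \sum_(i < n.+1) lam i ^+ 2 * cnsq (a i).
  rewrite PuE (eq_bigr (fun i : 'I_n.+1 => ((lam i)%:C * a i) *: e i)); last first.
    by move=> i _; rewrite scalerA.
  rewrite (@rnorm_orthonormal n.+1 e (fun i => (lam i)%:C * a i) oe).
  apply: eq_bigr => i _.
  rewrite (sp_unit spP) ?expr1n ?mulr1; last by rewrite li// -ltnS.
  by rewrite /cnsq Re_normM Re_norm_real exprMn real_normK ?num_real.
have u0 : 0 < rip (P u) u.
  have /rV0Pn[i ci] := c0; rewrite ripu (bigD1 i)//= ltr_pwDl//.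
    rewrite mulr_gt0//; first by rewrite li// -ltnS.
    rewrite aE /cnsq exprn_gt0// lt_neqAle Re_norm_ge0 andbT eq_sym.
    by apply: contra ci => /eqP h; rewrite -normr_eq0 cnormE h.
  apply: sumr_ge0 => j _; rewrite mulr_ge0 ?cnsq_ge0//; exact: sp_ge0 spP _.
have [|Tu0 hTu] := ThP ln u0.
  rewrite ripu normPu mulr_sumr; apply: ler_sum => i _.
  rewrite mulrA ler_wpM2r ?cnsq_ge0// expr2 ler_wpM2r ?(sp_ge0 spP)//.
  by apply: (sp_noninc spP); rewrite -ltnS.
have orth k : (k < n)%N -> d (Th u) (g k) = 0.
  move=> /hc <-; congr (d _ _); rewrite (lin_sum lTh); apply: eq_bigr => i _.
  by rewrite (linZ lTh) aE.
have NT : 0 < N (Th u) ^+ 2 by rewrite exprn_gt0// rnorm_gt0//; exact/eqP.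
rewrite -(ler_pM2r NT); apply: le_trans hTu _.
apply: le_trans (sp_upper spK n _) _; rewrite big1 ?add0r// => k _.
by rewrite orth// /cnsq normr0 /= expr0n mulr0.
Qed.

(* Finitely supported sequences c are encoded as polynomials, so that douglas
   applies to the maps c |-> sum_n c_n e_n and c |-> sum_n c_n g_n. *)
Lemma spectral_match : exists W : H -> H, [/\ bounded_op W, bnd 1 W &
  forall n, 0 < lam n -> W (g n) = e n].
Proof.
(* Only indices with lam_n > 0 are kept. There kap_n >= lam_n > 0, so e_n and g_n are both unit
   vectors and the two maps have equal norms. *)
pose h (w : nat -> H) n := if 0 < lam n then w n else 0.
pose Z (w : nat -> H) (p : {poly R[i]}) := \sum_(i < size p) p`_i *: h w i.
have Zwiden w (p : {poly R[i]}) n : (size p <= n)%N -> Z w p = \sum_(i < n) p`_i *: h w i.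
  move=> pn; rewrite /Z (big_ord_widen _ (fun i => p`_i *: h w i) pn) big_mkcond.
  apply: eq_bigr => i _; case: ltnP => // ?; by rewrite nth_default// scale0r.
have lZ w : linear (Z w).
  move=> c p q; pose n := maxn (size p) (size q).
  rewrite (Zwiden _ p n) ?leq_maxl// (Zwiden _ q n) ?leq_maxr// (Zwiden _ _ n).
    rewrite scaler_sumr -big_split; apply: eq_bigr => i _.
    by rewrite coefD coefZ scalerDl scalerA.
  rewrite (leq_trans (size_polyD _ _))// geq_max leq_maxr andbT.
  by rewrite (leq_trans (size_scale_leq _ _))// leq_maxl.
have h_orth (w : nat -> H) : (forall i j, i <> j -> d (w i) (w j) = 0) ->
    forall i j, i <> j -> d (h w i) (h w j) = 0.
  move=> ow i j ij; rewrite /h; case: ifP => _; last by rewrite ip0l.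
  by case: ifP => _; [exact: ow|rewrite ip0r].
have iso p : N (Z e p) = N (Z g p).
  apply/eqP; rewrite -(@eqrXn2 _ 2) ?rnorm_ge0//.
  rewrite (@rnorm_orthonormal (size p) (h e) (fun i => p`_i) (h_orth _ (sp_orth spP))).
  rewrite (@rnorm_orthonormal (size p) (h g) (fun i => p`_i) (h_orth _ (sp_orth spK))).
  apply/eqP/eq_bigr => i _; congr (_ * _); rewrite /h; case: ifP => // li.
  rewrite (sp_unit spP)// (sp_unit spK)//; apply: lt_le_trans li _.
  exact: spectral_le.
have [||||W [bW W1 WP]] := @douglas _ _ d d_norm _ (Z e) (Z g) 1 => //.
  by move=> p; rewrite mul1r iso.
exists W; split=> // n ln.
have ZX w : Z w 'X^n = w n.
  rewrite (Zwiden _ _ n.+1) ?size_polyXn// big_ord_recr/= coefXn eqxx scale1r.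
  rewrite big1 ?add0r /h ?ln// => i _.
  by rewrite coefXn ltn_eqF// scale0r.
by rewrite -(ZX g) -WP ZX.
Qed.

End MinMax.

Variable tau : (H -> H) -> \bar R.
Hypothesis tau_sing : singular_trace d tau.

(** Since W g_k = e_k, the inner product of v with e_k is that of [adj W v] with g_k. With lam_k <=
    kap_k the truncated sum for P at v is then at most the one for K at [adj W v], and the remainder
    lam_n |v|^2 tends to 0. *)
Lemma tau_spectral_le P K Th : pos_op P -> seq_compact P ->
  pos_op K -> seq_compact K -> linear Th ->
  (forall l u, 0 < l -> 0 < rip (P u) u -> l * rip (P u) u <= N (P u) ^+ 2 ->
    Th u <> 0 /\ l * N (Th u) ^+ 2 <= rip (K (Th u)) (Th u)) ->
  (tau P <= tau K)%E.
Proof.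
move=> pP cP pK cK lTh ThP.
have [lam [e spP]] := spectral_exists d_norm pP cP.
have [kap [g spK]] := spectral_exists d_norm pK cK.
have bP := pos_bounded pP.
have le := spectral_le spP spK bP lTh ThP.
have [W [bW W1 Wg]] := spectral_match spP spK bP lTh ThP.
apply: le_trans (tau_conj d_norm tau_sing bW W1 pK).
apply: (tau_mono tau_sing) => //; first exact: pos_conj.
move=> v /=; rewrite -[leRHS]/(real_ip d _ _).
rewrite {2}/real_ip (adjE d_norm) // -/(real_ip d _ _).
apply: (@le_eps _ _ _ (N v ^+ 2)) => eps eps0.
have [n hn] := sp_lim spP eps0.
apply: le_trans (sp_upper spP n v) _; apply: lerD; last first.
  by rewrite mulrC ler_wpM2l ?sqr_ge0// ltW.
apply: le_trans (sp_lower spK n _); apply: ler_sum => k _.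
have [lk|lk] := ltP 0 (lam k); last first.
  rewrite (le_trans (_ : _ <= 0))//; last by rewrite mulr_ge0 ?cnsq_ge0// (sp_ge0 spK).
  by rewrite mulr_le0_ge0 ?cnsq_ge0.
apply: ler_pM; rewrite ?cnsq_ge0 ?(sp_ge0 spP)//.
rewrite (ipC d (adj W v)) -(adjE d_norm)// Wg// /cnsq Re_norm_conj.
by rewrite (ipC d v) Re_norm_conj.
Qed.

End Comparison.

(** * Hoelder's inequality *)

Section RealYoung.
Context {R : realType}.
Implicit Types x y z t k p q : R.

(** The graph of y^k lies above its tangent at x; this is Young's inequality for y and x^(k-1) with
    exponents k and k/(k-1). *)
Lemma young_powR k x y : 1 < k -> 0 <= x -> 0 <= y ->
  k * x `^ (k - 1) * y - (k - 1) * x `^ k <= y `^ k.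
Proof.
move=> k1 x0 y0; have k0 : 0 < k by lra.
have k10 : 0 < k - 1 by lra.
have := @conjugate_powR _ y (x `^ (k - 1)) k (k / (k - 1)) y0 (powR_ge0 _ _) k0.
rewrite -powRrM mulrCA divff ?gt_eqF// mulr1 => h.
have {h} : y * x `^ (k - 1) <= y `^ k / k + x `^ k / (k / (k - 1)).
  by apply: h; [rewrite divr_gt0|field; rewrite !gt_eqF].
rewrite -(ler_pM2l k0) mulrDr [k * (_ / k)]mulrC divfK ?gt_eqF//.
rewrite (_ : k * (x `^ k / (k / (k - 1))) = (k - 1) * x `^ k); last first.
  by field; rewrite !gt_eqF.
lra.
Qed.

(** Young's inequality for t x and y / t with exponents 1/r and 1/(1-r); t is the weight to be
    optimised later. *)
Lemma young_weighted (r t x y : R) : 0 < r < 1 -> 0 < t -> 0 <= x -> 0 <= y ->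
  x * y <= r * t `^ r^-1 * x `^ r^-1 +
    (1 - r) * t `^ (- (1 - r)^-1) * y `^ (1 - r)^-1.
Proof.
move=> /andP[r0 r1] t0 x0 y0; have r10 : 0 < 1 - r by lra.
have := @conjugate_powR _ (t * x) (t^-1 * y) r^-1 (1 - r)^-1.
rewrite !mulr_ge0 ?invr_ge0 ?(ltW t0)// !invr_gt0 !invrK.
move=> /(_ isT isT r0 r10) h.
have {h} : t * x * (t^-1 * y) <=
   (t * x) `^ r^-1 * r + (t^-1 * y) `^ (1 - r)^-1 * (1 - r) by apply: h; lra.
rewrite (_ : t * x * (t^-1 * y) = x * y); last by field; rewrite gt_eqF.
rewrite !powRM ?invr_ge0 ?(ltW t0)//.
rewrite (_ : t^-1 `^ _ = t `^ (- (1 - r)^-1)); last first.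
  by rewrite -powR_inv1 ?(ltW t0)// -powRrM mulN1r.
lra.
Qed.

Lemma holder_optimize z x y p q : 0 <= x -> 0 <= y -> 1 < p -> 1 < q ->
  p^-1 + q^-1 = 1 ->
  (forall c, 0 < c -> z <= c `^ p / p * x + c `^ (- q) / q * y) ->
  z <= x `^ p^-1 * y `^ q^-1.
Proof.
move=> x0 y0 p1 q1 pq h; have p0 : 0 < p by lra.
have q0 : 0 < q by lra.
have pV : p^-1 != 0 by rewrite invr_eq0 gt_eqF.
have qV : q^-1 != 0 by rewrite invr_eq0 gt_eqF.
have [xe|xn] := eqVneq x 0.
  rewrite xe powR0// mul0r; apply: (@le_eps _ _ _ (y / q)) => e e0.
  have := h (e `^ (- q^-1)) (powR_gt0 _ e0).
  rewrite xe mulr0 -powRrM mulrNN mulVf ?gt_eqF// powRr1 ?(ltW e0)//.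
  by rewrite (_ : e / q * y = y / q * e)//; ring.
have [ye|yn] := eqVneq y 0.
  rewrite ye powR0// mulr0; apply: (@le_eps _ _ _ (x / p)) => e e0.
  have := h (e `^ p^-1) (powR_gt0 _ e0).
  rewrite ye mulr0 -powRrM mulVf ?gt_eqF// powRr1 ?(ltW e0)// addr0 add0r.
  by rewrite (_ : e / p * x = x / p * e)//; ring.
have xp : 0 < x by rewrite lt_neqAle eq_sym xn.
have yp : 0 < y by rewrite lt_neqAle eq_sym yn.
(* The terms c^p x and c^(-q) y agree when c^(p+q) = y / x, and p + q = p q for conjugate
   exponents. *)
pose c := (y / x) `^ (p * q)^-1.
have c0 : 0 < c by rewrite powR_gt0// divr_gt0.
have xe1 : x = x `^ p^-1 * x `^ q^-1.
  by rewrite -powRD ?pq ?powRr1 ?(ltW xp)// oner_eq0.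
have ye1 : y = y `^ p^-1 * y `^ q^-1.
  by rewrite -powRD ?pq ?powRr1 ?(ltW yp)// oner_eq0.
have cE s : c `^ s = y `^ (s / (p * q)) * (x `^ (s / (p * q)))^-1.
  rewrite /c -powRrM [_^-1 * s]mulrC powRM ?invr_ge0 ?(ltW xp) ?(ltW yp)//.
  congr (_ * _); have -> : x^-1 = x `^ (-1) by rewrite powR_inv1 ?(ltW xp).
  by rewrite -powRrM mulN1r powRN.
have h1 : c `^ p * x = x `^ p^-1 * y `^ q^-1.
  rewrite cE (_ : p / (p * q) = q^-1); last by field; rewrite !gt_eqF.
  rewrite {2}xe1; field; rewrite gt_eqF// powR_gt0//.
have h2 : c `^ (- q) * y = x `^ p^-1 * y `^ q^-1.
  rewrite powRN cE (_ : q / (p * q) = p^-1); last by field; rewrite !gt_eqF.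
  rewrite {2}ye1; field; rewrite !gt_eqF// powR_gt0//.
apply: le_trans (h c c0) _.
rewrite mulrAC h1 [X in _ + X]mulrAC h2 -mulrDr pq mulr1//.
Qed.

End RealYoung.

Section Hoelder.
Context {R : realType} {H : completeNormedModType R[i]}.
Local Notation N := (@rnorm R H).
Variable d : {dot H for Num.conj}.
Hypothesis d_norm : forall v : H, d v v = `|v| ^+ 2.
Local Notation rip := (real_ip d).
Local Notation adj := (adj d).
Local Notation pos_op := (pos_op d).
Local Notation absop := (absop d).
Implicit Types (S T X W K a b : H -> H) (M e c p q r : R).

Lemma op_pow_mul T r s : pos_op T -> 0 <= r -> 0 <= s -> r + s != 0 ->
  op_pow T r \o op_pow T s = op_pow T (r + s).
Proof.
move=> pT r0 s0 rs.
have fr := fc_powR d_norm pT r0; have fs := fc_powR d_norm pT s0.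
apply: (fc_uniq d_norm pT (fc_mul d_norm pT fr fs)).
  by apply: fc_powR => //; rewrite addr_ge0.
move=> t _; have [->|t0] := eqVneq t 0; last by rewrite powRD// t0 implybT.
rewrite [RHS]powR0//; have [rE|rn] := eqVneq r 0; last by rewrite powR0// mul0r.
by rewrite [X in _ * X]powR0 ?mulr0//; move: rs; rewrite rE add0r.
Qed.

Lemma op_pow_rip T r v : pos_op T -> 0 < r ->
  rip (op_pow T (r + r) v) v = N (op_pow T r v) ^+ 2.
Proof.
move=> pT r0; have r0' := ltW r0; have pr := pos_op_pow d_norm pT r0'.
rewrite -op_pow_mul//; last by rewrite gt_eqF// addr_gt0.
by rewrite /= (pos_rsym d_norm _ _ pr) (ripvv d_norm).
Qed.

(* Jensen's inequality for the spectral measure of v, via tangent lines. *)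
Lemma jensen_op_pow T (j k : R) v : pos_op T -> 0 <= j -> 1 < k -> N v = 1 ->
  rip (op_pow T j v) v `^ k <= rip (op_pow T (j * k) v) v.
Proof.
move=> pT j0 k1 v1; have k0 : 0 < k by apply: lt_trans k1.
have pj := pos_op_pow d_norm pT j0.
set x := rip _ v; have x0 : 0 <= x by exact: pos_rip.
have jk0 : 0 <= j * k by rewrite mulr_ge0// ltW.
have := fc_le d_norm pT (fc_add (fc_scale (k * x `^ (k - 1)) (fc_powR d_norm pT j0))
   (fc_cst pT (- ((k - 1) * x `^ k)))) (fc_powR d_norm pT jk0).
move=> /(_ _ v); rewrite addfE !scalefE ripDl !ripZl (ripvv d_norm) v1 expr1n mulr1.
rewrite -/x (_ : k * x `^ (k - 1) * x + - ((k - 1) * x `^ k) = x `^ k).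
  by apply=> t /andP[t0 _]; rewrite powRrM; apply: young_powR; rewrite ?powR_ge0.
by rewrite -(mulr_powRB1 x0 k0); ring.
Qed.

Variable tau : (H -> H) -> \bar R.
Hypothesis tau_sing : singular_trace d tau.
Local Open Scope ereal_scope.

(** Follows from membership in [tr_dom], and passes to adjoints because the absolute value of
    [adj a] is a conjugate of |a| by a contraction. *)
Definition in_ideal a := bounded_op a /\ tau (absop a) < +oo.

Lemma tr_dom_in_ideal a : tr_dom d tau a -> in_ideal a.
Proof.
by move=> da; split; [exact: tr_dom_bounded da|exact: tr_dom_absop].
Qed.

Lemma in_ideal_adj a : in_ideal a -> in_ideal (adj a).
Proof.
move=> [ba ta]; split; first exact: bounded_adj.
by apply: le_lt_trans (tau_absop_adj d_norm tau_sing ba) ta.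
Qed.

Lemma finite_seq_compact T : pos_op T -> tau T < +oo -> seq_compact T.
Proof.
move=> pT tT; apply: compact_op_seq; apply: (tr_compact tau_sing).
exact: pos_tr_dom.
Qed.

Lemma in_ideal_seq_compact a : in_ideal a -> seq_compact a.
Proof.
move=> [ba ta]; have [W [bW _ ->]] := polar d_norm ba.
by apply: seq_compact_compl => //; apply: finite_seq_compact => //; exact: pos_absop.
Qed.

Lemma tau_fin T : pos_op T -> tau T < +oo -> exists2 x : R, (0 <= x)%R & tau T = x%:E.
Proof.
move=> pT; have := tau_ge0 tau_sing pT; case: (tau T) => [x| |]// x0 _.
by exists x.
Qed.

Lemma in_ideal_op_pow a p : in_ideal a -> (1 <= p)%R ->
  exists2 x : R, (0 <= x)%R & tau (op_pow (absop a) p) = x%:E.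
Proof.
move=> [ba ta] p1; have pa := pos_absop d_norm ba; apply: tau_fin.
  by apply: pos_op_pow => //; apply: le_trans p1.
exact: tau_op_pow_lty.
Qed.

(* AM-GM after writing |T| = W X Y:
   2 Re <Y v, (W X)* v> <= e |(W X)* v|^2 + |Y v|^2 / e. *)
Lemma tau_absop_comp X Y T e u w : bounded_op X -> bounded_op Y -> bounded_op T ->
  (forall v, T v = X (Y v)) -> (0 < e)%R ->
  tau (adj X \o X) = u%:E -> tau (adj Y \o Y) = w%:E ->
  tau (absop T) <= (2^-1 * (e * u + e^-1 * w))%:E.
Proof.
move=> bX bY bT TE e0 uE wE.
have [W [bW W1 TW]] := polar_inv d_norm bT.
have pT := pos_absop d_norm bT.
have bWX : bounded_op (W \o X) by exact: bounded_comp.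
have pXX := pos_adjcomp d_norm bX; have pYY := pos_adjcomp d_norm bY.
have pWX := pos_compadj d_norm bWX.
have pS : pos_op (2^-1%:C *: (e%:C *: ((W \o X) \o adj (W \o X)) +
    e^-1%:C *: (adj Y \o Y)))%R.
  apply: pos_scale; first by rewrite invr_ge0.
  by apply: pos_add; apply: pos_scale; rewrite ?invr_ge0// ltW.
apply: le_trans (tau_mono tau_sing pT pS _) _.
  move=> v; rewrite scalefE addfE !scalefE ripZl ripDl !ripZl (rip_adjcomp d_norm)//.
  have -> : rip (absop T v) v = rip (Y v) (adj (W \o X) v).
    rewrite TW /= TE -[W (X _)]/((W \o X) _).
    by rewrite /real_ip (adjE d_norm).
  have := rip_adjcomp d_norm v (bounded_adj d_norm bWX).
  rewrite (adjK d_norm)// => ->.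
  set A := adj _ v; set B := Y v.
  have := rip_le d_norm B A; have := sqr_ge0 (e * N A - N B)%R.
  have h0 : (2 * (N B * N A) <= e * N A ^+ 2 + e^-1 * N B ^+ 2)%R.
    rewrite -subr_ge0 (_ : (_ - _)%R = e^-1 * (e * N A - N B) ^+ 2)%R.
      by rewrite mulr_ge0 ?sqr_ge0// invr_ge0 ltW.
    by field; rewrite gt_eqF.
  lra.
rewrite (tr_hom tau_sing) ?invr_ge0//; last first.
  by apply: pos_add; apply: pos_scale; rewrite ?invr_ge0// ltW.
rewrite (tr_add tau_sing); try by apply: pos_scale; rewrite ?invr_ge0// ltW.
rewrite !(tr_hom tau_sing) ?invr_ge0 ?(ltW e0)// wE EFinM.
rewrite lee_wpmul2l ?lee_fin ?invr_ge0// EFinD !EFinM leeD2r// lee_wpmul2l ?lee_fin ?(ltW e0)//.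
(* (W X) [adj (W X)] is the conjugate of X [adj X] by the contraction W, and X [adj X] has the same
   trace as [adj X] X. *)
rewrite -uE (adj_comp d_norm)// (tau_adjcomp tau_sing bX).
apply: le_trans (_ : tau (W \o (X \o adj X) \o adj W) <= _) _; first by [].
apply: tau_conj => //; exact: pos_compadj.
Qed.

Lemma absop_comp_sqr a : bounded_op a -> adj a \o a = op_pow (absop a) 2.
Proof.
move=> ba; have pa := pos_absop d_norm ba.
have n0 : (1 + 1 != 0 :> R)%R by rewrite gt_eqF// addr_gt0.
rewrite (_ : 2 = 1 + 1)%R// -(op_pow_mul pa ler01 ler01 n0) (op_pow1 d_norm pa).
by apply/funext => v /=; rewrite absop_sqr.
Qed.

(* With B = T^(1-q/2), P = (a B)* (a B) and v = a* a B u one has B v = P u and,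
   by Cauchy-Schwarz, |v|^4 <= |a v|^2 <P u, u>.  Jensen's and Young's
   inequalities bound |a v|^2 |B v|^2 by |v|^2 <K v, v>, where K is the weighted
   sum of |a|^p and T^q. *)
Lemma tau_gram_le a T p q t x y : in_ideal a -> pos_op T -> tau T < +oo ->
  (2 < p)%R -> (q = p / (p - 1))%R -> (0 < t)%R ->
  tau (op_pow (absop a) p) = x%:E -> tau (op_pow T q) = y%:E ->
  tau (adj (a \o op_pow T (1 - q / 2)) \o (a \o op_pow T (1 - q / 2))) <=
    (2 / p * t `^ (p / 2) * x + (1 - 2 / p) * t `^ (- (1 - 2 / p)^-1) * y)%:E.
Proof.
move=> ia pT tT p2 qE t0 xE yE; have [ba ta] := ia.
have p0 : (0 < p)%R by lra.
have pm1 : (0 < p - 1)%R by lra.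
have pm2 : (0 < p - 2)%R by lra.
have q0 : (0 < q)%R by rewrite qE divr_gt0.
set j : R := (1 - q / 2)%R.
have jE : j = ((p - 2) / (2 * (p - 1)))%R by rewrite /j qE; field; rewrite gt_eqF.
have j0 : (0 < j)%R by rewrite jE divr_gt0// mulr_gt0.
set r : R := (2 / p)%R.
have rV : (p / 2 = r^-1)%R by rewrite invf_div.
have r0 : (0 < r)%R by rewrite divr_gt0.
have r1 : (r < 1)%R by rewrite ltr_pdivrMr// mul1r.
have r10 : (0 < 1 - r)%R by rewrite subr_gt0.
(* This matching of exponents lets Jensen's inequality lead from T^(2j), the square of B, exactly to
   T^q. *)
have jq : ((j + j) * (1 - r)^-1 = q)%R.
  by rewrite jE /r qE; field; rewrite !gt_eqF.
have pa := pos_absop d_norm ba.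
have pap : pos_op (op_pow (absop a) p) by apply: pos_op_pow => //; exact: ltW.
have pTq : pos_op (op_pow T q) by apply: pos_op_pow => //; exact: ltW.
have pB : pos_op (op_pow T j) by apply: pos_op_pow => //; exact: ltW.
set B := op_pow T j in pB *; have bB := pos_bounded pB.
set al : R := (r * t `^ (p / 2))%R; set be : R := ((1 - r) * t `^ (- (1 - r)^-1))%R.
have al0 : (0 <= al)%R by rewrite mulr_ge0 ?powR_ge0// ltW.
have be0 : (0 <= be)%R by rewrite mulr_ge0 ?powR_ge0// ltW.
pose K : H -> H := (al%:C *: op_pow (absop a) p + be%:C *: op_pow T q)%R.
have pK1 := pos_scale al0 pap; have pK2 := pos_scale be0 pTq.
have pK : pos_op K := pos_add pK1 pK2.
have tK : tau K = (al * x + be * y)%:E.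
  rewrite /K (tr_add tau_sing pK1 pK2) (tr_hom tau_sing al0 pap).
  by rewrite (tr_hom tau_sing be0 pTq) xE yE EFinD !EFinM.
have bZ : bounded_op (a \o B) by exact: bounded_comp.
have bA := bounded_adj d_norm ba; have bZA := bounded_adj d_norm bZ.
have pP := pos_adjcomp d_norm bZ.
rewrite -tK.
have Kform1 v : N v = 1%R -> (N (a v) ^+ 2 * N (B v) ^+ 2 <= rip (K v) v)%R.
  move=> v1; rewrite /K addfE !scalefE ripDl !ripZl.
  have -> : (N (a v) ^+ 2 = rip (op_pow (absop a) 2 v) v)%R.
    by rewrite -absop_comp_sqr// rip_adjcomp.
  rewrite -op_pow_rip//.
  have c1 : (1 < p / 2)%R by rewrite ltr_pdivlMr// mul1r.
  have c2 : (1 < (1 - r)^-1)%R by rewrite invf_gt1// gtrBl.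
  have hA := jensen_op_pow pa (ler0n R 2) c1 v1.
  have hB := jensen_op_pow pT (addr_ge0 (ltW j0) (ltW j0)) c2 v1.
  rewrite jq in hB; rewrite (_ : 2 * (p / 2) = p)%R in hA; last by field.
  have X0 : (0 <= rip (op_pow (absop a) 2 v) v)%R.
    by apply: pos_rip; apply: pos_op_pow.
  have Y0 : (0 <= rip (op_pow T (j + j) v) v)%R.
    by apply: pos_rip; apply: pos_op_pow => //; rewrite addr_ge0// ltW.
  have r01 : (0 < r < 1)%R by rewrite r0.
  apply: le_trans (young_weighted r01 t0 X0 Y0) _; rewrite -rV -/al -/be.
  exact: lerD (ler_wpM2l al0 hA) (ler_wpM2l be0 hB).
have Kform v : (N (a v) ^+ 2 * N (B v) ^+ 2 <= N v ^+ 2 * rip (K v) v)%R.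
  have [->|v0] := eqVneq v 0%R.
    by rewrite (lin0 ba.1) (lin0 bB.1) !rnorm0 expr0n mul0r mul0r.
  have Nv := rnorm_gt0 v0; have NvV : (0 <= (N v)^-1)%R by rewrite invr_ge0 ltW.
  have := Kform1 ((N v)^-1%:C *: v)%R.
  rewrite (linZ ba.1) (linZ bB.1) (linZ (pos_bounded pK).1) !rnormZr ripZl ripZr.
  rewrite ger0_norm// mulVf ?gt_eqF// => /(_ erefl) h.
  have N2 : (0 < (N v)^-1 ^+ 2)%R by rewrite exprn_gt0// invr_gt0.
  rewrite -(ler_pM2l N2) -(ler_pM2l N2); move: h.
  congr (_ <= _)%R; first by ring.
  by field; rewrite gt_eqF.
have KT : tau K < +oo by rewrite tK ltry.
apply: (@tau_spectral_le _ _ _ d_norm _ tau_sing _ _ (adj a \o a \o B)) => //.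
- apply: seq_compact_compl => //; apply: seq_compact_compr => //.
    exact: in_ideal_seq_compact.
  exact: ba.1.
- exact: finite_seq_compact.
- by apply: (bounded_comp _ bB).1; apply: bounded_comp.
move=> l u l0; rewrite (rip_adjcomp d_norm)// => rho0.
have PuE : (adj (a \o B) \o (a \o B)) u = B (adj a (a (B u))).
  by rewrite (adj_comp d_norm)//= (pos_adj d_norm pB).
rewrite PuE; set v := adj a (a (B u)) => hl.
have rho0' : (0 < N (a (B u)) ^+ 2)%R by [].
have Bv0 : (0 < N (B v) ^+ 2)%R by apply: lt_le_trans hl; rewrite mulr_gt0.
have v0 : v <> 0%R.
  by move=> v0; move: Bv0; rewrite v0 (lin0 bB.1) rnorm0 expr0n ltxx.
split=> //=; rewrite -/v.
have Nv : (0 < N v)%R by apply: rnorm_gt0; exact/eqP.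
have Nv2 : (0 < N v ^+ 2)%R by rewrite exprn_gt0.
have h1 : (N v ^+ 2 <= N (a v) * N (a (B u)))%R.
  apply: le_trans (rip_le d_norm _ _).
  by rewrite -(ripvv d_norm) {2}/v /real_ip -(adjE d_norm).
have h2 : (N v ^+ 2 * N v ^+ 2 <= N (a v) ^+ 2 * N (a (B u)) ^+ 2)%R.
  by rewrite -!exprMn -expr2 ler_pXn2r ?nnegrE ?mulr_ge0 ?rnorm_ge0 ?sqr_ge0.
rewrite -(ler_pM2l Nv2); apply: le_trans (Kform v).
(* With rho = |a B u|^2: l rho |v|^4 <= |B v|^2 |v|^4 <= |B v|^2 |a v|^2 rho. Cancelling rho leaves
   l |v|^4 <= |a v|^2 |B v|^2, to which [Kform] applies. *)
rewrite -(ler_pM2l rho0').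
have := ler_wpM2l (sqr_ge0 (N (B v))) h2.
have := ler_wpM2r (mulr_ge0 (ltW Nv2) (ltW Nv2)) hl.
lra.
Qed.

End Hoelder.

(** * Hoelder's inequality for all pairs of conjugate exponents *)

Section HoelderInequality.
Context {R : realType} {H : completeNormedModType R[i]}.
Local Notation N := (@rnorm R H).
Variable d : {dot H for Num.conj}.
Hypothesis d_norm : forall v : H, d v v = `|v| ^+ 2.
Local Notation rip := (real_ip d).
Local Notation adj := (adj d).
Local Notation pos_op := (pos_op d).
Local Notation absop := (absop d).
Implicit Types (S T X W K a b : H -> H) (M e c p q r : R).
Variable tau : (H -> H) -> \bar R.
Hypothesis tau_sing : singular_trace d tau.
Local Notation in_ideal := (in_ideal d tau).
Local Open Scope ereal_scope.

(** With [adj b = W \o be] and j = 1 - q/2, the product a b factors as (a be^j) (be^(q/2) [adj W]).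
    The AM-GM step separates the factors; the Gram operator of the first is estimated by
    [tau_gram_le], and that of the second has trace at most tau (be^q). *)
Lemma tau_young a b p q x y c : in_ideal a -> in_ideal b -> (2 <= p)%R ->
  (q = p / (p - 1))%R -> (0 < c)%R ->
  tau (op_pow (absop a) p) = x%:E -> tau (op_pow (absop (adj b)) q) = y%:E ->
  tau (absop (a \o b)) <= (c `^ p / p * x + c `^ (- q) / q * y)%:E.
Proof.
move=> ia ib p2 qE c0 xE yE; have [ba ta] := ia; have [bb tb] := ib.
have bab : bounded_op (a \o b) by exact: bounded_comp.
have bA := bounded_adj d_norm bb.
have [_ tbA] := in_ideal_adj d_norm tau_sing ib.
set be := absop (adj b) in yE tbA.
have pbe : pos_op be by exact: pos_absop.
have p0 : (0 < p)%R by lra.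
have pm1 : (0 < p - 1)%R by lra.
have q0 : (0 < q)%R by rewrite qE divr_gt0.
(* At p = 2 the Jensen power p/2 is 1 and 1 - 2/p vanishes; AM-GM with weight c^2 gives the claim
   directly. *)
have [pE|pn] := eqVneq p 2%R.
  have q2 : q = 2%R by rewrite qE pE; field.
  have h1 : tau (adj a \o a) = x%:E by rewrite (absop_comp_sqr d_norm)// -pE.
  have h2 : tau (adj b \o b) = y%:E.
    rewrite (tau_adjcomp tau_sing bb) -{1}(adjK d_norm bb).
    by rewrite (absop_comp_sqr d_norm)// -yE q2.
  apply: le_trans (tau_absop_comp d_norm tau_sing ba bb bab _ (exprn_gt0 2 c0) h1 h2) _ => //.
  rewrite lee_fin pE q2 powR_mulrn ?(ltW c0)// powR_invn ?(ltW c0)//; lra.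
have {}p2 : (2 < p)%R by rewrite lt_neqAle eq_sym pn.
have pm2 : (0 < p - 2)%R by rewrite subr_gt0.
set j : R := (1 - q / 2)%R.
have jE : j = ((p - 2) / (2 * (p - 1)))%R by rewrite /j qE; field; rewrite gt_eqF.
have j0 : (0 <= j)%R by rewrite jE divr_ge0 ?mulr_ge0// ltW.
have s0 : (0 < q / 2)%R by rewrite divr_gt0.
(* Chosen so that t^(p/2) = c^(p-q) and t^(-1/(1-2/p)) = c^(-2q). After multiplication by the AM-GM
   weight c^q these become c^p and c^(-q). *)
pose t := (c `^ (2 - 2 * q / p))%R.
have t0 : (0 < t)%R by exact: powR_gt0.
have hP := tau_gram_le d_norm tau_sing ia pbe tbA p2 qE t0 xE yE.
have pj : pos_op (op_pow be j) by exact: pos_op_pow.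
have ps : pos_op (op_pow be (q / 2)) by apply: pos_op_pow => //; exact: ltW.
rewrite -/j in hP.
set Z := a \o op_pow be j in hP.
have bZ : bounded_op Z by exact: (bounded_comp ba (pos_bounded pj)).
have [|u u0 uE] := tau_fin tau_sing (pos_adjcomp d_norm bZ).
  by apply: le_lt_trans hP _; exact: ltry.
have [W [bW W1 bWE]] := polar d_norm bA.
have bWa := bounded_adj d_norm bW.
have bE : b = be \o adj W.
  rewrite -{1}(adjK d_norm bb) bWE (adj_comp d_norm bW (pos_bounded pbe)).
  by rewrite (pos_adj d_norm pbe).
pose Y := op_pow be (q / 2) \o adj W.
have bY : bounded_op Y by exact: (bounded_comp (pos_bounded ps) bWa).
have YY : tau (adj Y \o Y) <= y%:E.
  rewrite (tau_adjcomp tau_sing bY) -yE; apply: (tau_mono tau_sing).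
  - exact: (pos_compadj d_norm bY).
  - exact: (pos_op_pow d_norm pbe (ltW q0)).
  move=> v; have qq : (q = q / 2 + q / 2)%R by field.
  rewrite [X in op_pow be X]qq (op_pow_rip d_norm v pbe s0).
  have := rip_adjcomp d_norm v (bounded_adj d_norm bY); rewrite (adjK d_norm bY) => ->.
  rewrite (adj_comp d_norm (pos_bounded ps) bWa) (adjK d_norm bW) (pos_adj d_norm ps).
  rewrite ler_pXn2r ?nnegrE ?rnorm_ge0//=.
  by have := W1 (op_pow be (q / 2) v); rewrite mul1r.
have [|w w0 wE] := tau_fin tau_sing (pos_adjcomp d_norm bY).
  by apply: le_lt_trans YY _; exact: ltry.
have TE v : (a \o b) v = Z (Y v).
  rewrite bE /Z /Y /=; congr (a _); rewrite -[RHS]/((op_pow be j \o op_pow be (q / 2)) _).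
  have jq : (j + q / 2 = 1)%R by rewrite /j subrK.
  have jn : (j + q / 2 != 0)%R by rewrite jq oner_eq0.
  by rewrite (op_pow_mul d_norm pbe j0 (ltW s0) jn) jq (op_pow1 d_norm pbe).
have cq : (0 < c `^ q)%R by exact: powR_gt0.
apply: le_trans (tau_absop_comp d_norm tau_sing bZ bY bab TE cq uE wE) _.
rewrite lee_fin.
move: hP YY; rewrite uE wE !lee_fin => hu hw.
have m1 : (t `^ (p / 2) = c `^ p * (c `^ q)^-1)%R.
  rewrite /t -powRrM (_ : (2 - 2 * q / p) * (p / 2) = p - q)%R; last first.
    by field; rewrite gt_eqF.
  by rewrite powRB// (gt_eqF c0) implybT.
have m2 : (t `^ (- (1 - 2 / p)^-1) = (c `^ q)^-1 * (c `^ q)^-1)%R.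
  rewrite /t -powRrM -!powRN -powRD ?(gt_eqF c0) ?implybT//.
  by congr (_ `^ _)%R; rewrite qE; field; rewrite !gt_eqF.
rewrite m1 m2 in hu; rewrite powRN.
(* The coefficient 1/q of c^(-q) y is the sum of (1 - 2/p)/2 from the Gram operator and 1/2 from the
   second factor. *)
have e1 : (q^-1 = (1 - 2 / p) / 2 + 2^-1)%R.
  by rewrite qE; field; rewrite !gt_eqF.
have h1 := ler_wpM2l (ltW cq) hu.
have cqV : (0 <= (c `^ q)^-1)%R by rewrite invr_ge0 ltW.
have h2 := ler_wpM2l cqV hw.
have h3 : (c `^ q * (2 / p * (c `^ p / c `^ q) * x +
      (1 - 2 / p) * ((c `^ q)^-1 / c `^ q) * y) =
    2 * (c `^ p / p * x) + (1 - 2 / p) * (c `^ q)^-1 * y)%R.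
  by field; rewrite !gt_eqF.
rewrite h3 in h1; rewrite e1; lra.
Qed.

(** The absolute value of [adj b] appears because b is factored with its positive part on the left,
    next to a. *)
Lemma tau_holder_ge2 a b p q : in_ideal a -> in_ideal b -> (2 <= p)%R ->
  (p^-1 + q^-1 = 1)%R ->
  tau (absop (a \o b)) <= tau (op_pow (absop a) p) `^ p^-1 *
                          tau (op_pow (absop (adj b)) q) `^ q^-1.
Proof.
move=> ia ib p2 pq; have p0 : (0 < p)%R by lra.
have pm1 : (0 < p - 1)%R by lra.
have qE : (q = p / (p - 1))%R.
  rewrite -[q]invrK (_ : q^-1 = 1 - p^-1)%R; last by rewrite -pq; ring.
  by field; rewrite !gt_eqF.
have q1 : (1 < q)%R by rewrite qE ltr_pdivlMr// mul1r; lra.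
have p1 : (1 <= p)%R by lra.
have [x x0 xE] := in_ideal_op_pow d_norm tau_sing ia p1.
have [y y0 yE] := in_ideal_op_pow d_norm tau_sing (in_ideal_adj d_norm tau_sing ib) (ltW q1).
have h c (c0 : (0 < c)%R) := tau_young ia ib p2 qE c0 xE yE.
suff : tau (absop (a \o b)) <= x%:E `^ p^-1 * y%:E `^ q^-1 by rewrite -xE -yE.
rewrite !poweR_EFin -EFinM.
have bab : bounded_op (a \o b) by apply: bounded_comp; [case: ia|case: ib].
have := tau_ge0 tau_sing (pos_absop d_norm bab).
move: (tau (absop _)) h => [z| |] // h z0; last first.
  by have := h 1%R ltr01; rewrite leye_eq.
rewrite lee_fin; apply: (holder_optimize x0 y0 _ q1 pq); first by lra.
by move=> c /h; rewrite lee_fin.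
Qed.

Lemma tau_op_pow_adj b q : bounded_op b -> (1 <= q)%R ->
  tau (op_pow (absop (adj b)) q) <= tau (op_pow (absop b) q).
Proof.
move=> bb q1; have [W [bW W1 ->]] := op_pow_absop_adj d_norm bb q1.
have q0 : (0 <= q)%R by rewrite (le_trans ler01).
exact: (tau_conj d_norm tau_sing bW W1 (pos_op_pow d_norm (pos_absop d_norm bb) q0)).
Qed.

Lemma tau_absop_comp_adj a b : bounded_op a -> bounded_op b ->
  tau (absop (a \o b)) <= tau (absop (adj b \o adj a)).
Proof.
move=> ba bb; have bab := bounded_comp ba bb.
rewrite -{1}(adjK d_norm bab) -(adj_comp d_norm ba bb).
by apply: (tau_absop_adj d_norm tau_sing) => //; exact: bounded_adj.
Qed.

Lemma tau_holder a b p q : in_ideal a -> in_ideal b -> (1 < p)%R -> (1 < q)%R ->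
  (p^-1 + q^-1 = 1)%R ->
  tau (absop (a \o b)) <= tau (op_pow (absop a) p) `^ p^-1 *
                          tau (op_pow (absop b) q) `^ q^-1.
Proof.
move=> ia ib p1 q1 pq; have [ba _] := ia; have [bb _] := ib.
have bB := bounded_adj d_norm bb; have bA := bounded_adj d_norm ba.
have pw (T : H -> H) s : bounded_op T -> (1 < s)%R -> 0 <= tau (op_pow (absop T) s).
  move=> bT s1; have s0 : (0 <= s)%R by lra.
  exact: (tau_ge0 tau_sing (pos_op_pow d_norm (pos_absop d_norm bT) s0)).
have sV (s : R) : (1 < s)%R -> (0 <= s^-1)%R by move=> s1; rewrite invr_ge0; lra.
(* The bound has this shape for every p: if p < 2, then q > 2, and the case of a large first
   exponent is applied to [adj b] and [adj a], where the double adjoint restores a. *)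
have B : tau (absop (a \o b)) <= tau (op_pow (absop a) p) `^ p^-1 *
                          tau (op_pow (absop (adj b)) q) `^ q^-1.
  have [p2|p2] := leP 2%R p; first exact: tau_holder_ge2.
  have q2 : (2 <= q)%R.
    have p0 : (0 < p)%R by lra.
    have q0 : (0 < q)%R by lra.
    have e : (p * q = p + q)%R.
      by rewrite -[LHS]mulr1 -pq; field; rewrite !gt_eqF.
    by nra.
  apply: le_trans (tau_absop_comp_adj ba bb) _.
  have qp : (q^-1 + p^-1 = 1)%R by rewrite addrC.
  have := tau_holder_ge2 (in_ideal_adj d_norm tau_sing ib)
    (in_ideal_adj d_norm tau_sing ia) q2 qp.
  by rewrite (adjK d_norm ba) muleC.
have mono (u v : \bar R) : 0 <= u -> 0 <= v -> u <= v -> u `^ q^-1 <= v `^ q^-1.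
  move=> u0 v0; apply: gt0_ler_poweR; first exact: sV.
    by rewrite in_itv /= u0 leey.
  by rewrite in_itv /= v0 leey.
have h := mono _ _ (pw _ _ bB q1) (pw _ _ bb q1) (tau_op_pow_adj bb (ltW q1)).
exact: le_trans B (lee_wpmul2l (poweR_ge0 _ _) h).
Qed.

(** |a b| = w a v |b| with contractions w and v, and w a v divided by the norm of a is again a
    contraction, so [tau_half] applies. A zero norm is treated apart. *)
Lemma tau_bounded_l a b : bounded_op a -> in_ideal b ->
  tau (absop (a \o b)) <= (opnorm a)%:E * tau (absop b).
Proof.
move=> ba [bb tb]; have bab := bounded_comp ba bb.
have pb := pos_absop d_norm bb; have pT := pos_absop d_norm bab.
have [w [bw w1 wE]] := polar_inv d_norm bab.
have [v [bv v1 vE]] := polar d_norm bb.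
have ha := opnorm_bnd ba; have n0 := opnorm_ge0 ba; set n := opnorm a in ha n0 *.
rewrite -(tr_hom tau_sing n0 pb).
have pnb := pos_scale n0 pb.
have [nE|nn] := eqVneq n 0%R.
  apply: (@tau_half _ _ d d_norm tau tau_sing _ id) => //.
  - exact: bounded_id.
  - by move=> u; rewrite mul1r.
  move=> u; rewrite wE /= scalefE nE scale0r (_ : a (b u) = 0)%R ?(lin0 bw.1)//.
  apply: rnorm0_eq0; apply/eqP; rewrite eq_le rnorm_ge0 andbT.
  by have := ha (b u); rewrite nE mul0r.
have np : (0 < n)%R by rewrite lt_neqAle eq_sym nn.
apply: (@tau_half _ _ d d_norm tau tau_sing _ (n^-1%:C *: (w \o a \o v))%R) => //.
- by apply: bounded_scale; apply: (bounded_comp _ bv); exact: bounded_comp.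
- move=> u; rewrite scalefE rnormZr ger0_norm ?invr_ge0 ?(ltW np)//= mul1r.
  rewrite ler_pdivrMl//; apply: le_trans (w1 _) _; rewrite mul1r.
  by apply: le_trans (ha _) _; rewrite ler_pM2l//; have := v1 u; rewrite mul1r.
move=> u; rewrite !scalefE /= (linZ bv.1) (linZ ba.1) (linZ bw.1) scalerA.
rewrite -rmorphM mulVf ?gt_eqF// scale1r wE /=; congr (w (a _)).
by rewrite {1}vE.
Qed.

Lemma tau_bounded_r a b : in_ideal a -> bounded_op b ->
  tau (absop (a \o b)) <= tau (absop a) * (opnorm b)%:E.
Proof.
move=> ia bb; have [ba ta] := ia.
apply: le_trans (tau_absop_comp_adj ba bb) _.
have bA := bounded_adj d_norm ba; have bB := bounded_adj d_norm bb.
apply: le_trans (tau_bounded_l bB (in_ideal_adj d_norm tau_sing ia)) _.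
rewrite muleC; apply: lee_pmul.
- exact: (tau_ge0 tau_sing (pos_absop d_norm bA)).
- by rewrite lee_fin opnorm_ge0.
- exact: (tau_absop_adj d_norm tau_sing).
rewrite lee_fin; apply: opnorm_le; first exact: opnorm_ge0.
by apply: bnd_adj => //; [exact: opnorm_ge0|exact: opnorm_bnd].
Qed.

(** As the inverse of [+oo] is 0, an infinite exponent forces the other one to be 1, and both cannot
    be infinite. The endpoint cases are the bounds by the operator norm. *)
Lemma tau_holder_ext a b (p q : \bar R) : in_ideal a -> in_ideal b ->
  1 <= p -> 1 <= q -> p^-1 + q^-1 = 1 ->
  tau (absop (a \o b)) <= tr_norm d tau p a * tr_norm d tau q b.
Proof.
move=> ia ib; have [ba ta] := ia; have [bb tb] := ib.
have pa := pos_absop d_norm ba; have pb := pos_absop d_norm bb.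
case: p => [p| |]//; case: q => [q| |]//; rewrite ?lee_fin => p1 q1 /=.
- have p0 : (p != 0)%R by rewrite gt_eqF// (lt_le_trans ltr01).
  have q0 : (q != 0)%R by rewrite gt_eqF// (lt_le_trans ltr01).
  rewrite !inver (negbTE p0) (negbTE q0) -EFinD => -[pq].
  have pV : (0 < p^-1)%R by rewrite invr_gt0 (lt_le_trans ltr01).
  have qV : (0 < q^-1)%R by rewrite invr_gt0 (lt_le_trans ltr01).
  apply: tau_holder => //.
    rewrite lt_neqAle p1 andbT; apply: contraTneq qV => p1'.
    by rewrite -p1' invr1 in pq; lra.
  rewrite lt_neqAle q1 andbT; apply: contraTneq pV => q1'.
  by rewrite -q1' invr1 in pq; lra.
- have p0 : (p != 0)%R by rewrite gt_eqF// (lt_le_trans ltr01).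
  rewrite inver (negbTE p0) invey adde0 => -[pE].
  have -> : p = 1%R by rewrite -[p]invrK pE invr1.
  rewrite invr1 (op_pow1 d_norm)// poweRe1 ?(tau_ge0 tau_sing)//.
  exact: tau_bounded_r.
- have q0 : (q != 0)%R by rewrite gt_eqF// (lt_le_trans ltr01).
  rewrite inver (negbTE q0) invey add0e => -[qE].
  have -> : q = 1%R by rewrite -[q]invrK qE invr1.
  rewrite invr1 (op_pow1 d_norm)// poweRe1 ?(tau_ge0 tau_sing)//.
  exact: tau_bounded_l.
- by rewrite invey adde0 => -[/eqP]; rewrite eq_sym oner_eq0.
Qed.

End HoelderInequality.

(** With s = sqrt (r - 1) one has r = s^2 + 1, and the upper bound is 2 s <= s^2 + 1. *)
Lemma holder_const_bounds (R : realType) (p : \bar R) :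
  (1 <= p)%E -> 1 <= holder_const p <= 2.
Proof.
case: p => [r| |] // r1; last by rewrite /= lexx ler1n.
rewrite lee_fin in r1; have r0 : 0 < r by lra.
have s0 := sqrtr_ge0 (r - 1); have r10 : 0 <= r - 1 by lra.
have := sqr_sqrtr r10; have := sqr_ge0 (Num.sqrt (r - 1) - 1).
rewrite /holder_const; set s := Num.sqrt _ in s0 * => h1 h2.
rewrite lerDl mulr_ge0 ?divr_ge0 ?(ltW r0)//=.
rewrite -lerBrDl mulrA ler_pdivrMr//.
have : (s - 1) ^+ 2 = s ^+ 2 - 2 * s + 1 by ring.
lra.
Qed.

Local Open Scope ereal_scope.

Theorem theorem5p1 (R : realType) (H : completeNormedModType R[i])
    (d : {dot H for Num.conj})
    (d_norm : forall v : H, d v v = (`|v| ^+ 2)%R)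
    (H_infdim : ~ fin_dim [set: H])
    (tau : (H -> H) -> \bar R) (tau_sing : singular_trace d tau) :
  [/\ forall p : \bar R, 1 <= p -> (1 <= holder_const p <= 2)%R,
      forall (a b : H -> H) (p q : \bar R),
        tr_dom d tau a -> tr_dom d tau b ->
        1 <= p -> 1 <= q -> p^-1 + q^-1 = 1 ->
        (complex.Re `|tr_ext d tau (a \o b)|)%:E <= tau (absop d (a \o b)) /\
        tau (absop d (a \o b)) <=
          (holder_const p)%:E * tr_norm d tau p a * tr_norm d tau q b
    & forall phi : (R -> R) -> \bar R,
        generated_by d tau phi -> monotone_functional phi ->
      forall (a b : H -> H) (p q : \bar R),
        tr_dom d tau a -> tr_dom d tau b ->
        1 <= p -> 1 <= q -> p^-1 + q^-1 = 1 ->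
        (complex.Re `|tr_ext d tau (a \o b)|)%:E <= tau (absop d (a \o b)) /\
        tau (absop d (a \o b)) <=
          1%:E * tr_norm d tau p a * tr_norm d tau q b].
Proof.
have main (a b : H -> H) (p q : \bar R) : tr_dom d tau a -> tr_dom d tau b ->
    1 <= p -> 1 <= q -> p^-1 + q^-1 = 1 ->
    (complex.Re `|tr_ext d tau (a \o b)|)%:E <= tau (absop d (a \o b)) /\
    tau (absop d (a \o b)) <= tr_norm d tau p a * tr_norm d tau q b.
  move=> da db p1 q1 pq; split.
    apply: (tr_ext_le d_norm tau_sing).
    exact: (bounded_comp (tr_dom_bounded da) (tr_dom_bounded db)).
  exact: (tau_holder_ext d_norm tau_sing (tr_dom_in_ideal d_norm tau_sing da)
    (tr_dom_in_ideal d_norm tau_sing db)).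
have norm_ge0 (p : \bar R) (a : H -> H) : tr_dom d tau a -> 1 <= p ->
    0 <= tr_norm d tau p a.
  move=> /tr_dom_bounded ba; case: p => [r| |] //= _; first exact: poweR_ge0.
  by rewrite lee_fin opnorm_ge0.
split; first exact: holder_const_bounds.
  move=> a b p q da db p1 q1 pq; have [h1 h2] := main a b p q da db p1 q1 pq.
  split=> //; apply: le_trans h2 _.
  have Ng := norm_ge0 _ _ da p1; have Ng' := norm_ge0 _ _ db q1.
  (* [main] gives the bound with constant 1, and the factor [holder_const p] >= 1 only enlarges the
     right-hand side. *)
  apply: lee_wpmul2r => //; rewrite -[leLHS]mul1e; apply: lee_wpmul2r => //.
  by rewrite lee_fin; case/andP: (holder_const_bounds p1).
move=> phi _ _ a b p q da db p1 q1 pq; rewrite mul1e.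
exact: main.
Qed.
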